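(* Let $\mathcal T$ be a reduced T-mesh (on a simply connected domain with connected interior), $\mathbf r$ a smoothness distribution on $\mathcal T$ that is constant along each maximal segment, and $m,m'\ge0$ integers. Then $$\dim\mathcal S_{m,m'}^{\mathbf r}(\mathcal T)=\chi\bigl(\mathcal Q_{m,m'}^{\mathbf r}(\mathcal T^\circ)\bigr)+\dim\mathcal H_{m,m'}^{\mathbf r}\bigl(\operatorname{CNDC}_{m,m'}^{\mathbf r}(\mathcal T);\mathcal T\bigr).$$
   Context: **T-meshes.** Coordinates on $\mathbb R^2$ are $(s,t)$, with $s$ horizontal and $t$ vertical. Let $\Omega\subset\mathbb R^2$ be a finite union of closed axis-aligned rectangles with pairwise disjoint interiors, with $\Omega$ simply connected and $\Omega^\circ$ connected. A T-mesh on $\Omega$ is a triple $\mathcal T=(\mathcal T_2,\mathcal T_1,\mathcal T_0)$: $\mathcal T_2$ is the finite set of these closed rectangles (cells); $\mathcal T_1=\mathcal T_1^h\cup\mathcal T_1^v$ is a finite set of closed horizontal and vertical segments (edges) contained in $\bigcup_{\sigma\in\mathcal T_2}\partial\sigma$; $\mathcal T_0$ is the set of endpoints of edges (vertices); each $\partial\sigma$ is a finite union of edges; distinct cells $\sigma,\sigma'$ satisfy $\sigma\cap\sigma'=\partial\sigma\cap\partial\sigma'$, a finite union of edges and vertices; distinct edges meet only in vertices. Interior edges $\mathcal T_1^\circ$ are the edges meeting $\Omega^\circ$; the other edges are boundary edges. Interior vertices $\mathcal T_0^\circ$ are the vertices in $\Omega^\circ$. **Maximal segments.** A segment is a connected union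 of edges lying on one straight line. $\operatorname{MS}(\mathcal T)$ is the set of maximal segments consisting of interior edges. Such a segment is a cross-cut if both endpoints lie on $\partial\Omega$, a ray if exactly one does, and a maximal interior segment (MIS) if it does not meet $\partial\Omega$; $\operatorname{MIS}(\mathcal T)=\operatorname{MIS}_h(\mathcal T)\cup\operatorname{MIS}_v(\mathcal T)$ (horizontal/vertical). A boundary maximal segment is a maximal connected union of boundary edges on one line. $\widehat{\operatorname{MS}}(\mathcal T)$ is the set of all cross-cuts, rays, MISs and boundary maximal segments. $\mathcal T$ is reduced if no vertex is inserted merely to divide a straight edge into two collinear edges, every vertex lies on exactly one horizontal and exactly one vertical member of $\widehat{\operatorname{MS}}(\mathcal T)$, and the edges are exactly the closed subsegments between consecutive vertices on these members (so an interior and a boundary maximal segment of the same direction never meet collinearly at a common endpoint). **Smoothness.** A smoothness distribution is a map $\mathbf r:\mathcal T_1\to\{-1,0,1,\dots\}$ equal to $-1$ on boundary edges. It is constant along each maximal segment if for every $\rho\in\operatorname{MS}(\mathcal T)$ all edges $\tau\subset\rho$ have the same value $\mathbf r(\tau)=:r(\rho)$. For $\gamma\in\mathcal T_0^\circ$ with horizontal and vertical maximal segments $\rho_h(\gamma),\rho_v(\gamma)$ through it, $r_h(\gamma):=r(\rho_v(\gamma))$ and $r_v(\gamma):=r(\rho_h(\gamma))$. **Spline space and Euler characteristic.** $R_{a,b}=\operatorname{span}_{\mathbb R}\{s^it^j:0\le i\le a,\,0\le j\le b\}$, and $R_{a,b}=0$ if $a<0$ or $b<0$. $\mathcal S_{m,m'}^{\mathbf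 r}(\mathcal T)$ is the space of piecewise polynomial functions $f$ on $\Omega$ with $f|_\sigma\in R_{m,m'}$ for every cell $\sigma$ and $f$ of class $C^{\mathbf r(\tau)}$ across every interior edge $\tau$; $C^{-1}$ means no matching condition, so $f$ is regarded as a family of polynomials $(f_\sigma)_{\sigma\in\mathcal T_2}$. ($C^r$ across $\tau=$ common edge of $\sigma,\sigma'$ means $f_\sigma-f_{\sigma'}$ is divisible by $\ell_\tau^{r+1}$, where $\ell_\tau$ is a nonzero affine linear polynomial vanishing on the line of $\tau$.) Put $I_\tau^{\mathbf r}=\langle\ell_\tau^{\mathbf r(\tau)+1}\rangle\cap R_{m,m'}$ for $\tau\in\mathcal T_1^\circ$ and $I_\gamma^{\mathbf r}=\sum_{\tau\ni\gamma,\tau\in\mathcal T_1^\circ}I_\tau^{\mathbf r}$ for $\gamma\in\mathcal T_0^\circ$. $\mathcal Q_{m,m'}^{\mathbf r}(\mathcal T^\circ)$ is the complex $0\to\bigoplus_{\sigma\in\mathcal T_2}[\sigma]R_{m,m'}\to\bigoplus_{\tau\in\mathcal T_1^\circ}[\tau]R_{m,m'}/I_\tau^{\mathbf r}\to\bigoplus_{\gamma\in\mathcal T_0^\circ}[\gamma]R_{m,m'}/I_\gamma^{\mathbf r}\to0$ with maps induced by the cellular boundary maps relative to $\partial\Omega$; its Euler characteristic is $\chi(\mathcal Q_{m,m'}^{\mathbf r}(\mathcal T^\circ))=\sum_{\sigma\in\mathcal T_2}\dim R_{m,m'}-\sum_{\tau\in\mathcal T_1^\circ}\dim(R_{m,m'}/I_\tau^{\mathbf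 r})+\sum_{\gamma\in\mathcal T_0^\circ}\dim(R_{m,m'}/I_\gamma^{\mathbf r})$. **Correction spaces.** For a maximal segment $\rho$, $\ell_\rho$ is a nonzero affine linear polynomial vanishing on the line of $\rho$ (normalised as $s-s_0$ for $s=s_0$, $t-t_0$ for $t=t_0$). For an MIS $\rho$, $\mathcal B_\rho=R_{m,m'-r(\rho)-1}$ if $\rho$ is horizontal and $\mathcal B_\rho=R_{m-r(\rho)-1,m'}$ if $\rho$ is vertical. For $\mathcal A\subseteq\operatorname{MIS}(\mathcal T)$, $\mathcal M(\mathcal A)=\bigoplus_{\rho\in\mathcal A}[\rho]\mathcal B_\rho$ ($[\rho]$ a formal symbol). $\mathcal R(\mathcal T)\subseteq\mathcal M(\operatorname{MIS}(\mathcal T))$ is the subspace spanned by the vertex relations, for each interior vertex $\gamma=\rho_h\cap\rho_v$ ($\rho_h$ horizontal, $\rho_v$ vertical maximal segment) and each $q\in R_{m-r(\rho_v)-1,\,m'-r(\rho_h)-1}$: if both $\rho_h,\rho_v$ are MISs, $[\rho_v]\ell_{\rho_h}^{r(\rho_h)+1}q-[\rho_h]\ell_{\rho_v}^{r(\rho_v)+1}q$; if exactly one of them is an MIS, the same expression with the term of the non-MIS segment omitted. Put $\mathcal R_{\mathcal A}(\mathcal T):=\mathcal M(\mathcal A)\cap\mathcal R(\mathcal T)$ and $\mathcal H_{m,m'}^{\mathbf r}(\mathcal A;\mathcal T):=\mathcal M(\mathcal A)/\mathcal R_{\mathcal A}(\mathcal T)$. **Absolute weights.** A deletion state is a pair $(\mathcal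 A,\mathcal B)$ with $\mathcal A\cap\mathcal B=\varnothing$, $\mathcal A\cup\mathcal B=\operatorname{MIS}(\mathcal T)$. For $\rho\in\mathcal A$, $\operatorname{Mono}_{(\mathcal A,\mathcal B)}(\rho)$ is the set of vertices on $\rho$ lying on no MIS in $\mathcal A\setminus\{\rho\}$. With $(a)_+=\max\{a,0\}$, $\mu_h(\gamma)=(m-r_h(\gamma))_+$, $\mu_v(\gamma)=(m'-r_v(\gamma))_+$. The absolute weight $\Omega_{(\mathcal A,\mathcal B)}(\rho)$ is $\sum_{\gamma\in\operatorname{Mono}_{(\mathcal A,\mathcal B)}(\rho)}\mu_h(\gamma)$ for $\rho$ horizontal and $\sum_{\gamma\in\operatorname{Mono}_{(\mathcal A,\mathcal B)}(\rho)}\mu_v(\gamma)$ for $\rho$ vertical. The threshold is $\theta(\rho)=m+1$ for $\rho$ horizontal, $m'+1$ for $\rho$ vertical. An MIS $\rho\in\mathcal A$ is diagonalizable at $(\mathcal A,\mathcal B)$ if $\Omega_{(\mathcal A,\mathcal B)}(\rho)\ge\theta(\rho)$. **Deletion algorithm and weighted CNDC.** Start with $\mathcal A=\operatorname{MIS}(\mathcal T)$, $\mathcal B=\varnothing$. In each pass let $\mathcal Z$ be the set of all $\rho\in\mathcal A$ diagonalizable at $(\mathcal A,\mathcal B)$, and replace $\mathcal A$ by $\mathcal A\setminus\mathcal Z$ and $\mathcal B$ by $\mathcal B\cup\mathcal Z$; repeat until a pass has $\mathcal Z=\varnothing$. The final $\mathcal A$ is the weighted CNDC $\operatorname{CNDC}_{m,m'}^{\mathbf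 r}(\mathcal T)$. *)

(* Defs.v *)
From HB Require Import structures.
From mathcomp Require Import all_boot all_order all_algebra finmap.
From mathcomp Require Import all_classical all_reals all_analysis.
Set Implicit Arguments.
Unset Strict Implicit.
Unset Printing Implicit Defensive.
Import Order.TTheory GRing.Theory Num.Theory.
Import numFieldNormedType.Exports.
Local Open Scope classical_set_scope.
Local Open Scope ring_scope.

Section Topology.
Context {R : realType} {X : topologicalType}.

Local Notation I01 := (`[0, 1]%classic : set R).

Definition frontier (A : set X) : set X := closure A `\` A°.

Definition path_connected (A : set X) : Prop :=
  forall x y, A x -> A y -> exists f : R -> X,
    [/\ {within I01, continuous f}, f 0 = x, f 1 = y
      & forall t, I01 t -> A (f t)].

(* [h (0, _)] is the loop [f] and [h (1, _)] the constant loop; the homotopy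
   fixes the base point. *)
Definition null_homotopic (A : set X) (f : R -> X) : Prop :=
  exists h : R * R -> X,
    [/\ {within I01 `*` I01, continuous h},
        forall u t, I01 u -> I01 t -> A (h (u, t)),
        forall t, I01 t -> h (0, t) = f t,
        forall t, I01 t -> h (1, t) = f 0
      & forall u, I01 u -> h (u, 0) = f 0 /\ h (u, 1) = f 0].

Definition simply_connected (A : set X) : Prop :=
  path_connected A /\
  forall f : R -> X, {within I01, continuous f} -> f 0 = f 1 ->
    (forall t, I01 t -> A (f t)) -> null_homotopic A f.

End Topology.
Arguments path_connected R {X} A.
Arguments simply_connected R {X} A.

Section LinearAlgebra.
Context {K : fieldType} {V : vectType K}.
Implicit Types (A : set V) (U W : {vspace V}).

Lemma spanning_seq A : exists2 s : seq V,
  (forall v, v \in s -> A v) & (forall v, A v -> v \in span s).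
Proof.
pose P n := `[< exists s : seq V, (forall v, v \in s -> A v) /\ \dim (span s) = n >].
have exP : exists n, P n.
  by exists (\dim (span [::] : {vspace V})); apply/asboolP; exists [::].
have leP n : P n -> (n <= \dim {:V})%N.
  by move=> /asboolP[s [_ <-]]; apply/dimvS/subvf.
case: (ex_maxnP exP leP) => n /asboolP[s [sA sn]] nmax.
exists s => // v Av.
have : P (\dim (span (v :: s))).
  apply/asboolP; exists (v :: s); split => // w.
  by rewrite inE => /predU1P[->//|/sA].
move=> /nmax; rewrite -sn => le_dim.
have sub : (span s <= span (v :: s))%VS by rewrite span_cons addvSr.
have /eqP -> : (span s == span (v :: s))%VS by rewrite eqEdim sub.
by rewrite memv_span // mem_head.
Qed.

(* the subspace spanned by an arbitrary set, characterized by [vspan_spec] below *)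
Definition vspan A : {vspace V} :=
  xget 0%VS [set U : {vspace V} | (forall v, A v -> v \in U) /\
    forall W, (forall v, A v -> v \in W) -> (U <= W)%VS].

Lemma vspan_spec A : (forall v, A v -> v \in vspan A) /\
  forall W, (forall v, A v -> v \in W) -> (vspan A <= W)%VS.
Proof.
rewrite /vspan; case: xgetP => [U _ //|noU]; exfalso.
have [s sA As] := spanning_seq A.
by apply: (noU (span s)); split => // W AW; apply/span_subvP => v /sA/AW.
Qed.

Lemma sub_vspan A v : A v -> v \in vspan A.
Proof. exact: (vspan_spec A).1. Qed.

Lemma vspan_sub A W : (forall v, A v -> v \in W) -> (vspan A <= W)%VS.
Proof. exact: (vspan_spec A).2. Qed.

Lemma mem_vspan A v :
  A 0 -> (forall a u w, A u -> A w -> A (a *: u + w)) ->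
  v \in vspan A <-> A v.
Proof.
move=> A0 Alin; split; last exact: sub_vspan.
have [s sA As] := spanning_seq A => /(subvP (vspan_sub As)) vs.
rewrite (coord_span (X := in_tuple s) vs).
apply: (big_ind A) => // [x y Ax Ay|i _].
  by rewrite -[x]scale1r; apply: Alin.
by rewrite -[_ *: _]addr0; apply: Alin => //; apply/sA/mem_nth.
Qed.

(* The quotient U / (U :&: W), represented by a complement of U :&: W in U,
   onto which it projects isomorphically. *)
Definition quotv U W : {vspace V} := (U :\: W)%VS.

End LinearAlgebra.

Section Geometry.
Context {R : realType}.

Record rect := Rect { rx0 : R; rx1 : R; ry0 : R; ry1 : R }.

(* [lhor] tells horizontal from vertical, [lpos] is the constant coordinate
   ([t] if horizontal, [s] if vertical), and [llo], [lhi] bound the other one *)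
Record lseg := LSeg { lhor : bool; lpos : R; llo : R; lhi : R }.

Definition rect_tuple (c : rect) := (rx0 c, rx1 c, ry0 c, ry1 c).
Definition tuple_rect (c : R * R * R * R) :=
  let: (a, b, c, d) := c in Rect a b c d.
Lemma rect_tupleK : cancel rect_tuple tuple_rect. Proof. by case. Qed.
HB.instance Definition _ := Choice.copy rect (can_type rect_tupleK).

Definition lseg_tuple (e : lseg) := (lhor e, lpos e, llo e, lhi e).
Definition tuple_lseg (e : bool * R * R * R) :=
  let: (h, p, a, b) := e in LSeg h p a b.
Lemma lseg_tupleK : cancel lseg_tuple tuple_lseg. Proof. by case. Qed.
HB.instance Definition _ := Choice.copy lseg (can_type lseg_tupleK).

Definition rect_pts (c : rect) : set (R * R) :=
  `[rx0 c, rx1 c]%classic `*` `[ry0 c, ry1 c]%classic.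

Definition lseg_pts (e : lseg) : set (R * R) :=
  if lhor e then `[llo e, lhi e]%classic `*` [set lpos e]
  else [set lpos e] `*` `[llo e, lhi e]%classic.

Definition lseg_end0 (e : lseg) : R * R :=
  if lhor e then (llo e, lpos e) else (lpos e, llo e).

Definition lseg_end1 (e : lseg) : R * R :=
  if lhor e then (lhi e, lpos e) else (lpos e, lhi e).

Definition lsegs_pts (E : {fset lseg}) : set (R * R) :=
  \bigcup_(e in [set` E]) lseg_pts e.

End Geometry.
Arguments rect R : clear implicits.
Arguments lseg R : clear implicits.

Record tmesh (R : realType) := TMesh {
  cells : {fset rect R};
  edges : {fset lseg R}
}.

Section TMesh.
Context {R : realType}.
Implicit Types (T : tmesh R) (E : {fset lseg R}) (e rho : lseg R).

Definition domain T : set (R * R) :=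
  \bigcup_(c in [set` cells T]) rect_pts c.

Definition vertices T : {fset R * R} :=
  ([fset lseg_end0 e | e in edges T] `|` [fset lseg_end1 e | e in edges T])%fset.

Record is_tmesh T : Prop := IsTMesh {
  cell_proper : forall c, c \in cells T -> rx0 c < rx1 c /\ ry0 c < ry1 c;
  cell_disjoint : forall c c', c \in cells T -> c' \in cells T -> c != c' ->
    (rect_pts c)° `&` (rect_pts c')° = set0;
  domain_simply_connected : simply_connected R (domain T);
  domain_interior_connected : connected (domain T)°;
  edge_proper : forall e, e \in edges T -> llo e < lhi e;
  edge_sub : forall e, e \in edges T ->
    lseg_pts e `<=` \bigcup_(c in [set` cells T]) frontier (rect_pts c);
  cell_frontier : forall c, c \in cells T -> exists E,
    (E `<=` edges T)%fset /\ frontier (rect_pts c) = lsegs_pts E;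
  cell_meet : forall c c', c \in cells T -> c' \in cells T -> c != c' ->
    rect_pts c `&` rect_pts c' =
      frontier (rect_pts c) `&` frontier (rect_pts c') /\
    exists E (W : {fset R * R}),
      [/\ (E `<=` edges T)%fset, (W `<=` vertices T)%fset
        & rect_pts c `&` rect_pts c' = lsegs_pts E `|` [set` W]];
  edge_meet : forall e e', e \in edges T -> e' \in edges T -> e != e' ->
    lseg_pts e `&` lseg_pts e' `<=` [set` vertices T]
}.

Definition meets_interior T e : Prop := lseg_pts e `&` (domain T)° !=set0.

Definition int_edges T : {fset lseg R} :=
  [fset e in edges T | `[< meets_interior T e >]]%fset.

Definition bnd_edges T : {fset lseg R} := (edges T `\` int_edges T)%fset.

Definition int_vertices T : {fset R * R} :=
  [fset p in vertices T | `[< (domain T)° p >]]%fset.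

(* A finite union of axis-parallel edges is connected and contained in a line
   exactly when it is the point set of some [rho : lseg R]. *)
Definition is_segment E rho : Prop :=
  llo rho < lhi rho /\
  exists E', (E' `<=` E)%fset /\ lseg_pts rho = lsegs_pts E'.

Definition is_max_segment E rho : Prop :=
  is_segment E rho /\
  forall rho', is_segment E rho' -> lseg_pts rho `<=` lseg_pts rho' ->
    rho' = rho.

(* Such a segment starts where some edge starts and ends where some edge ends,
   so filtering this finite set loses nothing: see [max_segmentsP]. *)
Definition max_segments E : {fset lseg R} :=
  [fset rho in
     [fset LSeg (lhor e) (lpos e) (llo e) (lhi e') | e in E, e' in E]
   | `[< is_max_segment E rho >]]%fset.

Lemma lseg_sub e rho : llo e < lhi e -> lseg_pts e `<=` lseg_pts rho ->
  [/\ lhor e = lhor rho, lpos e = lpos rho, llo rho <= llo e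
    & lhi e <= lhi rho].
Proof.
case: e rho => [h p a b] [k q c d] /= ab.
rewrite /lseg_pts /= => sub.
have ain : `[a, b]%classic a by rewrite /= in_itv /= lexx ltW.
have bin : `[a, b]%classic b by rewrite /= in_itv /= lexx ltW.
case: h k sub => [] [] sub.
- have [/= + ->] := sub (a, p) (conj ain erefl).
  have [/= + _] := sub (b, p) (conj bin erefl).
  by rewrite !in_itv /= => /andP[_ ->] /andP[-> _].
- have [/= aq _] := sub (a, p) (conj ain erefl).
  have [/= bq _] := sub (b, p) (conj bin erefl).
  by move: ab; rewrite aq bq ltxx.
- have [/= _ aq] := sub (p, a) (conj erefl ain).
  have [/= _ bq] := sub (p, b) (conj erefl bin).
  by move: ab; rewrite aq bq ltxx.
- have [/= -> +] := sub (p, a) (conj erefl ain).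
  have [/= _ +] := sub (p, b) (conj erefl bin).
  by rewrite !in_itv /= => /andP[_ ->] /andP[-> _].
Qed.

Lemma max_segmentsP E rho : (forall e, e \in E -> llo e < lhi e) ->
  rho \in max_segments E <-> is_max_segment E rho.
Proof.
move=> Elt; rewrite !inE /=; split => [/andP[_ /asboolP//]|maxrho].
apply/andP; split; last exact/asboolP.
have [[lt [E' [EE' rE]]] _] := maxrho.
have E'sub e : e \in E' -> [/\ lhor e = lhor rho, lpos e = lpos rho,
    llo rho <= llo e & lhi e <= lhi rho].
  move=> eE'; apply: lseg_sub; first by apply/Elt/(fsubsetP EE').
  by rewrite rE => x xe; exists e.
have : lseg_pts rho (lseg_end0 rho).
  by rewrite /lseg_pts /lseg_end0; case: (lhor rho);
    split => //=; rewrite in_itv /= lexx ltW.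
rewrite rE => -[e /= eE' e0].
have : lseg_pts rho (lseg_end1 rho).
  by rewrite /lseg_pts /lseg_end1; case: (lhor rho);
    split => //=; rewrite in_itv /= lexx ltW.
rewrite rE => -[e' /= e'E' e1].
have [he pe le_e ge_e] := E'sub _ eE'.
have [he' pe' le_e' ge_e'] := E'sub _ e'E'.
apply/imfset2P; exists e => /=; first exact: (fsubsetP EE').
exists e' => /=; first exact: (fsubsetP EE').
have -> : llo e = llo rho.
  apply/eqP; rewrite eq_le le_e andbT.
  move: e0; rewrite /lseg_pts /lseg_end0 he.
  by case: (lhor rho) => -[/= x0 x1]; move: x0 x1; rewrite ?in_itv /=;
    [move=> /andP[]|move=> _ /andP[]].
have -> : lhi e' = lhi rho.
  apply/eqP; rewrite eq_le ge_e' /=.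
  move: e1; rewrite /lseg_pts /lseg_end1 he'.
  by case: (lhor rho) => -[/= x0 x1]; move: x0 x1; rewrite ?in_itv /=;
    [move=> /andP[]|move=> _ /andP[]].
by rewrite he pe; case: (rho).
Qed.

Definition MS T : {fset lseg R} := max_segments (int_edges T).

Definition bnd_MS T : {fset lseg R} := max_segments (bnd_edges T).

Definition cross_cut T rho : Prop :=
  frontier (domain T) (lseg_end0 rho) /\ frontier (domain T) (lseg_end1 rho).

Definition ray T rho : Prop :=
  (frontier (domain T) (lseg_end0 rho) /\
   ~ frontier (domain T) (lseg_end1 rho)) \/
  (~ frontier (domain T) (lseg_end0 rho) /\
   frontier (domain T) (lseg_end1 rho)).

Definition avoids_frontier T rho : Prop :=
  lseg_pts rho `&` frontier (domain T) = set0.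

Definition MIS T : {fset lseg R} :=
  [fset rho in MS T | `[< avoids_frontier T rho >]]%fset.

Definition MS_hat T : {fset lseg R} :=
  ([fset rho in MS T | `[< cross_cut T rho >]] `|`
   [fset rho in MS T | `[< ray T rho >]] `|` MIS T `|` bnd_MS T)%fset.

Record reduced T : Prop := Reduced {
  no_splitting_vertex : forall p, p \in vertices T ->
    ~ exists e e', [/\ e \in edges T, e' \in edges T, e != e',
        lhor e = lhor e'
      & forall e'', e'' \in edges T ->
          lseg_pts e'' p <-> e'' = e \/ e'' = e'];
  vertex_segments : forall p, p \in vertices T -> forall h : bool,
    exists! rho, [/\ rho \in MS_hat T, lhor rho = h & lseg_pts rho p];
  edge_consecutive : forall e, e \in edges T <->
    llo e < lhi e /\
    exists rho, [/\ rho \in MS_hat T, lseg_pts e `<=` lseg_pts rho,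
        lseg_end0 e \in vertices T, lseg_end1 e \in vertices T
      & forall p, p \in vertices T -> lseg_pts e p ->
          p = lseg_end0 e \/ p = lseg_end1 e]
}.

(* only the values on [edges T] matter *)
Definition smoothness T (r : lseg R -> int) : Prop :=
  (forall e, e \in edges T -> -1 <= r e) /\
  (forall e, e \in bnd_edges T -> r e = -1).

Definition constant_along_MS T (r : lseg R -> int) : Prop :=
  forall rho, rho \in MS T -> forall e e', e \in edges T -> e' \in edges T ->
    lseg_pts e `<=` lseg_pts rho -> lseg_pts e' `<=` lseg_pts rho ->
    r e = r e'.

Definition seg_r T (r : lseg R -> int) rho : int :=
  r (xget rho [set e | e \in edges T /\ lseg_pts e `<=` lseg_pts rho]).

(* rho_h(p) for [h = true], rho_v(p) for [h = false]; unique at an interior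
   vertex of a reduced mesh *)
Definition MS_at T (h : bool) (p : R * R) : lseg R :=
  xget (LSeg h 0 0 0) [set rho | [/\ rho \in MS T, lhor rho = h
                                   & lseg_pts rho p]].

End TMesh.

(* R_(m,n): the entry at (i, j) is the coefficient of s^i t^j *)
Definition bipoly (R : realType) (m n : nat) := 'M[R]_(m.+1, n.+1).

Section Splines.
Context {R : realType} (T : tmesh R) (r : lseg R -> int) (m m' : nat).
Local Notation Rmm := (bipoly R m m').

(* the polynomial ring in s (inner variable) and t (outer variable) *)
Definition svar : {poly {poly R}} := 'X%:P.
Definition tvar : {poly {poly R}} := 'X.

Definition bieval (p : Rmm) : {poly {poly R}} :=
  \sum_(i < m.+1) \sum_(j < m'.+1) (p i j)%:P%:P * svar ^+ i * tvar ^+ j.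

(* R_(a,b) for a <= m and b <= m', as a subspace of R_(m,m') *)
Definition biR (a b : int) : {vspace Rmm} :=
  (\sum_(i < m.+1 | ((i : nat)%:Z <= a)%R)
     \sum_(j < m'.+1 | ((j : nat)%:Z <= b)%R) <[delta_mx i j : Rmm]>)%VS.

Definition ell (e : lseg R) : {poly {poly R}} :=
  if lhor e then tvar - (lpos e)%:P%:P else svar - (lpos e)%:P%:P.

(* for the exponents k = r + 1 >= 0 occurring below *)
Definition ell_pow (e : lseg R) (k : int) : {poly {poly R}} := ell e ^+ `|k|%N.

Definition divides (d p : {poly {poly R}}) : Prop := exists q, p = d * q.

(* The conditions defining [spline_space], [I_edge] and [M_space] are linear, so
   by [mem_vspan] these spans have exactly the stated elements. *)
Definition spline_space : {vspace {ffun cells T -> Rmm}} :=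
  vspan [set f : {ffun cells T -> Rmm} |
    forall (c c' : cells T) (e : lseg R), c != c' -> e \in int_edges T ->
      lseg_pts e `<=` rect_pts (val c) `&` rect_pts (val c') ->
      divides (ell_pow e (r e + 1)) (bieval (f c) - bieval (f c'))].

Definition I_edge (e : lseg R) : {vspace Rmm} :=
  vspan [set p : Rmm | divides (ell_pow e (r e + 1)) (bieval p)].

Definition I_vertex (p : R * R) : {vspace Rmm} :=
  (\sum_(e <- int_edges T | `[< lseg_pts e p >]) I_edge e)%VS.

Definition chiQ : int :=
  \sum_(c <- cells T) (\dim {:Rmm})%:Z
  - \sum_(e <- int_edges T) (\dim (quotv fullv (I_edge e)))%:Z
  + \sum_(p <- int_vertices T) (\dim (quotv fullv (I_vertex p)))%:Z.

Local Notation r_ rho := (seg_r T r rho).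

Definition B_seg (rho : lseg R) : {vspace Rmm} :=
  if lhor rho then biR m (m'%:Z - r_ rho - 1)
  else biR (m%:Z - r_ rho - 1) m'.

(* the element x of the direct sum over MIS(T), all of whose summands lie in
   R_(m,m'), stands for the formal sum of the [rho] x(rho) *)
Local Notation Mtype := {ffun MIS T -> Rmm}.

Definition M_space (A : {set MIS T}) : {vspace Mtype} :=
  vspan [set x : Mtype | forall rho : MIS T,
    x rho \in (if rho \in A then B_seg (val rho) else 0%VS)].

(* Terms of segments that are not MISs are omitted because [rho] ranges over
   MIS(T); if neither segment is an MIS, the relation is 0 = 0. *)
Definition vertex_relation (x : Mtype) : Prop :=
  exists p, p \in int_vertices T /\
  exists rhoh rhov,
    [/\ rhoh \in MS T /\ lhor rhoh, rhov \in MS T /\ ~~ lhor rhov,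
        lseg_pts rhoh p, lseg_pts rhov p
      & exists2 q : Rmm, q \in biR (m%:Z - r_ rhov - 1) (m'%:Z - r_ rhoh - 1) &
        forall rho : MIS T, bieval (x rho) =
          if val rho == rhov then ell_pow rhoh (r_ rhoh + 1) * bieval q
          else if val rho == rhoh then - (ell_pow rhov (r_ rhov + 1) * bieval q)
          else 0].

Definition relations : {vspace Mtype} := vspan vertex_relation.

Definition R_space (A : {set MIS T}) : {vspace Mtype} :=
  (M_space A :&: relations)%VS.

Definition H_space (A : {set MIS T}) : {vspace Mtype} :=
  quotv (M_space A) (R_space A).

(* r_h(p) and r_v(p) are the smoothness of the *other* direction's segment *)
Definition mu_h (p : R * R) : int := Num.max 0 (m%:Z - r_ (MS_at T false p)).
Definition mu_v (p : R * R) : int := Num.max 0 (m'%:Z - r_ (MS_at T true p)).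

(* A deletion state (A, B) is given by its first component, as B is the
   complement of A in MIS(T). *)
Definition mono (A : {set MIS T}) (rho : MIS T) : {fset R * R} :=
  [fset p in vertices T | `[< lseg_pts (val rho) p >] &&
    `[< forall rho' : MIS T, rho' \in A :\ rho ->
        ~ lseg_pts (val rho') p >]]%fset.

Definition weight (A : {set MIS T}) (rho : MIS T) : int :=
  \sum_(p <- mono A rho) if lhor (val rho) then mu_h p else mu_v p.

Definition threshold (rho : MIS T) : int :=
  if lhor (val rho) then m.+1 else m'.+1.

Definition diagonalizable (A : {set MIS T}) (rho : MIS T) : bool :=
  threshold rho <= weight A rho.

Definition deletion_pass (A : {set MIS T}) : {set MIS T} :=
  A :\: [set rho in A | diagonalizable A rho]%SET.

(* Each pass but the last removes an MIS, so after #|MIS(T)| passes the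
   iteration has become stationary. *)
Definition CNDC : {set MIS T} :=
  iter #|{: MIS T}| deletion_pass [set: MIS T]%SET.

End Splines.

(* Main.v *)
Require Import Defs.
From HB Require Import structures.
From mathcomp Require Import all_boot all_order all_algebra finmap.
From mathcomp Require Import all_classical all_reals all_analysis.
From mathcomp Require Import lra ring zify.
Set Implicit Arguments.
Unset Strict Implicit.
Unset Printing Implicit Defensive.
Import Order.TTheory GRing.Theory Num.Theory.
Import numFieldNormedType.Exports.
Local Open Scope classical_set_scope.
Local Open Scope ring_scope.

(* Recording a spline by its jumps across interior edges identifies the spline
   space, up to the kernel of d2, with the cycles of d1 lying in the sum of the
   edge ideals, where d2 : cells -> interior edges and d1 : interior edges ->
   interior vertices are the boundary maps of the cellular complex relative to
   the boundary of the domain. That complex is exact: locally a cycle has a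
   potential at every point, cells meeting in two points share an edge (this
   uses reducedness), so the local potentials form a cocycle on touching cells,
   and simple connectedness makes it a coboundary; d1 is onto because from an
   interior vertex some edge leads to the right or upwards. A dimension count
   leaves the cokernel of d1 from edge ideals to vertex ideals. At a vertex the
   ideal is the sum of the ideals of the horizontal and the vertical segment,
   and along a segment the edges identify the contributions of all vertices,
   killing them if the segment reaches the boundary; what remains is M(MIS)/R.
   Finally, every deleted segment contributes only to R: the vertices counted by
   its weight give relations supported on it and on segments deleted before,
   and by Hermite interpolation they span once the weight reaches the
   threshold. *)

(** * Simple connectedness and cocycles on cells *)

(** The cokernel of d1 is computed without bases. Let N be the sum, over interior vertices and the
    two directions, of the ideals of the segments through the vertex. Adding the two directions maps
    N onto the vertex ideals; adding along each MIS maps N onto the ideals of the MISs, a copy of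
    M(MIS). Boundaries of chains of edge ideals are the image under the first map of the kernel of
    the second. Dually, R is the image under the second map of the kernel of the first: an element
    of N that cancels at every vertex consists of pairs w, -w with w in both segment ideals. Both
    cokernels are therefore N modulo the sum of the two kernels. The topological obstacle is that
    simple connectedness is given by continuous homotopies, while the cocycle identity is available
    only for three cells with a common point. A fine subdivision yields cells that touch pairwise;
    for boxes this suffices, because having a common point can be decided on each axis separately.
    The order of deletions leaves no trace in the end: only M(CNDC) + R = M(MIS) is used. *)

Lemma compact_uniform_continuous (R : realType) (X Y : pseudoMetricType R)
    (K : set X) (f : X -> Y) (e : R) :
  compact K -> {within K, continuous f} -> 0 < e ->
  exists2 d, 0 < d &
    forall x y, K x -> K y -> ball x d y -> ball (f x) e (f y).
Proof.
move=> /compact_near_coveringP/near_covering_withinP cK.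
move=> /subspace_continuousP cf e0.
have [|d /= d0 dP] := cK R 0^'+ (fun d x =>
    forall y, K y -> ball x d y -> ball (f x) e (f y)) _.
  move=> x Kx; have e20 : 0 < e / 2 by rewrite divr_gt0.
  have /nbhs_ballP[d /= d0 dP] := cf x Kx _ (nbhsx_ballx (f x) (e / 2) e20).
  have d20 : 0 < d / 2 by rewrite divr_gt0.
  exists (ball x (d / 2), [set d' | d' < d / 2]) => /=.
    by split; [exact: nbhsx_ballx|exact: nbhs_right_lt].
  move=> [x' d'] /= [xx' d'd] Kx' y Ky x'y.
  rewrite [e]splitr; apply: (@ball_triangle _ _ (f x)).
    apply: ball_sym; apply: dP => //.
    by apply: le_ball xx'; rewrite ler_pdivrMr// ler_peMr ?ler1n// ltW.
  apply: dP => //; rewrite [d]splitr; apply: ball_triangle xx' _.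
  by apply: le_ball x'y; exact: ltW.
exists (d / 2); first by rewrite divr_gt0.
move=> x y Kx Ky xy; apply: (dP (d / 2)) => //=.
- by rewrite sub0r normrN gtr0_norm ?divr_gt0// ltr_pdivrMr// ltr_pMr// ltr1n.
- by rewrite divr_gt0.
Qed.

(** A discrete Stokes formula: the hypothesis pushes a lattice path across one square, and square by
    square the path moves from one pair of sides of the grid to the other. *)
Lemma grid_sum (V : zmodType) (C : Type) (g : C -> C -> V)
    (w : nat -> nat -> C) (m n : nat) :
  (forall i j, (i < m)%N -> (j < n)%N ->
    g (w i j) (w i j.+1) + g (w i j.+1) (w i.+1 j.+1) =
    g (w i j) (w i.+1 j) + g (w i.+1 j) (w i.+1 j.+1)) ->
  \sum_(j < n) g (w 0%N j) (w 0%N j.+1) + \sum_(i < m) g (w i n) (w i.+1 n) =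
  \sum_(i < m) g (w i 0%N) (w i.+1 0%N) + \sum_(j < n) g (w m j) (w m j.+1).
Proof.
elim: m => [|m IHm] H; first by rewrite !big_ord0 addr0 add0r.
have row : \sum_(j < n) g (w m j) (w m j.+1) + g (w m n) (w m.+1 n) =
    g (w m 0%N) (w m.+1 0%N) + \sum_(j < n) g (w m.+1 j) (w m.+1 j.+1).
  have {}H := H m ^~ (ltnSn m).
  elim: n H {IHm} => [|n IHn] H; first by rewrite !big_ord0 addr0 add0r.
  rewrite !big_ord_recr /= -addrA H// addrA IHn ?addrA// => j jn.
  by apply: H; exact: ltnW.
rewrite !big_ord_recr /= addrA IHm; last by move=> i j im; apply/H/ltnW.
by rewrite -!addrA row.
Qed.

Lemma positive_lower_bound (R : realFieldType) (s : seq R) :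
  exists2 d, 0 < d & forall x, x \in s -> 0 < x -> d < x.
Proof.
elim: s => [|x s [d d0 dP]]; first by exists 1.
exists (if 0 < x then Num.min d (x / 2) else d) => [|y].
  by case: ifP => // x0; rewrite lt_min d0 divr_gt0.
rewrite inE => /predU1P[->|ys] y0.
  by rewrite y0 gt_min [X in _ || X]gtr_pMr ?invf_lt1 ?ltr1n ?orbT.
by case: ifP => _; rewrite ?gt_min dP.
Qed.

Section Polyline.
Context {R : realType}.
Implicit Types (a : nat -> R) (n : nat) (x : R).

(** The path with value [a k] at time [k], as a sum of increments that are switched on linearly
    during one unit of time each. Continuity then needs no gluing of pieces. *)
Definition polyline a n x : R :=
  a 0%N + \sum_(k < n) Num.min 1 (Num.max 0 (x - k%:R)) * (a k.+1 - a k).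

Lemma polyline_ge a n x : n%:R <= x -> polyline a n x = a n.
Proof.
rewrite /polyline; elim: n => [|n IHn] nx; first by rewrite big_ord0 addr0.
rewrite big_ord_recr /= addrA IHn; last first.
  by apply: le_trans nx; rewrite ler_nat.
have x1 : 1 <= x - n%:R by rewrite lerBrDr -natr1 addrC in nx *.
by rewrite max_r ?(le_trans _ x1)// min_l// mul1r addrC subrK.
Qed.

Lemma polyline_segment a n i x : (i < n)%N -> i%:R <= x <= i.+1%:R ->
  polyline a n x = a i + (x - i%:R) * (a i.+1 - a i).
Proof.
move=> + /andP[ix xi]; elim: n => // n IHn; rewrite ltnS leq_eqVlt.
rewrite /polyline big_ord_recr /= addrA => /predU1P[<-|lt_in].
  rewrite -/(polyline a i x) polyline_ge// max_r ?subr_ge0// min_r//.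
  by rewrite lerBlDl natr1.
rewrite -/(polyline a n x) IHn// max_l ?min_r ?mul0r ?addr0//.
by rewrite subr_le0 (le_trans xi)// ler_nat.
Qed.

Lemma continuous_maxr (f g : R -> R) :
  continuous f -> continuous g -> continuous (fun x => Num.max (f x) (g x)).
Proof.
move=> cf cg; rewrite (_ : (fun _ => _) =
    fun x => (f x + g x + `|f x - g x|) / 2); last first.
  by apply: funext => x; exact: maxr_absE.
move=> x; apply: cvgMr_tmp; apply: cvgD; first exact: cvgD (cf x) (cg x).
by apply: cvg_norm; exact: cvgB (cf x) (cg x).
Qed.

Lemma continuous_minr (f g : R -> R) :
  continuous f -> continuous g -> continuous (fun x => Num.min (f x) (g x)).
Proof.
move=> cf cg; rewrite (_ : (fun _ => _) =
    fun x => (f x + g x - `|f x - g x|) / 2); last first.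
  by apply: funext => x; exact: minr_absE.
move=> x; apply: cvgMr_tmp; apply: cvgB; first exact: cvgD (cf x) (cg x).
by apply: cvg_norm; exact: cvgB (cf x) (cg x).
Qed.

Lemma polyline_continuous a n : continuous (polyline a n).
Proof.
rewrite /polyline; elim: n => [|n IHn].
  by under eq_fun do rewrite big_ord0; move=> x; exact: cvg_cst.
under eq_fun do rewrite big_ord_recr /= addrA; move=> x.
apply: cvgD; first exact: IHn.
have cmax : continuous (fun y : R => Num.max 0 (y - n%:R)).
  apply: (@continuous_maxr (cst 0)) => y; first exact: cvg_cst.
  by apply: cvgB; [exact: cvg_id|exact: cvg_cst].
have cmin : continuous (fun y : R => Num.min 1 (Num.max 0 (y - n%:R))).
  by apply: (@continuous_minr (cst 1)) => // y; exact: cvg_cst.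
by apply: cvgMr_tmp; exact: cmin.
Qed.

End Polyline.

(** * Boxes in the plane and closed chains of cells *)

Section Boxes.
Context {R : realType}.
Implicit Types (p q : R * R) (c : rect R) (h : bool).

(** Axes are indexed by the boolean of [lhor]: [co (lhor e)] varies along [e] and [co (~~ lhor e)]
    is constant on it. Most arguments then treat both axes at once. *)
Definition co h p : R := if h then p.1 else p.2.
Definition rlo h c : R := if h then rx0 c else ry0 c.
Definition rhi h c : R := if h then rx1 c else ry1 c.

Lemma co_inj p q : (forall h, co h p = co h q) -> p = q.
Proof. by case: p q => [a b] [a' b'] pq; rewrite (pq true : a = a') (pq false : b = b'). Qed.

Lemma rect_ptsP c p : rect_pts c p <-> forall h, rlo h c <= co h p <= rhi h c.
Proof.
rewrite /rect_pts /=; split => [[]|pc].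
  by rewrite /= !in_itv /= => p1 p2 [].
by split; rewrite /= in_itv /=; [exact: (pc true)|exact: (pc false)].
Qed.

Lemma ball_co p q e : ball p e q <-> forall h, `|co h p - co h q| < e.
Proof. by split => [[p1 p2] []//|pq]; split; [exact: (pq true)|exact: (pq false)]. Qed.

Lemma exists_max_seq (T : eqType) (f : T -> R) (s : seq T) : s != [::] ->
  exists2 x, x \in s & forall y, y \in s -> f y <= f x.
Proof.
case: s => // x s _; elim: s x => [x|y s IHs x].
  by exists x; rewrite ?mem_head// => y; rewrite inE => /eqP->.
have [z zs zP] := IHs y.
have [xz|zx] := leP (f x) (f z).
  exists z; first by rewrite inE zs orbT.
  by move=> t; rewrite inE => /predU1P[->//|/zP].
exists x; first exact: mem_head.
by move=> t; rewrite inE => /predU1P[->//|/zP/le_trans]; apply; exact: ltW.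
Qed.

(** On each axis the largest lower bound serves as coordinate, since no upper bound lies below
    it. *)
Lemma Helly_boxes (s : seq (rect R)) : s != [::] ->
  (forall c c' h, c \in s -> c' \in s -> rlo h c <= rhi h c') ->
  exists p, forall c, c \in s -> rect_pts c p.
Proof.
move=> s0 sP; have [ct ts tP] := exists_max_seq (rlo true) s0.
have [cf fs fP] := exists_max_seq (rlo false) s0.
exists (rlo true ct, rlo false cf) => c cs; apply/rect_ptsP => h.
by apply/andP; split; case: h; [exact: tP|exact: fP|exact: sP|exact: sP].
Qed.

(* Two disjoint boxes are separated along one axis. *)
Lemma near_boxes_touch (C : {fset rect R}) : exists2 d, 0 < d &
  forall c c' p p', c \in C -> c' \in C -> rect_pts c p -> rect_pts c' p' ->
    ball p d p' -> forall h, rlo h c <= rhi h c'.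
Proof.
have [d d0 dP] := positive_lower_bound
  ([seq rlo true c - rhi true c' | c <- C, c' <- C] ++
   [seq rlo false c - rhi false c' | c <- C, c' <- C]).
exists d => // c c' p p' cC c'C /rect_ptsP cp /rect_ptsP cp' /ball_co pp' h.
rewrite leNgt -subr_gt0; apply/negP => gap0.
have gap : d < rlo h c - rhi h c'.
  apply: dP => //; rewrite mem_cat; apply/orP.
  by case: (h); [left|right]; apply/allpairsP; exists (c, c').
have /andP[cp1 _] := cp h; have /andP[_ cp2] := cp' h.
have := pp' h; rewrite ltr_norml => /andP[_ pp].
lra.
Qed.

Context {V : zmodType} (C : {fset rect R}) (g : rect R -> rect R -> V).
Hypothesis C_simply_connected :
  simply_connected R (\bigcup_(c in [set` C]) rect_pts c).
Hypothesis g_cocycle : forall c1 c2 c3 p, c1 \in C -> c2 \in C -> c3 \in C ->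
  rect_pts c1 p -> rect_pts c2 p -> rect_pts c3 p -> g c1 c2 + g c2 c3 = g c1 c3.

Let g_refl c p : c \in C -> rect_pts c p -> g c c = 0.
Proof.
move=> cC cp; by apply: (addrI (g c c)); rewrite addr0 (g_cocycle cC cC cC cp cp cp).
Qed.

(** Repeating each cell [M] times changes nothing: inside a block the terms are [g c c], which
    vanish, and only the steps between blocks survive. *)
Let sum_blocks (c : nat -> rect R) (n M : nat) : (0 < M)%N ->
  (forall i, (i <= n)%N -> g (c i) (c i) = 0) ->
  \sum_(j < n * M) g (c (j %/ M)%N) (c (j.+1 %/ M)%N) =
  \sum_(i < n) g (c i) (c i.+1).
Proof.
case: M => // M _; elim: n => [|n IHn] cc; first by rewrite mul0n !big_ord0.
rewrite [RHS]big_ord_recr /= -IHn; last by move=> i /leqW/cc.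
rewrite mulSn addnC big_split_ord /=; congr (_ + _).
rewrite big_ord_recr /= big1 ?add0r => [|i _].
  by rewrite -addnS !divnMDl// divn_small// divnn addn0 addn1.
by rewrite -addnS !divnMDl// !divn_small ?addn0 ?cc ?ltnS// ltnW.
Qed.

Local Notation I01 := (`[0, 1]%classic : set R).
Local Notation domainC := (\bigcup_(c in [set` C]) rect_pts c).

Let unit_step (n : nat) (x : R) : (0 < n)%N -> 0 <= x <= n%:R ->
  exists2 i, (i < n)%N & i%:R <= x <= i.+1%:R.
Proof.
case: n => // n _; elim: n => [|n IHn] /andP[x0 xn].
  by exists 0%N => //; rewrite x0.
have [xn1|/ltW n1x] := leP x n.+1%:R.
  have [|i iltn ix] := IHn; first by rewrite x0.
  by exists i => //; exact: ltnW.
by exists n.+1; rewrite ?n1x.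
Qed.

Let rect_convex c p q (s : R) (z : R * R) : rect_pts c p -> rect_pts c q ->
  0 <= s <= 1 -> (forall h, co h z = co h p + s * (co h q - co h p)) ->
  rect_pts c z.
Proof.
move=> /rect_ptsP cp /rect_ptsP cq /andP[s0 s1] zE; apply/rect_ptsP => h.
have /andP[p1 p2] := cp h; have /andP[q1 q2] := cq h.
by rewrite zE; apply/andP; split; nra.
Qed.

(* A null homotopy of a loop running through the chain, cut into squares that
   are so small that cells chosen at the corners of a square all touch. *)
Lemma closed_chain_sum (n : nat) (c : nat -> rect R) :
  (forall i, (i <= n)%N -> c i \in C) ->
  (forall i, (i < n)%N -> rect_pts (c i) `&` rect_pts (c i.+1) !=set0) ->
  c n = c 0%N -> \sum_(i < n) g (c i) (c i.+1) = 0.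
Proof.
case: n => [|m]; first by rewrite big_ord0.
set n := m.+1 => cC cc cn0.
(* [q i] and [q i.+1] both lie in [c i], so by convexity the loop stays in [c i] between the times
   [i] and [i.+1]. *)
have [q [ql qr q0]] : exists q : nat -> R * R,
    [/\ forall i, (i <= n)%N -> rect_pts (c i) (q i),
        forall i, (i < n)%N -> rect_pts (c i) (q i.+1) & q n = q 0%N].
  pose t i := xget 0 (rect_pts (c i) `&` rect_pts (c i.+1)).
  have tP i : (i < n)%N -> rect_pts (c i) (t i) /\ rect_pts (c i.+1) (t i).
    by move=> /cc; exact: xgetPex.
  (* The start [t m] is the meeting point of the last two cells; it lies in [c 0] because the chain
     closes up. *)
  exists (fun i => if i is j.+1 then t j else t m); split => //.
    by case => [_|i /tP[]//]; rewrite -cn0; have [] := tP _ (ltnSn m).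
  by move=> i /tP[].
pose f (t : R) : R * R := (polyline (fun i => (q i).1) n (n%:R * t),
                           polyline (fun i => (q i).2) n (n%:R * t)).
have fE h t : co h (f t) = polyline (fun i => co h (q i)) n (n%:R * t).
  by case: h.
have fc i t : (i < n)%N -> i%:R <= n%:R * t <= i.+1%:R -> rect_pts (c i) (f t).
  move=> ltin it; apply: (@rect_convex _ (q i) (q i.+1) (n%:R * t - i%:R)).
  - exact/ql/ltnW.
  - exact: qr.
  - by rewrite subr_ge0 lerBlDl natr1.
  - by move=> h; rewrite fE (polyline_segment _ ltin it).
have f0 : f 0 = q 0%N.
  apply: co_inj => h; rewrite fE mulr0 (@polyline_segment _ _ _ 0%N)//.
    by rewrite subrr mul0r addr0.
  by rewrite lexx ler01.
have f1 : f 1 = q 0%N by apply: co_inj => h; rewrite fE mulr1 polyline_ge// q0.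
have f_dom t : I01 t -> domainC (f t).
  rewrite /= in_itv /= => /andP[t0 t1].
  have [||i ltin it] := @unit_step n (n%:R * t) => //.
    by rewrite mulr_ge0//= ler_piMr.
  by exists (c i); [exact/cC/ltnW|exact: fc it].
have f_cont : continuous f.
  have cpl a : continuous (fun t : R => polyline a n (n%:R * t)).
    move=> t; have : {for n%:R * t, continuous (polyline a n)}.
      exact: polyline_continuous.
    by apply: (@cvg_comp _ _ _ (fun t : R => n%:R * t)); exact: mulrl_continuous.
  by move=> t; exact: cvg_pair (cpl _ t) (cpl _ t).
have [_ /(_ f)[]] := C_simply_connected => //.
- exact: continuous_subspaceT.
- by rewrite f0 f1.
move=> H [H_cont H_dom H0 H1 H01].
have [dlt dlt0 dltP] := near_boxes_touch C.
have [d d0 dP] := compact_uniform_continuous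
  (compact_setX (@segment_compact _ 0 1) (@segment_compact _ 0 1)) H_cont dlt0.
have [k kd] := ltr_add_invr d0; rewrite add0r in kd.
(* The bound [1 / M < d] controls the size of the squares, and [N] is a multiple of [n] so that each
   cell of the chain occupies [M] steps of the loop. *)
set M := k.+1 in kd; set N := (n * M)%N.
have N0 : 0 < N%:R :> R by rewrite ltr0n.
pose x (i : nat) : R := i%:R / N%:R.
have x01 i : (i <= N)%N -> I01 (x i).
  by move=> iN; rewrite /= in_itv /= divr_ge0//= ler_pdivrMr// mul1r ler_nat.
(* The side carrying the loop gets the chain itself. On the other three sides the homotopy stays at
   the base point, which lies in [c 0]; taking [c 0] there makes them contribute nothing. *)
pose w (i j : nat) : rect R :=
  if i == 0%N then c (j %/ M)%N
  else if [|| j == 0%N, j == N | i == N] then c 0%N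
  else xget (c 0%N) [set b | b \in C /\ rect_pts b (H (x i, x j))].
have NM : (N %/ M)%N = n by rewrite mulnK.
have x_N : x N = 1 by rewrite /x divff// gt_eqF.
have x_0 : x 0%N = 0 by rewrite /x mul0r.
have wP i j : (i <= N)%N -> (j <= N)%N ->
    w i j \in C /\ rect_pts (w i j) (H (x i, x j)).
  move=> iN jN; rewrite /w; case: eqP => [->|/eqP i0].
    rewrite x_0 H0; last exact: x01.
    split; first by rewrite cC// -NM leq_div2r.
    move: jN; rewrite leq_eqVlt => /predU1P[->|jN].
      by rewrite x_N f1 -q0 NM; exact: ql.
    apply: fc; first by rewrite ltn_divLR.
    have -> : n%:R * x j = j%:R / M%:R :> R.
      by rewrite /x natrM invfM mulrCA mulVKf ?pnatr_eq0.
    rewrite ler_pdivlMr ?ltr0n// ler_pdivrMr ?ltr0n//.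
    by rewrite -!natrM !ler_nat leq_divM ltnW// ltn_ceil.
  case: ifP => [ijP|_]; last first.
    apply: (@xgetPex _ _ [set b | b \in C /\ rect_pts b (H (x i, x j))]).
    by have [b] := H_dom _ _ (x01 _ iN) (x01 _ jN); exists b.
  split; first exact: cC.
  case/or3P: ijP => /eqP->.
  - by rewrite x_0 (H01 _ (x01 _ iN)).1 f0; exact: ql.
  - by rewrite x_N (H01 _ (x01 _ iN)).2 f0; exact: ql.
  - by rewrite x_N H1 ?f0; [exact: ql|exact: x01].
have x_near i : `|x i - x i.+1| < d.
  rewrite /x -mulrBl -natr1 opprD addrA subrr add0r mulN1r normrN.
  rewrite ger0_norm ?invr_ge0 ?ler0n//; apply: le_lt_trans kd.
  by rewrite lef_pV2 ?posrE ?ltr0n// ler_nat leq_pmull.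
have x_refl i : `|x i - x i| < d by rewrite subrr normr0.
have near i j i' j' : (i <= i' <= i.+1)%N -> (j <= j' <= j.+1)%N ->
    (i' <= N)%N -> (j' <= N)%N -> forall h,
    rlo h (w i j) <= rhi h (w i' j') /\ rlo h (w i' j') <= rhi h (w i j).
  move=> /andP[ii' i'i] /andP[jj' j'j] i'N j'N h.
  have iN := leq_trans ii' i'N; have jN := leq_trans jj' j'N.
  have [wC wH] := wP _ _ iN jN; have [w'C w'H] := wP _ _ i'N j'N.
  have bl : ball (x i, x j) d (x i', x j').
    have cases a b : (a <= b <= a.+1)%N -> `|x a - x b| < d.
      by case/andP; rewrite leq_eqVlt => /predU1P[->//|ab ba];
        rewrite (_ : b = a.+1)//; apply/eqP; rewrite eqn_leq ba.
    by split; apply: cases; apply/andP.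
  have bH := dP (_, _) (_, _) (conj (x01 _ iN) (x01 _ jN))
    (conj (x01 _ i'N) (x01 _ j'N)) bl.
  by split; [exact: dltP bH h|apply: dltP (ball_sym bH) h].
have tri i j i1 j1 i2 j2 : (i <= i1 <= i2)%N -> (j <= j1 <= j2)%N ->
    (i2 <= i.+1)%N -> (j2 <= j.+1)%N -> (i2 <= N)%N -> (j2 <= N)%N ->
    g (w i j) (w i1 j1) + g (w i1 j1) (w i2 j2) = g (w i j) (w i2 j2).
  move=> /andP[i_1 i1_2] /andP[j_1 j1_2] i2i j2j i2N j2N.
  have i1N := leq_trans i1_2 i2N; have j1N := leq_trans j1_2 j2N.
  have iN := leq_trans i_1 i1N; have jN := leq_trans j_1 j1N.
  have [p pP] : exists p, forall b, b \in [:: w i j; w i1 j1; w i2 j2] ->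
      rect_pts b p.
    apply: Helly_boxes => // b b' h; rewrite !inE.
    have le1 := leq_trans i1_2 i2i; have le2 := leq_trans j1_2 j2j.
    have i_2 := leq_trans i_1 i1_2; have j_2 := leq_trans j_1 j1_2.
    have step a1 a2 : (a1 <= a2)%N -> (a2 <= a1.+1)%N -> (a1 <= a2 <= a1.+1)%N.
      by move=> -> ->.
    have [a0 a1] := near _ _ _ _ (step _ _ i_1 le1) (step _ _ j_1 le2) i1N j1N h.
    have [b0 b1] := near _ _ _ _ (step _ _ i_2 i2i) (step _ _ j_2 j2j) i2N j2N h.
    have [c0 c1] := near _ _ _ _ (step _ _ i1_2 (leq_trans i2i (i_1 : (i.+1 <= i1.+1)%N)))
      (step _ _ j1_2 (leq_trans j2j (j_1 : (j.+1 <= j1.+1)%N))) i2N j2N h.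
    have refl k1 k2 : (k1 <= N)%N -> (k2 <= N)%N ->
        rlo h (w k1 k2) <= rhi h (w k1 k2).
      by move=> k1N k2N; have [] := near k1 k2 k1 k2 (step _ _ (leqnn _) (leqnSn _))
        (step _ _ (leqnn _) (leqnSn _)) k1N k2N h.
    have [r0 r1 r2] := And3 (refl _ _ iN jN) (refl _ _ i1N j1N) (refl _ _ i2N j2N).
    by move=> /or3P[]/eqP-> /or3P[]/eqP->.
  by apply: (@g_cocycle _ _ _ p); rewrite ?(wP _ _ _ _).1//;
    apply: pP; rewrite !inE eqxx ?orbT.
have g00 : g (c 0%N) (c 0%N) = 0 by apply: (g_refl (p := q 0%N)); first [exact: cC|exact: ql].
have w_0 i : w i 0%N = c 0%N by rewrite /w div0n eqxx; case: ifP.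
have w_N i : w i N = c 0%N by rewrite /w NM eqxx orbT cn0; case: ifP.
have wN_ j : w N j = c 0%N.
  by rewrite /w eqxx !orbT; case: eqP => // N_0; move: N0; rewrite N_0 ltxx.
have := @grid_sum V _ g w N N _.
under [X in _ + X = _]eq_bigr do rewrite !w_N g00.
under [X in _ = X + _]eq_bigr do rewrite !w_0 g00.
under [X in _ = _ + X]eq_bigr do rewrite !wN_ g00.
rewrite !big1_eq !addr0 => row0.
rewrite -(@sum_blocks c n M)// => [|i ilen].
  by apply: row0 => i j iN jN; rewrite !(tri i j) ?leqnn ?leqnSn.
by apply: (g_refl (p := q i)); first [exact: cC|exact: ql].
Qed.

End Boxes.

Section Potential.
Context {R : realType} {V : zmodType}.
Context (C : {fset rect R}) (g : rect R -> rect R -> V).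
Hypothesis C_simply_connected :
  simply_connected R (\bigcup_(c in [set` C]) rect_pts c).
Hypothesis g_cocycle : forall c1 c2 c3 p, c1 \in C -> c2 \in C -> c3 \in C ->
  rect_pts c1 p -> rect_pts c2 p -> rect_pts c3 p -> g c1 c2 + g c2 c3 = g c1 c3.

Fixpoint walk_sum (c : C) (s : seq C) : V :=
  if s is d :: s' then g (val c) (val d) + walk_sum d s' else 0.

Let touch : rel C := [rel c d | `[< rect_pts (val c) `&` rect_pts (val d) !=set0 >]].

Let touch_sym : connect_sym touch.
Proof.
by apply: sym_connect_sym => c d; rewrite /touch /= setIC.
Qed.

Let walk_sum_cat c s t :
  walk_sum c (s ++ t) = walk_sum c s + walk_sum (last c s) t.
Proof. by elim: s c => [|d s IHs] c /=; rewrite ?add0r// IHs addrA. Qed.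

Let walk_sum_closed c s : path touch c s -> last c s = c -> walk_sum c s = 0.
Proof.
move=> cs sc; pose w i := val (nth c (c :: s) i).
have <- : \sum_(i < size s) g (w i) (w i.+1) = walk_sum c s.
  rewrite {}/w; set x0 := (X in nth X); move: x0 => x0.
  elim: s c {cs sc} => [|d s IHs] c; first by rewrite big_ord0.
  by rewrite /= big_ord_recl -IHs.
apply: (closed_chain_sum C_simply_connected g_cocycle).
- by move=> i _; exact: valP.
- by move=> i /(pathP c cs) wi; have /asboolP := wi.
- by rewrite /w /= -[in RHS]sc -[size s]/(size (c :: s)).-1 nth_last.
Qed.

(** The potential of a cell sums [g] along a chosen walk to the root of its component in the
    touching graph; closed walks sum to zero, so the choice is harmless. *)
Lemma cocycle_potential : exists f : rect R -> V,
  forall c c' p, c \in C -> c' \in C -> rect_pts c p -> rect_pts c' p ->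
    g c c' = f c - f c'.
Proof.
have toroot (c : C) : exists s, path touch c s /\ last c s = fingraph.root touch c.
  by have /connectP[s cs ->] := connect_root touch c; exists s.
have [r rP] := choice toroot.
exists (fun c => if insub c is Some c' then walk_sum c' (r c') else 0).
move=> c d p cC dC cp dp.
rewrite (insubT (fun c => c \in C) cC) (insubT (fun c => c \in C) dC) /=.
set c' := Sub c cC; set d' := Sub d dC.
have cd : touch c' d' by apply/asboolP; exists p.
have [cs sc] := rP c'; have [ds sd] := rP d'.
have crd : fingraph.root touch c' = fingraph.root touch d' by apply/(fingraph.rootP touch_sym)/connect1.
(* One walk [s] back from the root closes both the walk from [c'] and the walk from [c'] through
   [d']; comparing the two sums leaves [g c d]. *)
have : connect touch (fingraph.root touch c') c'.
  by rewrite touch_sym; exact: connect_root.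
move=> /connectP[s rs sr].
have := @walk_sum_closed c' (r c' ++ s).
rewrite cat_path cs sc rs last_cat sc -sr => /(_ isT erefl).
rewrite walk_sum_cat sc => /eqP; rewrite addr_eq0 => /eqP->.
have := @walk_sum_closed c' (d' :: r d' ++ s).
rewrite /= cat_path cd ds sd -crd rs last_cat sd -crd -sr => /(_ isT erefl).
rewrite walk_sum_cat sd -crd => /eqP; rewrite addrA addr_eq0 => /eqP <-.
by rewrite addrK.
Qed.

End Potential.

(** * Local geometry of a mesh *)

Section PlaneGeometry.
Context {R : realType}.
Implicit Types (p q : R * R) (c : rect R) (e : lseg R) (h s : bool) (d : R).

Definition mkpt (x : bool -> R) : R * R := (x true, x false).

Lemma co_mkpt x h : co h (mkpt x) = x h. Proof. by case: h. Qed.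

Definition rect_in c p := forall h, rlo h c < co h p < rhi h c.

Lemma rect_in_pts c p : rect_in c p -> rect_pts c p.
Proof.
by move=> cp; apply/rect_ptsP => h; have /andP[p1 p2] := cp h; rewrite !ltW.
Qed.

Lemma interiorE (A : set (R * R)) p :
  A° p <-> exists2 d, 0 < d & forall q, (forall h, `|co h p - co h q| < d) -> A q.
Proof.
split=> [/nbhs_ballP[d /= d0 dA]|[d d0 dA]].
  by exists d => // q pq; apply: dA; apply/ball_co.
by apply/nbhs_ballP; exists d => // q /ball_co; exact: dA.
Qed.

Lemma interior_rect c p : (rect_pts c)° p <-> rect_in c p.
Proof.
split=> [/interiorE[d d0 dA] h|cp]; last first.
  have [d d0 dP] := positive_lower_bound
    [:: co true p - rlo true c; rhi true c - co true p;
        co false p - rlo false c; rhi false c - co false p].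
  apply/interiorE; exists d => // q pq; apply/rect_ptsP => h.
  have /andP[cp1 cp2] := cp h.
  have /dP : co h p - rlo h c \in [:: co true p - rlo true c; rhi true c - co true p;
        co false p - rlo false c; rhi false c - co false p].
    by case: (h); rewrite !inE eqxx ?orbT.
  have /dP : rhi h c - co h p \in [:: co true p - rlo true c; rhi true c - co true p;
        co false p - rlo false c; rhi false c - co false p].
    by case: (h); rewrite !inE eqxx ?orbT.
  rewrite !subr_gt0 => /(_ cp2) d2 /(_ cp1) d1.
  have := pq h; rewrite ltr_norml => /andP[q1 q2].
  by apply/andP; split; lra.
have half (s : bool) : rect_pts c (mkpt (fun h => co h p + if s then d / 2 else - (d / 2))).
  apply: dA => k; rewrite co_mkpt opprD addrA subrr sub0r normrN.
  by case: s; rewrite ?normrN gtr0_norm; lra.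
have /rect_ptsP/(_ h) := half true; have /rect_ptsP/(_ h) := half false.
by rewrite !co_mkpt => /andP[+ _] /andP[_]; move=> *; apply/andP; split; lra.
Qed.

Lemma frontier_rect c p : frontier (rect_pts c) p <-> rect_pts c p /\ ~ rect_in c p.
Proof.
rewrite /frontier /setD /= interior_rect; split=> -[cp ncp]; split=> //; last first.
  exact: subset_closure.
apply/rect_ptsP => h; rewrite !leNgt -negb_or; apply/negP => out.
pose d := if co h p < rlo h c then rlo h c - co h p else co h p - rhi h c.
have d0 : 0 < d by rewrite /d; case: ifP out => /= [|_]; rewrite subr_gt0.
have [q [/rect_ptsP/(_ h)/andP[q1 q2] /ball_co/(_ h)]] :=
  cp _ (nbhsx_ballx p d d0).
rewrite /d ltr_norml; case: ifP out => /= [_ _|_ out] /andP[a1 a2]; lra.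
Qed.

Lemma lseg_ptsP e p : lseg_pts e p <->
  co (~~ lhor e) p = lpos e /\ llo e <= co (lhor e) p <= lhi e.
Proof. by rewrite /lseg_pts; case: (lhor e); rewrite /= in_itv /=; split=> -[]. Qed.

Lemma co_end0 e : co (lhor e) (lseg_end0 e) = llo e.
Proof. by rewrite /lseg_end0; case: (lhor e). Qed.
Lemma co_end1 e : co (lhor e) (lseg_end1 e) = lhi e.
Proof. by rewrite /lseg_end1; case: (lhor e). Qed.
Lemma coN_end0 e : co (~~ lhor e) (lseg_end0 e) = lpos e.
Proof. by rewrite /lseg_end0; case: (lhor e). Qed.
Lemma coN_end1 e : co (~~ lhor e) (lseg_end1 e) = lpos e.
Proof. by rewrite /lseg_end1; case: (lhor e). Qed.

Lemma lseg_end0_pts e : llo e <= lhi e -> lseg_pts e (lseg_end0 e).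
Proof. by move=> le; apply/lseg_ptsP; rewrite coN_end0 co_end0 lexx. Qed.
Lemma lseg_end1_pts e : llo e <= lhi e -> lseg_pts e (lseg_end1 e).
Proof. by move=> le; apply/lseg_ptsP; rewrite coN_end1 co_end1 lexx le. Qed.

Lemma co_inj2 h p q : co h p = co h q -> co (~~ h) p = co (~~ h) q -> p = q.
Proof. by move=> pq pqN; apply: co_inj => k; case: h k pq pqN => [] []. Qed.

Definition signed s d := if s then d else - d.

Definition diag p d (sg : bool -> bool) := mkpt (fun h => co h p + signed (sg h) d).
Definition along p d h s :=
  mkpt (fun k => if k == h then co h p + signed s d else co k p).

Lemma co_diag p d sg h : co h (diag p d sg) = co h p + signed (sg h) d.
Proof. exact: co_mkpt. Qed.

Lemma co_along p d h s : co h (along p d h s) = co h p + signed s d.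
Proof. by rewrite co_mkpt eqxx. Qed.

Lemma coN_along p d h s : co (~~ h) (along p d h s) = co (~~ h) p.
Proof. by rewrite co_mkpt; case: h. Qed.

(* [c] fills the quadrant of signs [sg] at [p] *)
Definition quad (sg : bool -> bool) p c := forall h,
  if sg h then rlo h c <= co h p < rhi h c else rlo h c < co h p <= rhi h c.

Definition flip h (sg : bool -> bool) : bool -> bool :=
  fun k => if k == h then ~~ sg k else sg k.

Lemma quad_pts sg p c : quad sg p c -> rect_pts c p.
Proof.
move=> cp; apply/rect_ptsP => h; have := cp h; case: ifP => _ /andP[p1 p2].
  by rewrite p1 ltW.
by rewrite p2 ltW.
Qed.

Lemma quad_two_in sg sg' p c : quad sg p c -> quad sg' p c ->
  (forall h, sg h != sg' h) -> rect_in c p.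
Proof.
move=> c1 c2 ne h; have := c1 h; have := c2 h; have := ne h.
by case: (sg h); case: (sg' h) => //= _ /andP[a b] /andP[a' b']; apply/andP.
Qed.

End PlaneGeometry.

(** * Quadrants, edges and cells around a point *)

Section MeshGeometry.
Context {R : realType} (T : tmesh R).
Hypothesis hT : is_tmesh T.
Implicit Types (p q : R * R) (c : rect R) (e : lseg R) (h s : bool) (d : R)
  (sg : bool -> bool).

Definition critical : seq R :=
  [seq rlo true c | c <- cells T] ++ [seq rhi true c | c <- cells T] ++
  [seq rlo false c | c <- cells T] ++ [seq rhi false c | c <- cells T] ++
  [seq lpos e | e <- edges T] ++ [seq llo e | e <- edges T] ++
  [seq lhi e | e <- edges T].

(** A displacement of [p] by [d] moves off the critical values at [p] and crosses no others.
    Comparisons of the displaced coordinate thus reduce to comparisons at [p], strict or weak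
    according to the sign. *)
Definition clear p d := 0 < d /\
  forall h a, a \in critical -> a != co h p -> d < `|a - co h p|.

Lemma critical_rlo h c : c \in cells T -> rlo h c \in critical.
Proof. by case: h => cT; rewrite !mem_cat map_f ?orbT. Qed.
Lemma critical_rhi h c : c \in cells T -> rhi h c \in critical.
Proof. by case: h => cT; rewrite !mem_cat map_f ?orbT. Qed.
Lemma critical_lpos e : e \in edges T -> lpos e \in critical.
Proof. by move=> eT; rewrite !mem_cat map_f ?orbT. Qed.
Lemma critical_llo e : e \in edges T -> llo e \in critical.
Proof. by move=> eT; rewrite !mem_cat map_f ?orbT. Qed.
Lemma critical_lhi e : e \in edges T -> lhi e \in critical.
Proof. by move=> eT; rewrite !mem_cat map_f ?orbT. Qed.

Lemma clear_exists p : exists d, clear p d.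
Proof.
have [d d0 dP] := positive_lower_bound
  ([seq `|a - co true p| | a <- critical] ++ [seq `|a - co false p| | a <- critical]).
exists d; split => // h a ac ap; apply: dP; last by rewrite normr_gt0 subr_eq0.
by rewrite mem_cat; case: h ap => _; apply/orP; [left|right];
  apply: (map_f (fun a => `|a - _|)).
Qed.

Lemma clear_le p d d' : 0 < d' -> d' <= d -> clear p d -> clear p d'.
Proof. by move=> d'0 d'd [_ dP]; split=> // h a ac /(dP _ _ ac); exact: le_lt_trans. Qed.

Lemma clear_signed p d h a s : clear p d -> a \in critical ->
  a != co h p + signed s d.
Proof.
move=> [d0 dP] ac; have [->|/(dP _ _ ac)] := eqVneq a (co h p).
  by rewrite eq_sym -subr_eq0 addrAC subrr add0r; case: s => /=; rewrite ?oppr_eq0 gt_eqF.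
apply: contraTN => /eqP->; rewrite addrAC subrr add0r -leNgt.
by case: s => /=; rewrite ?normrN gtr0_norm.
Qed.

Lemma clear_lower p d h a s : clear p d -> a \in critical ->
  (a <= co h p + signed s d) = (if s then a <= co h p else a < co h p).
Proof.
move=> [d0 dP] ac; have [->|/(dP _ _ ac)] := eqVneq a (co h p).
  by case: s => /=; rewrite ?lexx ?ltxx; apply/idP; lra.
rewrite ltr_normr => /orP[] gap; case: s => /=.
- by rewrite !leNgt; congr (~~ _); apply/idP/idP; lra.
- by rewrite !ltNge; apply/idP/idP; lra.
- by apply/idP/idP; lra.
- by apply/idP/idP; lra.
Qed.

Lemma clear_upper p d h a s : clear p d -> a \in critical ->
  (co h p + signed s d <= a) = (if s then co h p < a else co h p <= a).
Proof.
move=> cl ac; rewrite le_eqVlt eq_sym (negPf (clear_signed _ _ cl ac)) /=.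
by rewrite ltNge (clear_lower _ _ cl ac); case: s; rewrite -?leNgt -?ltNge.
Qed.

Lemma clear_lower_lt p d h a s : clear p d -> a \in critical ->
  (a < co h p + signed s d) = (if s then a <= co h p else a < co h p).
Proof.
by move=> cl ac; rewrite -(clear_lower _ _ cl ac) le_eqVlt
  (negPf (clear_signed _ _ cl ac)).
Qed.

Lemma clear_upper_lt p d h a s : clear p d -> a \in critical ->
  (co h p + signed s d < a) = (if s then co h p < a else co h p <= a).
Proof.
by move=> cl ac; rewrite -(clear_upper _ _ cl ac) le_eqVlt eq_sym
  (negPf (clear_signed _ _ cl ac)).
Qed.

Lemma quad_diag sg p c d : clear p d -> c \in cells T ->
  rect_pts c (diag p d sg) -> quad sg p c.
Proof.
move=> cl cT /rect_ptsP cp h; have := cp h; rewrite co_diag.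
by rewrite (clear_lower _ _ cl) ?critical_rlo// (clear_upper _ _ cl) ?critical_rhi//;
  case: (sg h).
Qed.

Lemma quad_diag_in sg p c d : clear p d -> c \in cells T ->
  quad sg p c -> rect_in c (diag p d sg).
Proof.
move=> cl cT cp h; have := cp h; rewrite co_diag.
by rewrite (clear_lower_lt _ _ cl) ?critical_rlo// (clear_upper_lt _ _ cl) ?critical_rhi//;
  case: (sg h).
Qed.

Lemma rect_in_inj c c' p : c \in cells T -> c' \in cells T ->
  rect_in c p -> rect_in c' p -> c = c'.
Proof.
move=> cT c'T cp c'p; apply/eqP/negPn/negP => cc'.
have : ((rect_pts c)° `&` (rect_pts c')°) p by split; apply/interior_rect.
by rewrite (cell_disjoint hT cT c'T cc').
Qed.

Lemma quad_uniq sg p c c' : c \in cells T -> c' \in cells T ->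
  quad sg p c -> quad sg p c' -> c = c'.
Proof.
move=> cT c'T cp c'p; have [d cl] := clear_exists p.
exact: rect_in_inj (quad_diag_in cl cT cp) (quad_diag_in cl c'T c'p).
Qed.

(** A diagonal point close to [p] detects the cell in its quadrant; conversely every point close to
    [p] lies in a closed quadrant, hence in the cell filling it. Topological interior becomes a
    condition on four quadrants. *)
Lemma interior_domain p : (domain T)° p <->
  forall sg, exists2 c, c \in cells T & quad sg p c.
Proof.
have [d cl] := clear_exists p; have [d0 dP] := cl.
split=> [/interiorE[d' d'0 dA] sg|Q].
  pose b := Num.min d (d' / 2); have b0 : 0 < b by rewrite lt_min d0; lra.
  have clb : clear p b by apply: clear_le cl => //; rewrite ge_min lexx.
  have [|c cT cp] := dA (diag p b sg) _; last by exists c => //; apply: quad_diag cp.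
  move=> h; rewrite co_diag opprD addrA subrr sub0r normrN.
  apply: (@le_lt_trans _ _ (d' / 2)); last lra.
  by case: (sg h); rewrite /= ?normrN gtr0_norm// ge_min lexx orbT.
apply/interiorE; exists d => // q pq.
have [c cT cp] := Q (fun h => co h p <= co h q); exists c => //.
apply/rect_ptsP => h; have := cp h; have := pq h; rewrite ltr_norml => /andP[pq1 pq2].
case: ifP => [le_pq /andP[lo hi]|/negbT]; last rewrite -ltNge => lt_qp /andP[lo hi].
  have /(dP h _ (critical_rhi h cT)) : rhi h c != co h p by rewrite gt_eqF.
  by rewrite gtr0_norm ?subr_gt0// => ?; apply/andP; split; lra.
have /(dP h _ (critical_rlo h cT)) : rlo h c != co h p by rewrite lt_eqF.
by rewrite ltr0_norm ?subr_lt0// => ?; apply/andP; split; lra.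
Qed.

Lemma rlo_lt_rhi c h : c \in cells T -> rlo h c < rhi h c.
Proof. by move=> /(cell_proper hT)[]; case: h. Qed.

Lemma quad_cell c p : c \in cells T -> rect_pts c p ->
  quad (fun h => co h p < rhi h c) p c.
Proof.
move=> cT /rect_ptsP cp h; have /andP[lo hi] := cp h.
case: ifP => [->|/negbT]; first by rewrite lo.
by rewrite -leNgt hi => ge; rewrite (lt_le_trans (rlo_lt_rhi h cT) ge).
Qed.

Lemma cell_common_frontier c c' p : c \in cells T -> c' \in cells T -> c != c' ->
  rect_pts c p -> rect_pts c' p -> ~ rect_in c p.
Proof.
move=> cT c'T cc' cp c'p; have [E _] := cell_meet hT cT c'T cc'.
have : (rect_pts c `&` rect_pts c') p by [].
by rewrite E => -[/frontier_rect[]].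
Qed.

Lemma edge_not_in e c p : e \in edges T -> c \in cells T -> lseg_pts e p ->
  ~ rect_in c p.
Proof.
move=> eT cT ep; have [b bT /frontier_rect[bp nbp]] := edge_sub hT eT ep.
have [<-//|cb] := eqVneq b c.
move=> cp; rewrite eq_sym in cb.
exact: (cell_common_frontier cT bT cb (rect_in_pts cp) bp cp).
Qed.

Lemma edge_lt e : e \in edges T -> llo e < lhi e.
Proof. exact: edge_proper hT _. Qed.


Hypothesis hred : reduced T.

Lemma edge_vertex e p : e \in edges T -> p \in vertices T -> lseg_pts e p ->
  p = lseg_end0 e \/ p = lseg_end1 e.
Proof.
by move=> /(edge_consecutive hred)[_ [rho [_ _ _ _ H]]] pT ep; exact: H.
Qed.

Lemma end0_vertex e : e \in edges T -> lseg_end0 e \in vertices T.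
Proof.
by move=> eT; rewrite /vertices in_fsetU; apply/orP; left; apply/imfsetP; exists e.
Qed.

Lemma end1_vertex e : e \in edges T -> lseg_end1 e \in vertices T.
Proof.
by move=> eT; rewrite /vertices in_fsetU; apply/orP; right; apply/imfsetP; exists e.
Qed.

Lemma vertex_end p : p \in vertices T ->
  exists2 e, e \in edges T & p = lseg_end0 e \/ p = lseg_end1 e.
Proof.
rewrite /vertices in_fsetU => /orP[] /imfsetP[e /= eT ->]; exists e => //.
  by left.
by right.
Qed.

Lemma vertex_edge p : p \in vertices T -> exists2 e, e \in edges T & lseg_pts e p.
Proof.
move=> /vertex_end[e eT ep]; exists e => //.
by case: ep => ->; [apply: lseg_end0_pts|apply: lseg_end1_pts]; apply/ltW/edge_lt.
Qed.

Lemma edge_uniq e e' p : e \in edges T -> e' \in edges T -> p \notin vertices T ->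
  lseg_pts e p -> lseg_pts e' p -> e = e'.
Proof.
move=> eT e'T pT ep e'p; apply/eqP/negPn/negP => ee'.
by have := edge_meet hT eT e'T ee' (conj ep e'p); rewrite /= (negPf pT).
Qed.

(* the edge [e] leaves [p] in the direction of axis [h] and sign [s] *)
Definition leaves p h s e := [/\ e \in edges T, lhor e = h, co (~~ h) p = lpos e
  & if s then llo e <= co h p < lhi e else llo e < co h p <= lhi e].

Lemma leaves_pts p h s e : leaves p h s e -> lseg_pts e p.
Proof.
move=> [eT <- eq lt]; apply/lseg_ptsP; split=> //.
by case: s lt => /andP[a b]; apply/andP; split=> //; exact: ltW.
Qed.

(** The displaced point is strictly between the ends of [e], and a reduced mesh has no vertex inside
    an edge. Two edges leaving alike would then meet outside the vertices, hence [leaves_uniq]. *)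
Lemma leaves_along p h s e d : clear p d -> leaves p h s e ->
  lseg_pts e (along p d h s) /\ along p d h s \notin vertices T.
Proof.
move=> cl [eT eh eq lt].
have [lo hi] : llo e < co h (along p d h s) /\ co h (along p d h s) < lhi e.
  rewrite co_along (clear_lower_lt _ _ cl) ?critical_llo//.
  rewrite (clear_upper_lt _ _ cl) ?critical_lhi//.
  by case: s lt => /andP[].
have ea : lseg_pts e (along p d h s).
  by apply/lseg_ptsP; rewrite eh coN_along; split=> //; apply/andP; split; exact: ltW.
split=> //; apply/negP => /(edge_vertex eT)/(_ ea)[] E; move: lo hi; rewrite E -eh.
  by rewrite co_end0 ltxx.
by rewrite co_end1 ltxx.
Qed.

Lemma leaves_uniq p h s e e' : leaves p h s e -> leaves p h s e' -> e = e'.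
Proof.
move=> pe pe'; have [d cl] := clear_exists p.
have [eT _ _ _] := pe; have [e'T _ _ _] := pe'.
have [ea aT] := leaves_along cl pe; have [e'a _] := leaves_along cl pe'.
exact: edge_uniq ea e'a.
Qed.

Lemma leaves_end0 e : e \in edges T -> leaves (lseg_end0 e) (lhor e) true e.
Proof. by move=> eT; split; rewrite // ?coN_end0// co_end0 lexx edge_lt. Qed.

Lemma leaves_end1 e : e \in edges T -> leaves (lseg_end1 e) (lhor e) false e.
Proof. by move=> eT; split; rewrite // ?coN_end1// co_end1 lexx edge_lt. Qed.

Lemma leaves_exists e p : e \in edges T -> lseg_pts e p ->
  leaves p (lhor e) (co (lhor e) p < lhi e) e.
Proof.
move=> eT /lseg_ptsP[eq /andP[lo hi]]; split=> //.
case: ifP => [->|/negbT]; first by rewrite lo.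
by rewrite -leNgt hi => ge; rewrite (lt_le_trans (edge_lt eT) ge).
Qed.

Lemma leaves_vertex p h s e : p \in vertices T -> leaves p h s e ->
  p = if s then lseg_end0 e else lseg_end1 e.
Proof.
move=> pT pe; have ep := leaves_pts pe; have [eT eh eq lt] := pe.
case: (edge_vertex eT pT ep) => E; move: lt; rewrite E -eh ?co_end0 ?co_end1;
  by case: s {pe} => //; rewrite ltxx ?andbF.
Qed.

(** The frontier of a cell is a union of whole edges, and a point that is no vertex lies on at most
    one edge. *)
Lemma edge_sub_frontier e p c : e \in edges T -> c \in cells T ->
  p \notin vertices T -> lseg_pts e p -> rect_pts c p ->
  lseg_pts e `<=` frontier (rect_pts c).
Proof.
move=> eT cT pT ep cp q eq; have [E [/fsubsetP ET FE]] := cell_frontier hT cT.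
have : frontier (rect_pts c) p by apply/frontier_rect; split=> //; exact: edge_not_in ep.
rewrite FE => -[e' /= e'E e'p].
by exists e' => //; rewrite -(edge_uniq eT (ET _ e'E) pT ep e'p).
Qed.

(* [c] lies along the edge [e], on its positive side if [s] *)
Definition on_side e c s := [/\ c \in cells T, lseg_pts e `<=` rect_pts c
  & lpos e = if s then rlo (~~ lhor e) c else rhi (~~ lhor e) c].

(** If the line of [e] ran strictly between two parallel sides of [c], the midpoint of [e] would be
    interior to [c], which no point of an edge is. *)
Lemma edge_cell_side e c : e \in edges T -> c \in cells T ->
  lseg_pts e `<=` rect_pts c -> exists s, on_side e c s.
Proof.
move=> eT cT ec; have lt := edge_lt eT.
pose x := mkpt (fun h => if h == lhor e then (llo e + lhi e) / 2 else lpos e).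
have xh : co (lhor e) x = (llo e + lhi e) / 2 by rewrite co_mkpt eqxx.
have xn : co (~~ lhor e) x = lpos e by rewrite co_mkpt; case: (lhor e).
have ex : lseg_pts e x.
  by apply/lseg_ptsP; rewrite xn xh; split=> //; apply/andP; split; lra.
have /rect_ptsP cx := ec _ ex.
have /rect_ptsP c0 := ec _ (lseg_end0_pts (ltW lt)).
have /rect_ptsP c1 := ec _ (lseg_end1_pts (ltW lt)).
have [lo|lo] := eqVneq (lpos e) (rlo (~~ lhor e) c); first by exists true.
have [hi|hi] := eqVneq (lpos e) (rhi (~~ lhor e) c); first by exists false.
exfalso; apply: (edge_not_in eT cT ex) => h.
have [->|] := eqVneq h (lhor e).
  have := c0 (lhor e); have := c1 (lhor e).
  rewrite co_end0 co_end1 xh => /andP[_ a] /andP[b _].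
  by apply/andP; split; lra.
move=> hne; have -> : h = ~~ lhor e by move: hne; case: (h); case: (lhor e).
by have := cx (~~ lhor e); rewrite xn !lt_neqAle [_ == lpos e]eq_sym lo hi => /andP[-> ->].
Qed.

Definition signs h s s' : bool -> bool := fun k => if k == h then s else s'.

Lemma quad_ext sg sg' p c : sg =1 sg' -> quad sg p c -> quad sg' p c.
Proof. by move=> E cp h; rewrite -E. Qed.

Lemma on_side_quad e c p h s s' : on_side e c s' -> leaves p h s e ->
  quad (signs h s s') p c.
Proof.
move=> [cT ec pos] [eT eh eq lt] k; subst h; rewrite /signs.
have le := ltW (edge_lt eT).
have [->|kh] := eqVneq k (lhor e).
  have /rect_ptsP/(_ (lhor e)) := ec _ (lseg_end0_pts le).
  have /rect_ptsP/(_ (lhor e)) := ec _ (lseg_end1_pts le).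
  rewrite co_end0 co_end1 => /andP[_ hi] /andP[lo _].
  case: s lt => /andP[a b].
    by rewrite (le_trans _ a)// (lt_le_trans b).
  by rewrite (le_lt_trans _ a)// (le_trans b).
have -> : k = ~~ lhor e by move: kh; case: (k); case: (lhor e).
rewrite eq pos; case: s' {pos}; rewrite lexx ?andbT/=; exact: rlo_lt_rhi.
Qed.

Lemma on_side_uniq e c c' s : e \in edges T -> on_side e c s -> on_side e c' s ->
  c = c'.
Proof.
move=> eT ce c'e; have [cT _ _] := ce; have [c'T _ _] := c'e.
apply: (quad_uniq cT c'T (on_side_quad ce (leaves_end0 eT))).
exact: on_side_quad c'e (leaves_end0 eT).
Qed.

Lemma quad_along sg p c h d : clear p d -> c \in cells T -> quad sg p c ->
  rect_pts c (along p d h (sg h)).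
Proof.
move=> cl cT cp; apply/rect_ptsP => k; have [->|kh] := eqVneq k h.
  have /rect_ptsP/(_ h) := rect_in_pts (quad_diag_in cl cT cp).
  by rewrite co_along co_diag.
have -> : k = ~~ h by move: kh; case: (k); case: (h).
by rewrite coN_along; have /rect_ptsP := quad_pts cp.
Qed.

(** A point of [e] slightly off [p] lies in [c] and is no vertex, so all of [e] lies along [c]; the
    quadrant decides on which side. *)
Lemma quad_leaves sg p c h e : c \in cells T -> quad sg p c ->
  leaves p h (sg h) e -> on_side e c (sg (~~ h)).
Proof.
move=> cT cp pe; have [d cl] := clear_exists p.
have [ea aT] := leaves_along cl pe; have [eT eh eq lt] := pe.
have ec : lseg_pts e `<=` rect_pts c.
  move=> q qe; have := edge_sub_frontier eT cT aT ea (quad_along h cl cT cp).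
  by move=> /(_ q qe)/frontier_rect[].
have [s [_ _ pos]] := edge_cell_side eT cT ec; split=> //; rewrite pos eh.
have := cp (~~ h); rewrite eq pos eh; case: (s); case: (sg _) => //.
  by rewrite ltxx.
by rewrite ltxx andbF.
Qed.

(** A point slightly off [p] on the ray between the quadrants lies in two distinct cells, hence on a
    frontier and on an edge. That edge follows the ray, as the displaced coordinate is not
    critical. *)
Lemma edge_between_quads sg p c c' h : c \in cells T -> c' \in cells T ->
  c != c' -> quad sg p c -> quad (flip (~~ h) sg) p c' ->
  exists e, leaves p h (sg h) e.
Proof.
move=> cT c'T cc' cp c'p; have [d cl] := clear_exists p; have [d0 _] := cl.
set a := along p d h (sg h).
have ca : rect_pts c a by exact: quad_along.
have c'a : rect_pts c' a.
  by rewrite /a (_ : sg h = flip (~~ h) sg h); [exact: quad_along|case: (h)].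
have Fca : frontier (rect_pts c) a.
  by apply/frontier_rect; split=> //; exact: cell_common_frontier cc' ca c'a.
have [E [/fsubsetP ET FE]] := cell_frontier hT cT.
move: Fca; rewrite FE => -[e /= /ET eT ea]; exists e.
have /lseg_ptsP[apos ain] := ea.
have eh : lhor e = h.
  apply/eqP/negPn/negP => ne.
  have nh : ~~ lhor e = h by move: ne; case: (lhor e); case: (h).
  move: apos; rewrite nh co_along => apos.
  by have := @clear_signed p d h _ (sg h) cl (critical_lpos eT); rewrite apos eqxx.
rewrite eh coN_along in apos; split=> //.
move: ain; rewrite eh co_along (clear_lower _ _ cl) ?critical_llo//.
by rewrite (clear_upper _ _ cl) ?critical_lhi//; case: (sg h).
Qed.

(** The edge leaves its midpoint both ways, so cells on both sides fill all four quadrants there.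
    Conversely, at a point of the edge interior to the domain the quadrants on either side are
    filled. *)
Lemma int_edge_sides e : e \in edges T ->
  e \in int_edges T <-> forall s, exists c, on_side e c s.
Proof.
move=> eT; rewrite !inE eT /=; split=> [/asboolP[p [ep pT]] s|side].
  have /interior_domain/(_ (signs (lhor e) (co (lhor e) p < lhi e) s))[c cT cp] := pT.
  exists c; have := quad_leaves (h := lhor e) (e := e) cT cp.
  rewrite {1 2}/signs eqxx (_ : (~~ lhor e == lhor e) = false); last by case: lhor.
  by apply; exact: leaves_exists.
pose x := mkpt (fun h => if h == lhor e then (llo e + lhi e) / 2 else lpos e).
have xh : co (lhor e) x = (llo e + lhi e) / 2 by rewrite co_mkpt eqxx.
have xn : co (~~ lhor e) x = lpos e by rewrite co_mkpt; case: (lhor e).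
have lt := edge_lt eT.
have lx s : leaves x (lhor e) s e.
  by split=> //; rewrite xh; case: s; apply/andP; split; lra.
apply/asboolP; exists x; split; first exact: leaves_pts (lx true).
apply/interior_domain => sg; have [c ce] := side (sg (~~ lhor e)).
exists c; first by case: ce.
apply: quad_ext (on_side_quad ce (lx (sg (lhor e)))).
by move=> k; rewrite /signs; case: (k); case: (lhor e).
Qed.

Lemma int_edge e : e \in int_edges T -> e \in edges T.
Proof. by rewrite !inE => /andP[]. Qed.

Lemma leaves_interior p h s e : (domain T)° p -> leaves p h s e -> e \in int_edges T.
Proof.
move=> pT pe; have [eT eh _ _] := pe; apply/(int_edge_sides eT) => s'.
have /interior_domain/(_ (signs h s s'))[c cT cp] := pT.
exists c; have := quad_leaves (h := h) (e := e) cT cp.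
by rewrite {1 2}/signs eqxx (_ : (~~ h == h) = false) => [|]; [apply|case: (h)].
Qed.

End MeshGeometry.

(** * Edges shared by two cells *)

Section CommonEdge.
Context {R : realType} (T : tmesh R).
Hypotheses (hT : is_tmesh T) (hred : reduced T).
Implicit Types (p q : R * R) (c : rect R) (e : lseg R) (h s : bool) (d : R).

Lemma on_side_neq e c s : on_side T e c s -> ~ on_side T e c (~~ s).
Proof.
move=> [cT _ E] [_ _ E']; have := rlo_lt_rhi hT (~~ lhor e) cT.
by case: s E E' => /= <- <-; rewrite ltxx.
Qed.

(** Both cells contain [q], so at [p] they extend in the positive direction [h]. On the same side of
    that ray they would fill the same quadrant and coincide; hence the ray separates them. *)
Let leave_common c c' p q h : c \in cells T -> c' \in cells T -> c != c' ->
  rect_pts c p -> rect_pts c' p -> rect_pts c q -> rect_pts c' q ->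
  co h p < co h q -> exists e s,
    [/\ leaves T p h true e, on_side T e c s & on_side T e c' (~~ s)].
Proof.
move=> cT c'T cc' cp c'p cq c'q pq.
have := quad_cell hT cT cp; have := quad_cell hT c'T c'p.
set sg' := fun h => _; set sg := fun h => _ => c'quad cquad.
have sgh : sg h = true.
  by have /rect_ptsP/(_ h)/andP[_] := cq; exact: lt_le_trans.
have sgh' : sg' h = true.
  by have /rect_ptsP/(_ h)/andP[_] := c'q; exact: lt_le_trans.
have sgN : sg' (~~ h) = ~~ sg (~~ h).
  have [E|] := eqVneq (sg' (~~ h)) (sg (~~ h)); last first.
    by case: (sg' _); case: (sg _).
  move/eqP: cc'; case; apply: (quad_uniq hT cT c'T cquad).
  apply: quad_ext c'quad => k; have [->|kh] := eqVneq k h; first by rewrite sgh.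
  by have -> : k = ~~ h by move: kh; case: (k); case: (h).
have c'f : quad (flip (~~ h) sg) p c'.
  apply: quad_ext c'quad => k; rewrite /flip; have [->//|kh] := eqVneq k (~~ h).
  by have -> : k = h by [move: kh; case: (k); case: (h)]; rewrite sgh.
have [e pe] := edge_between_quads hT cT c'T cc' cquad c'f.
exists e, (sg (~~ h)); split; first by rewrite -sgh.
  exact: quad_leaves pe.
rewrite -sgN; apply: (quad_leaves hT hred c'T c'quad).
by rewrite sgh' -sgh.
Qed.

(* If the edge starting at [p] stopped before [q], its end would merely divide
   the common side of [c] and [c'], against reducedness. *)
Lemma common_edge c c' p q : c \in cells T -> c' \in cells T -> c != c' ->
  rect_pts c p -> rect_pts c' p -> rect_pts c q -> rect_pts c' q -> p != q ->
  exists e s, [/\ e \in int_edges T, lseg_pts e p, lseg_pts e q,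
    on_side T e c s & on_side T e c' (~~ s)].
Proof.
move=> cT c'T cc' cp c'p cq c'q pq.
have [h hpq] : exists h, co h p != co h q.
  apply: contrapT => /forallNP H; move/eqP: pq; apply; apply: co_inj => h.
  by apply/eqP/negPn/negP; exact: H.
wlog lt_pq : p q cp c'p cq c'q pq hpq / co h p < co h q.
  move=> W; move: (hpq); rewrite neq_lt => /orP[|lt]; first exact: W.
  have [||e [s [? ? ? ? ?]]] := W q p cq c'q cp c'p _ _ lt; rewrite 1?eq_sym//.
  by exists e, s.
(* Otherwise the midpoint of [p] and [q] would be interior to both cells. *)
have same : co (~~ h) p = co (~~ h) q.
  apply/eqP/negPn/negP => ne.
  pose m := mkpt (fun k => (co k p + co k q) / 2).
  have m_in b : rect_pts b p -> rect_pts b q -> rect_in b m.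
    move=> /rect_ptsP bp /rect_ptsP bq k; rewrite co_mkpt.
    have : co k p != co k q.
      by have [->//|kh] := eqVneq k h; have -> : k = ~~ h by move: kh; case: (k); case: (h).
    rewrite neq_lt; have /andP[a1 a2] := bp k; have /andP[b1 b2] := bq k.
    by case/orP => ?; apply/andP; split; lra.
  by move/eqP: cc'; apply; exact: (rect_in_inj hT cT c'T (m_in _ cp cq) (m_in _ c'p c'q)).
have [e [s [pe ce c'e]]] := leave_common cT c'T cc' cp c'p cq c'q lt_pq.
have [eT eh epos elt] := pe.
exists e, s; split=> //.
- apply: (int_edge_sides hT hred eT).2 => s'.
  have [->|s's] := eqVneq s' s; first by exists c.
  by exists c'; have -> : s' = ~~ s by move: s's; case: (s'); case: (s).
- exact: leaves_pts pe.
apply/lseg_ptsP; rewrite eh -same; split=> //.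
move: elt => /andP[lo _]; rewrite (le_trans lo (ltW lt_pq)) /= leNgt.
apply/negP => v_lt; pose v := lseg_end1 e.
have vh : co h v = lhi e by rewrite -eh co_end1.
have vn : co (~~ h) v = lpos e by rewrite -eh coN_end1.
have ev : lseg_pts e v by apply: lseg_end1_pts; exact/ltW/(edge_lt hT).
have cv : rect_pts c v by case: ce => _ /(_ _ ev).
have c'v : rect_pts c' v by case: c'e => _ /(_ _ ev).
have [|e' [s' [ve' _ _]]] := leave_common (h := h) cT c'T cc' cv c'v cq c'q.
  by rewrite vh.
have vT : v \in vertices T by exact: end1_vertex.
apply: (no_splitting_vertex hred vT); exists e, e'.
have [e'T e'h _ /andP[_ e'hi]] := ve'.
split=> //; rewrite ?eh//.
  by apply/eqP => ee'; move: e'hi; rewrite -ee' vh ltxx.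
move=> f fT; split; last by case=> ->; [exact: ev|exact: leaves_pts ve'].
move=> fv; have vf := leaves_exists hT fT fv; set t := (_ < _) in vf.
have [fh|fh] := eqVneq (lhor f) h.
  rewrite fh in vf; case: t vf => vf.
    by right; exact: leaves_uniq vf ve'.
  left; apply: (leaves_uniq hT hred vf).
  by rewrite -eh; exact: leaves_end1.
(* A transverse edge [f] at [v] would enter the interior of [b], the one of the two cells lying on
   the side where [f] goes: [b] contains [p] and [q], so it extends past [v] both ways. *)
exfalso; have {}fh : lhor f = ~~ h by move: fh; case: lhor; case: (h).
rewrite fh in vf.
have [b [bT bp bq be]] : exists b,
    [/\ b \in cells T, rect_pts b p, rect_pts b q & on_side T e b t].
  by have [->|ts] := eqVneq t s; [exists c|exists c'; split=> //;
    move: ts c'e; case: (t); case: (s)].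
have [d cl] := clear_exists T v; have [d0 _] := cl.
have [fa _] := leaves_along hred cl vf.
apply: (edge_not_in hT fT bT fa) => k.
have [->|kh] := eqVneq k (~~ h).
  have := on_side_quad hT be (leaves_end1 hT eT) (~~ h).
  rewrite -/v /signs eh (_ : (~~ h == h) = false); last by case: (h).
  rewrite co_along (clear_lower_lt _ _ cl) ?critical_rlo//.
  by rewrite (clear_upper_lt _ _ cl) ?critical_rhi//; case: (t).
have -> : k = h by move: kh; case: (k); case: (h).
have -> : co h (along v d (~~ h) t) = co h v.
  by have := coN_along v d (~~ h) t; rewrite negbK.
rewrite vh.
have /rect_ptsP/(_ h)/andP[b1 _] := bp; have /rect_ptsP/(_ h)/andP[_ b2] := bq.
rewrite (lt_le_trans v_lt b2) andbT (le_lt_trans b1)//.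
by have [_ _ _ /andP[]] := pe.
Qed.

End CommonEdge.

(** * Exactness of the relative cellular complex *)

Section Exactness.
Context {R : realType} (T : tmesh R).
Hypotheses (hT : is_tmesh T) (hred : reduced T).
Context {V : zmodType}.
Implicit Types (p q : R * R) (c : rect R) (e : lseg R) (h s : bool)
  (j : lseg R -> V) (f : rect R -> V).

Lemma int_verticesP p : p \in int_vertices T <-> p \in vertices T /\ (domain T)° p.
Proof.
have -> : (p \in int_vertices T) = (p \in vertices T) && `[< (domain T)° p >].
  by rewrite [LHS]in_fset.
by split=> [/andP[? /asboolP]|[-> ?]] //; exact/asboolP.
Qed.

Definition boundary j p : V :=
  \sum_(e <- int_edges T | lseg_end1 e == p) j e -
  \sum_(e <- int_edges T | lseg_end0 e == p) j e.

Definition cell_on e s : rect R := xget (Rect 0 0 0 0) [set c | on_side T e c s].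

(* The cell to the left of [e] minus the cell to its right, where horizontal
   edges point to the right and vertical ones upwards. *)
Definition jump f e : V := f (cell_on e (lhor e)) - f (cell_on e (~~ lhor e)).

Lemma cell_onP e s : e \in int_edges T -> on_side T e (cell_on e s) s.
Proof.
move=> eT; have eT' := int_edge eT.
apply: (@xgetPex _ _ [set c | on_side T e c s]).
exact: (int_edge_sides hT hred eT').1.
Qed.

Lemma cell_onE e c s : e \in edges T -> on_side T e c s -> cell_on e s = c.
Proof.
move=> eT ce; apply: (on_side_uniq hT eT _ ce).
by apply: (@xgetPex _ _ [set c | on_side T e c s]); exists c.
Qed.

(** At most one term, by [leaves_uniq]. Written as a sum it is linear in [j] and vanishes when no
    interior edge leaves that way. *)
Definition dirsum j p h s : V :=
  \sum_(e <- int_edges T | `[< leaves T p h s e >]) j e.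

Lemma dirsum_leaves j p h s e : e \in int_edges T -> leaves T p h s e ->
  dirsum j p h s = j e.
Proof.
move=> eT pe; rewrite /dirsum big_mkcond (bigD1_seq e) ?fset_uniq//= asboolT//.
rewrite big1 ?addr0// => e' ne; case: asboolP => // pe'.
by rewrite (leaves_uniq hT hred pe' pe) eqxx in ne.
Qed.

Lemma dirsum0 j p h s : (forall e, e \in int_edges T -> ~ leaves T p h s e) ->
  dirsum j p h s = 0.
Proof.
by move=> no; rewrite /dirsum big_seq_cond big1// => e /andP[/no pe /asboolP/pe].
Qed.

Lemma boundary_dirsum j p : p \in vertices T -> boundary j p =
  dirsum j p true false + dirsum j p false false -
  (dirsum j p true true + dirsum j p false true).
Proof.
move=> pT; rewrite /boundary; congr (_ - _).
  rewrite (bigID (fun e => lhor e)) /=; congr (_ + _); rewrite /dirsum;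
  rewrite big_seq_cond [RHS]big_seq_cond; apply: eq_bigl => e;
  apply: andb_id2l => /int_edge eT; apply/andP/asboolP => [[/eqP<- eh]|pe].
  - by have := leaves_end1 hT eT; rewrite eh.
  - by have := leaves_vertex hred pT pe => ->; case: pe => _ ->.
  - by have := leaves_end1 hT eT; rewrite (negPf eh).
  - by have := leaves_vertex hred pT pe => ->; case: pe => _ ->.
rewrite (bigID (fun e => lhor e)) /=; congr (_ + _); rewrite /dirsum;
rewrite big_seq_cond [RHS]big_seq_cond; apply: eq_bigl => e;
apply: andb_id2l => /int_edge eT; apply/andP/asboolP => [[/eqP<- eh]|pe].
- by have := leaves_end0 hT eT; rewrite eh.
- by have := leaves_vertex hred pT pe => ->; case: pe => _ ->.
- by have := leaves_end0 hT eT; rewrite (negPf eh).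
- by have := leaves_vertex hred pT pe => ->; case: pe => _ ->.
Qed.

(** The two cells lie on either side of the ray. Without an edge along the ray they coincide, and
    both sides of the equation vanish. *)
Lemma dirsum_jump f p h s c c' : c \in cells T -> c' \in cells T ->
  quad (signs h s h) p c -> quad (signs h s (~~ h)) p c' ->
  dirsum (jump f) p h s = f c - f c'.
Proof.
move=> cT c'T cp c'p.
have sh s' : signs h s s' h = s by rewrite /signs eqxx.
have shN s' : signs h s s' (~~ h) = s' by rewrite /signs; case: (h).
have sides e : leaves T p h s e -> on_side T e c h /\ on_side T e c' (~~ h).
  move=> pe; split.
    by have := quad_leaves hT hred (h := h) (e := e) cT cp; rewrite sh shN; apply.
  by have := quad_leaves hT hred (h := h) (e := e) c'T c'p; rewrite sh shN; apply.
have [[e pe]|no] := pselect (exists e, leaves T p h s e).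
  have [ce c'e] := sides _ pe; have [eT eh _ _] := pe.
  have eI : e \in int_edges T.
    apply: (int_edge_sides hT hred eT).2 => s'.
    have [->|s'h] := eqVneq s' h; first by exists c.
    by exists c'; have -> : s' = ~~ h by move: s'h; case: (s'); case: (h).
  rewrite (dirsum_leaves _ eI pe) /jump eh.
  by rewrite (cell_onE eT ce) (cell_onE eT c'e).
rewrite dirsum0 => [|e _ pe]; last by apply: no; exists e.
have [->|cc'] := eqVneq c c'; first by rewrite subrr.
exfalso; apply: no; rewrite -(sh h); apply: (edge_between_quads hT cT c'T cc' cp).
by apply: quad_ext c'p => k; rewrite /signs /flip; case: (k); case: (h).
Qed.

Lemma boundary_jump f p : p \in int_vertices T -> boundary (jump f) p = 0.
Proof.
move=> /int_verticesP[pT /interior_domain Q].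
have [tt ttT ttp] := Q (fun=> true).
have [ff ffT ffp] := Q (fun=> false).
have [tf tfT tfp] := Q id.
have [ft ftT ftp] := Q negb.
have ext sg sg' c : quad sg p c -> sg =1 sg' -> quad sg' p c.
  by move=> cp /quad_ext; apply.
rewrite boundary_dirsum//.
rewrite (@dirsum_jump f p true false ft ff)//; first last.
- by apply: (ext _ _ _ ffp); case.
- by apply: (ext _ _ _ ftp); case.
rewrite (@dirsum_jump f p false false ff tf)//; first last.
- by apply: (ext _ _ _ tfp); case.
- by apply: (ext _ _ _ ffp); case.
rewrite (@dirsum_jump f p true true tt tf)//; first last.
- by apply: (ext _ _ _ tfp); case.
- by apply: (ext _ _ _ ttp); case.
rewrite (@dirsum_jump f p false true ft tt)//; first last.
- by apply: (ext _ _ _ ttp); case.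
- by apply: (ext _ _ _ ftp); case.
by rewrite addrA subrK [f tt - _ + _]addrC addrA subrK subrr.
Qed.

(** Each ray at [p] prescribes the difference of [F] across it, but only when both adjacent
    quadrants are filled. Around [p] the four equations are consistent exactly when the boundary of
    [j] vanishes; next to an empty quadrant an equation is void and the others can be solved. *)
Lemma quadrant_potential j p : p \in vertices T ->
  (p \in int_vertices T -> boundary j p = 0) ->
  exists F : (bool -> bool) -> V, (forall sg sg', sg =1 sg' -> F sg = F sg') /\
  forall h s, (forall s', exists2 c, c \in cells T & quad (signs h s s') p c) ->
    dirsum j p h s = F (signs h s h) - F (signs h s (~~ h)).
Proof.
move=> pT bd.
pose J := dirsum j p; pose inh sg := exists2 c, c \in cells T & quad sg p c.
have inhE sg sg' : sg =1 sg' -> inh sg -> inh sg'.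
  by move=> E [c cT cp]; exists c => //; exact: quad_ext cp.
have in_cells h s : (forall s', exists2 c, c \in cells T & quad (signs h s s') p c) ->
    if h then forall s', inh (fun k => if k then s else s')
    else forall s', inh (fun k => if k then s' else s).
  by move=> H; case: h H => H s'; apply: inhE (H s'); case.
pose mk (v1 v2 v3 v4 : V) (sg : bool -> bool) : V :=
  if sg true then if sg false then v1 else v2 else if sg false then v3 else v4.
have mkE v1 v2 v3 v4 sg sg' : sg =1 sg' -> mk v1 v2 v3 v4 sg = mk v1 v2 v3 v4 sg'.
  by move=> E; rewrite /mk !E.
have [[s' no]|all_left] := pselect (exists s', ~ inh (fun k => if k then false else s')).
  (* the equation between the two quadrants on the left is void *)
  exists (mk (J true true - J false false) (- J false false)
    (J true true - J false false + J false true) 0); split; first exact: mkE.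
  case=> -[] /in_cells/= Q; rewrite /mk /signs /= -/(J _ _).
  - by rewrite opprK subrK.
  - by case: no.
  - by rewrite addrAC subrr add0r.
  - by rewrite sub0r opprK.
(* Both left quadrants are filled here; if the right ones are too, [p] is an interior vertex and the
   cycle condition yields the last equation. *)
have JTT : (forall s', inh (fun k => if k then true else s')) ->
    J true true = J true false - J false true + J false false.
  move=> all_right; have := bd _; rewrite boundary_dirsum// => E.
  have /E/eqP : p \in int_vertices T.
    apply/int_verticesP; split=> //; apply/interior_domain => sg.
    suff : inh (fun k => if k then sg true else sg false) by apply: inhE; case.
    by case: (sg true) => //; apply: contrapT => no; apply: all_left; exists (sg false).
  rewrite subr_eq0 => /eqP E'; rewrite addrAC -/(J _ _) in E' *.
  by rewrite /J E' addrK.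
exists (mk (J true false - J false true) (- J false false) (J true false) 0).
split; first exact: mkE.
case=> -[] /in_cells/= Q; rewrite /mk /signs /= -/(J _ _).
- by rewrite opprK JTT.
- by rewrite subr0.
- by rewrite opprB addrCA subrr addr0.
- by rewrite sub0r opprK.
Qed.

Lemma local_potential j p : (p \in int_vertices T -> boundary j p = 0) ->
  exists phi : rect R -> V, forall e c c', e \in int_edges T -> lseg_pts e p ->
    on_side T e c (lhor e) -> on_side T e c' (~~ lhor e) -> j e = phi c - phi c'.
Proof.
move=> bd; have [pT|pT] := boolP (p \in vertices T); last first.
  have [[e eT ep]|no] := pselect (exists2 e, e \in int_edges T & lseg_pts e p); last first.
    by exists (fun=> 0) => e c c' eT ep; case: no; exists e.
  exists (fun c => if c == cell_on e (lhor e) then j e else 0) => e' c c' e'T e'p.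
  rewrite -{e' e'T e'p}(edge_uniq hT (int_edge eT) (int_edge e'T) pT ep e'p).
  move=> ce c'e; rewrite (cell_onE (int_edge eT) ce) eqxx; case: eqP => [cc'|].
    by case: (on_side_neq hT ce); rewrite -cc'.
  by rewrite subr0.
have [F [FE FJ]] := quadrant_potential pT bd.
pose sgn (c : rect R) : bool * bool := xget (true, true)
  [set a | quad (fun k : bool => if k then a.1 else a.2) p c].
pose phi c := F (fun k => if k then (sgn c).1 else (sgn c).2).
(* A cell fills two adjacent quadrants when [p] is inside one of its sides. No edge then runs
   between them, so [F] agrees on both and [phi] does not depend on the quadrant picked by [sgn]. *)
have step h s c : c \in cells T -> quad (signs h s true) p c ->
    quad (signs h s false) p c -> F (signs h s true) = F (signs h s false).
  move=> cT c1 c2; have : dirsum j p h s = F (signs h s h) - F (signs h s (~~ h)).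
    by apply: FJ; case; exists c.
  rewrite dirsum0; last first.
    move=> e _ pe; have sh s' : signs h s s' h = s by rewrite /signs eqxx.
    have shN s' : signs h s s' (~~ h) = s' by rewrite /signs; case: (h).
    have := quad_leaves hT hred (h := h) (e := e) cT c1.
    have := quad_leaves hT hred (h := h) (e := e) cT c2.
    rewrite !sh !shN => /(_ pe) ce /(_ pe) ce'.
    exact: (on_side_neq hT ce' ce).
  by move/esym/eqP; rewrite subr_eq0 => /eqP; case: (h).
have phiE sg c : c \in cells T -> quad sg p c -> phi c = F sg.
  move=> cT cp; rewrite /phi.
  have : quad (fun k : bool => if k then (sgn c).1 else (sgn c).2) p c.
    apply: (@xgetPex _ _ [set a : bool * bool | quad (fun k : bool => if k then a.1 else a.2) p c]).
    by exists (sg true, sg false); apply: quad_ext cp; case.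
  move: (sgn c) => [a b] /= cab.
  have E : sg =1 (fun k : bool => if k then sg true else sg false) by case.
  rewrite (FE _ _ E); have {E} cp' := quad_ext E cp.
  move: (sg true) (sg false) cp' => a' b' {cp}cp.
  have [aa|aa] := eqVneq a a'; have [bb|bb] := eqVneq b b'.
  - by rewrite aa bb.
  - have := @step true a c cT; rewrite -aa in cp *.
    have E1 k : signs true a k =1 (fun k' : bool => if k' then a else k) by case.
    rewrite !(FE _ _ (E1 _)); case: b b' bb cab cp => [] [] // _ cab cp -> //;
      by apply: quad_ext; [move=> ?; exact/esym/E1|].
  - have := @step false b c cT; rewrite -bb in cp *.
    have E1 k : signs false b k =1 (fun k' : bool => if k' then k else b) by case.
    rewrite !(FE _ _ (E1 _)); case: a a' aa cab cp => [] [] // _ cab cp -> //;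
      by apply: quad_ext; [move=> ?; exact/esym/E1|].
  (* Filling opposite quadrants would put the vertex [p] in the interior of the cell. *)
  - exfalso; have [e eT ep] := vertex_edge hT pT.
    apply: (edge_not_in hT eT cT ep); apply: quad_two_in cab cp _.
    by case.
exists phi => e c c' eT ep ce c'e.
have pe := leaves_exists hT (int_edge eT) ep; set s := (_ < _) in pe.
have q1 := on_side_quad hT ce pe; have q2 := on_side_quad hT c'e pe.
have [cT _ _] := ce; have [c'T _ _] := c'e.
rewrite (phiE _ _ cT q1) (phiE _ _ c'T q2) -FJ ?(dirsum_leaves _ eT pe)//.
by case=> [|]; case: (lhor e) {ce c'e pe} q1 q2 => q1 q2; [exists c|exists c'|exists c'|exists c].
Qed.

Lemma cycle_jump j : (forall p, p \in int_vertices T -> boundary j p = 0) ->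
  exists f, forall e, e \in int_edges T -> j e = jump f e.
Proof.
move=> bd; have /choice[phi phiP] : forall p, exists phi : rect R -> V,
    forall e c c', e \in int_edges T -> lseg_pts e p ->
    on_side T e c (lhor e) -> on_side T e c' (~~ lhor e) -> j e = phi c - phi c'.
  by move=> p; apply: local_potential; exact: bd.
pose g c c' : V := let p := xget 0 (rect_pts c `&` rect_pts c') in
  phi p c - phi p c'.
(* The chosen common point is immaterial: two such points lie on one common edge, across which both
   local potentials jump by [j e], up to the same sign. *)
have gE c c' p : c \in cells T -> c' \in cells T -> rect_pts c p -> rect_pts c' p ->
    g c c' = phi p c - phi p c'.
  move=> cT c'T cp c'p; rewrite /g; set q := xget _ _.
  have [cq c'q] : rect_pts c q /\ rect_pts c' q.
    by apply: (@xgetPex _ _ (rect_pts c `&` rect_pts c')); exists p.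
  have [->|cc'] := eqVneq c c'; first by rewrite !subrr.
  have [->//|pq] := eqVneq p q.
  have [e [s [eT ep eq ce c'e]]] := common_edge hT hred cT c'T cc' cp c'p cq c'q pq.
  have [sh|sh] := eqVneq s (lhor e).
    rewrite sh in ce c'e.
    by rewrite -(phiP p e c c')// -(phiP q e c c').
  have {}sh : s = ~~ lhor e by move: sh; case: s {ce c'e}; case: lhor.
  rewrite sh negbK in ce c'e; apply: oppr_inj; rewrite !opprB.
  by rewrite -(phiP p e c' c)// -(phiP q e c' c).
have [|f fP] := @cocycle_potential R V (cells T) g (domain_simply_connected hT).
  move=> c1 c2 c3 p c1T c2T c3T c1p c2p c3p.
  by rewrite (gE c1 c2 p)// (gE c2 c3 p)// (gE c1 c3 p)// addrA subrK.
exists f => e eT; have eT' := int_edge eT.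
have ce := cell_onP (lhor e) eT; have c'e := cell_onP (~~ lhor e) eT.
have ep := lseg_end0_pts (ltW (edge_lt hT eT')).
have [cT cs _] := ce; have [c'T c's _] := c'e.
rewrite /jump -(fP _ _ (lseg_end0 e))//; [|exact: cs|exact: c's].
rewrite (gE _ _ (lseg_end0 e))//; [|exact: cs|exact: c's].
by rewrite -(phiP _ e).
Qed.

(** With no edge to the right or upwards, the cell of the upper right quadrant would also fill the
    two adjacent ones and have the vertex [p] in its interior. The growing coordinate sum drives the
    induction in [d1_onto]. *)
Lemma int_vertex_leaves p : p \in int_vertices T ->
  exists e, [/\ e \in int_edges T, lseg_end0 e = p
    & p.1 + p.2 < (lseg_end1 e).1 + (lseg_end1 e).2].
Proof.
move=> /int_verticesP[pT pI].
suff [e [h pe]] : exists e h, leaves T p h true e.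
  exists e; have [eT eh eq lt] := pe; rewrite (leaves_interior hT hred pI pe).
  rewrite -(leaves_vertex hred pT pe); split=> //; move: eq lt.
  rewrite -eh /lseg_end1; case: (lhor e) => /= -> /andP[_ lt].
    by rewrite ltrD2r.
  by rewrite ltrD2l.
have Q := (interior_domain T p).1 pI.
have [tt ttT ttp] := Q (fun=> true).
have [tf tfT tfp] := Q (flip (~~ true) (fun=> true)).
have [ft ftT ftp] := Q (flip (~~ false) (fun=> true)).
have [E1|ne] := eqVneq tt tf; last first.
  by have [e] := edge_between_quads hT ttT tfT ne ttp tfp; exists e, true.
have [E2|ne] := eqVneq tt ft; last first.
  by have [e] := edge_between_quads hT ttT ftT ne ttp ftp; exists e, false.
exfalso; have [e eT ep] := vertex_edge hT pT.
apply: (edge_not_in hT eT ttT ep); rewrite -E1 in tfp; rewrite -E2 in ftp.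
case; first by have := ftp true; have := ttp true; rewrite /= => /andP[_ ->] /andP[->].
by have := tfp false; have := ttp false; rewrite /= => /andP[_ ->] /andP[->].
Qed.

End Exactness.

(** * Chains on maximal segments *)

Section MaximalSegments.
Context {R : realType} (T : tmesh R).
Hypotheses (hT : is_tmesh T) (hred : reduced T).
Implicit Types (p q : R * R) (c : rect R) (e rho : lseg R) (h s : bool).

Lemma MS_max rho : rho \in MS T -> is_max_segment (int_edges T) rho.
Proof. by move/max_segmentsP; apply=> e /int_edge; exact: edge_lt. Qed.

Lemma MS_lt rho : rho \in MS T -> llo rho < lhi rho.
Proof. by move/MS_max => [[]]. Qed.

Lemma int_edge_segment e : e \in int_edges T -> is_segment (int_edges T) e.
Proof.
move=> eT; split; first exact/(edge_lt hT)/int_edge.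
exists [fset e]%fset; split; first by rewrite fsub1set.
by apply/seteqP; split=> [p ep|p [e' /= /[!inE]/eqP-> //]]; exists e; rewrite //= inE.
Qed.

Lemma segment_leaves rho p s : is_segment (int_edges T) rho -> lseg_pts rho p ->
  (if s then co (lhor rho) p < lhi rho else llo rho < co (lhor rho) p) ->
  exists e, [/\ e \in int_edges T, leaves T p (lhor rho) s e
    & lseg_pts e `<=` lseg_pts rho].
Proof.
move=> [lt [E [/fsubsetP ET rE]]] rp room; set h := lhor rho in room *.
have [rpos /andP[rlo rhi]] := (lseg_ptsP rho p).1 rp.
have [d cl] := clear_exists T p; have [d0 _] := cl.
pose g := if s then lhi rho - co h p else co h p - llo rho.
have g0 : 0 < g by rewrite /g; case: (s) room => ?; rewrite subr_gt0.
have {}cl : clear T p (Num.min d g).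
  by apply: clear_le cl; rewrite ?lt_min ?d0// ge_min lexx.
have [_ gm] : Num.min d g <= d /\ Num.min d g <= g by rewrite !ge_min !lexx orbT.
have [m0 _] := cl; set m := Num.min d g in cl gm m0.
have rx : lseg_pts rho (along p m h s).
  apply/lseg_ptsP; rewrite coN_along co_along -/h; split=> //.
  by move: gm; rewrite /g; case: (s) => /= gm; apply/andP; split; rewrite -/h in rlo rhi; lra.
have [e /= eE ex] : lsegs_pts E (along p m h s) by rewrite -rE.
have eT := ET _ eE; have eT' := int_edge eT.
have er : lseg_pts e `<=` lseg_pts rho by rewrite rE => x; exists e.
have [eh epos _ _] := lseg_sub (edge_lt hT eT') er.
exists e; split=> //; split=> //; first by rewrite epos.
have /lseg_ptsP[_] := ex; rewrite eh co_along (clear_lower _ _ cl) ?critical_llo//.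
by rewrite (clear_upper _ _ cl) ?critical_lhi//; case: (s).
Qed.

(** Collinear segments with a common point have a segment as union, and maximality makes that union
    equal to [rho]. *)
Lemma max_segment_absorb (E : {fset lseg R}) rho sigma p :
  is_max_segment E rho -> is_segment E sigma -> lhor sigma = lhor rho ->
  lseg_pts rho p -> lseg_pts sigma p -> lseg_pts sigma `<=` lseg_pts rho.
Proof.
move=> [[lt [A [AE rA]]] rmax] [lt' [B [BE sB]]] eh rp sp.
have [rpos /andP[r1 r2]] := (lseg_ptsP rho p).1 rp.
have [spos /andP[s1 s2]] := (lseg_ptsP sigma p).1 sp.
pose u := LSeg (lhor rho) (lpos rho) (Num.min (llo rho) (llo sigma))
  (Num.max (lhi rho) (lhi sigma)).
have uE : lseg_pts u = lseg_pts rho `|` lseg_pts sigma.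
  rewrite eh in spos s1 s2.
  apply/seteqP; split=> [q /lseg_ptsP/=[qpos]|q [|] /lseg_ptsP[qpos /andP[q1 q2]]].
  - rewrite ge_min le_max => /andP[q1 q2].
    have [rq|rq] := boolP (llo rho <= co (lhor rho) q <= lhi rho).
      by left; apply/lseg_ptsP.
    right; apply/lseg_ptsP; rewrite eh qpos -spos rpos; split=> //.
    move: rq q1 q2; rewrite negb_and -!ltNge => /orP[] ? /orP[] ? /orP[] ?;
      apply/andP; split; lra.
  - by apply/lseg_ptsP => /=; rewrite qpos ge_min q1 le_max q2.
  - apply/lseg_ptsP => /=; rewrite -eh qpos ge_min q1 orbT le_max q2 orbT.
    by rewrite -spos -rpos.
have -> : rho = u.
  symmetry; apply: rmax; last by rewrite uE; exact: subsetUl.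
  split; first by rewrite /= gt_min lt_max lt.
  exists (A `|` B)%fset; split; first by rewrite fsubUset AE.
  rewrite uE rA sB; apply/seteqP; split=> [q [[e /= eA]|[e /= eB]]|q [e /=]].
  - by exists e => //=; rewrite inE eA.
  - by exists e => //=; rewrite inE eB orbT.
  - by rewrite inE => /orP[eA|eB] eq; [left|right]; exists e.
by rewrite uE; exact: subsetUr.
Qed.

Lemma int_edge_sub_MS rho e p : rho \in MS T -> e \in int_edges T ->
  lhor e = lhor rho -> lseg_pts rho p -> lseg_pts e p ->
  lseg_pts e `<=` lseg_pts rho.
Proof.
move=> /MS_max rmax /int_edge_segment es eh; exact: max_segment_absorb rmax es eh.
Qed.

Lemma MS_uniq rho rho' p : rho \in MS T -> rho' \in MS T ->
  lhor rho = lhor rho' -> lseg_pts rho p -> lseg_pts rho' p -> rho = rho'.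
Proof.
move=> /MS_max rmax /MS_max [r's r'max] eh rp r'p.
have [rs _] := rmax.
apply: r'max rs _; exact: max_segment_absorb rmax r's (esym eh) rp r'p.
Qed.

Lemma edge_domain e p : e \in edges T -> lseg_pts e p -> domain T p.
Proof.
by move=> eT /(edge_sub hT eT)[c cT /frontier_rect[cp _]]; exists c.
Qed.

Lemma MS_point rho p : rho \in MS T -> lseg_pts rho p ->
  exists e, [/\ e \in int_edges T, lseg_pts e p & lseg_pts e `<=` lseg_pts rho].
Proof.
move=> /MS_max[[_ [E [/fsubsetP ET rE]]] _]; rewrite rE => -[e /= eE ep].
by exists e; split=> //; [exact: ET|move=> q eq; exists e].
Qed.

Lemma MIS_MS rho : rho \in MIS T -> rho \in MS T.
Proof. by rewrite /MIS in_fset inE /= => /andP[]. Qed.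

(** Reducedness supplies the segment; it is not a boundary one, because a boundary edge contains no
    interior point of the domain. *)
Lemma MS_atP p h : p \in int_vertices T ->
  [/\ MS_at T h p \in MS T, lhor (MS_at T h p) = h & lseg_pts (MS_at T h p) p].
Proof.
move=> /int_verticesP[pT pI].
apply: (@xgetPex _ _ [set rho | [/\ rho \in MS T, lhor rho = h & lseg_pts rho p]]).
have [rho [[rT rh rp] _]] := vertex_segments hred pT h.
exists rho; split=> //; move: rT; rewrite /MS_hat !in_fsetU.
have bnd : rho \in bnd_MS T -> False.
  rewrite /bnd_MS => /max_segmentsP[].
    by move=> e; rewrite in_fsetD => /andP[_]; exact: edge_lt.
  move=> [_ [E [/fsubsetP ET rE]]] _; move: rp; rewrite rE => -[e /= /ET].
  rewrite in_fsetD => /andP[+ eT] ep; rewrite [_ \in _]in_fset /= inE /= eT /=.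
  by move=> /asboolP; apply; exists p.
case/orP => [/orP[/orP[]|]|/bnd//]; last exact: MIS_MS.
  by rewrite in_fset inE /= => /andP[].
by rewrite in_fset inE /= => /andP[].
Qed.

Lemma MS_at_eq rho p : p \in int_vertices T -> rho \in MS T -> lseg_pts rho p ->
  MS_at T (lhor rho) p = rho.
Proof. by move=> pT rT rp; have [mT mh mp] := MS_atP (lhor rho) pT; exact: MS_uniq mp rp. Qed.

Lemma MIS_vertex rho p : rho \in MIS T -> p \in vertices T -> lseg_pts rho p ->
  p \in int_vertices T.
Proof.
move=> rM pT rp; apply/int_verticesP; split=> //.
have [e [eT ep _]] := MS_point (MIS_MS rM) rp.
move: rM; rewrite /MIS in_fset inE /= => /andP[_ /asboolP avoid].
apply: contrapT => pI; suff : (lseg_pts rho `&` frontier (domain T)) p by rewrite avoid.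
by split=> //; split=> //; apply/subset_closure/(edge_domain (int_edge eT)).
Qed.

(** An interior edge has cells on both sides, so its points other than the ends are interior to the
    domain; the frontier can be met only at a vertex. *)
Lemma nonMIS_vertex rho : rho \in MS T -> rho \notin MIS T ->
  exists p, [/\ p \in vertices T, lseg_pts rho p & p \notin int_vertices T].
Proof.
move=> rT; rewrite /MIS in_fset inE /= rT /= => /asboolP/eqP/set0P[p [rp [_ pI]]].
exists p; split=> //; last by apply/negP => /int_verticesP[].
apply/negPn/negP => pT; apply: pI.
have [e [eT ep _]] := MS_point rT rp; have eT' := int_edge eT.
have [epos /andP[lo hi]] := (lseg_ptsP e p).1 ep.
have inside : llo e < co (lhor e) p < lhi e.
  rewrite !lt_neqAle lo hi !andbT; apply/andP; split; apply: contra pT => /eqP E.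
    by have -> : p = lseg_end0 e;
      [apply: (@co_inj2 _ (lhor e)); rewrite ?co_end0 ?coN_end0|exact: end0_vertex].
  by have -> : p = lseg_end1 e;
    [apply: (@co_inj2 _ (lhor e)); rewrite ?co_end1 ?coN_end1|exact: end1_vertex].
have pe s : leaves T p (lhor e) s e.
  by split=> //; have /andP[] := inside; case: (s) => a b; rewrite ?a ?b ?(ltW a) ?(ltW b).
apply/interior_domain => sg.
have [c ce] := (int_edge_sides hT hred eT').1 eT (sg (~~ lhor e)).
exists c; first by case: ce.
apply: quad_ext (on_side_quad hT ce (pe (sg (lhor e)))).
by move=> k; rewrite /signs; case: (k); case: (lhor e).
Qed.

Lemma MIS_int_vertex rho : rho \in MIS T ->
  exists2 p, p \in int_vertices T & lseg_pts rho p.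
Proof.
move=> rM; have rT := MIS_MS rM.
have [e [eT _ er]] := MS_point rT (lseg_end0_pts (ltW (MS_lt rT))).
have eT' := int_edge eT.
have rp := er _ (lseg_end0_pts (ltW (edge_lt hT eT'))).
by exists (lseg_end0 e) => //; apply: MIS_vertex rM _ rp; exact: end0_vertex.
Qed.

Lemma seg_rE (r : lseg R -> int) rho e : constant_along_MS T r -> rho \in MS T ->
  e \in edges T -> lseg_pts e `<=` lseg_pts rho -> seg_r T r rho = r e.
Proof.
move=> rc rT eT er; rewrite /seg_r.
have [e'T e'r] := @xgetPex _ rho [set e | e \in edges T /\ lseg_pts e `<=` lseg_pts rho]
  (ex_intro _ e (conj eT er)).
exact: rc rT _ _ e'T eT e'r er.
Qed.

End MaximalSegments.

Section Chains.
Context {R : realType} (T : tmesh R).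
Hypotheses (hT : is_tmesh T) (hred : reduced T).
Implicit Types (p q : R * R) (e rho : lseg R) (h s : bool).

Definition dirbound {V : zmodType} (j : lseg R -> V) p h : V :=
  dirsum T j p h false - dirsum T j p h true.

Lemma boundary_dirbound {V : zmodType} (j : lseg R -> V) p : p \in int_vertices T ->
  boundary T j p = dirbound j p true + dirbound j p false.
Proof.
by move=> /int_verticesP[pT _]; rewrite boundary_dirsum// opprD addrACA.
Qed.

Lemma leaves_MS rho p s e : rho \in MS T -> p \in int_vertices T ->
  lseg_pts rho p -> leaves T p (lhor rho) s e -> lseg_pts e `<=` lseg_pts rho.
Proof.
move=> rT /int_verticesP[_ pI] rp pe; have [_ eh _ _] := pe.
exact: (int_edge_sub_MS hT rT (leaves_interior hT hred pI pe) eh rp (leaves_pts pe)).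
Qed.

(** Every edge of [rho] leaves exactly one vertex in direction [s], and all vertices on an MIS are
    interior. The result does not depend on [s], which makes directed boundaries cancel along an
    MIS. *)
Let sum_dirsum {V : zmodType} (j : lseg R -> V) rho s : rho \in MIS T ->
  \sum_(p <- int_vertices T | `[< lseg_pts rho p >]) dirsum T j p (lhor rho) s =
  \sum_(e <- int_edges T | `[< lseg_pts e `<=` lseg_pts rho >]) j e.
Proof.
move=> rM; have rT := MIS_MS rM; rewrite /dirsum.
rewrite big_seq_cond (exchange_big_dep (fun e => `[< lseg_pts e `<=` lseg_pts rho >]))/=.
  rewrite big_seq_cond [RHS]big_seq_cond; apply: eq_bigr => e /andP[eT /asboolP er].
  have eT' := int_edge eT; have lt := edge_lt hT eT'.
  have [eh _ _ _] := lseg_sub lt er.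
  pose v := if s then lseg_end0 e else lseg_end1 e.
  have ve : leaves T v (lhor rho) s e.
    by rewrite /v -eh; case: (s); [exact: leaves_end0|exact: leaves_end1].
  have rv := er _ (leaves_pts ve).
  have vT : v \in vertices T.
    by rewrite /v; case: (s); [exact: end0_vertex|exact: end1_vertex].
  have vI := MIS_vertex hT rM vT rv.
  rewrite big_mkcond (bigD1_seq v) ?fset_uniq//= vI !asboolT//=.
  rewrite big1 ?addr0// => p pv; case: ifP => // /andP[/andP[pI _] /asboolP pe].
  have [pT _] := (int_verticesP T p).1 pI.
  by rewrite (leaves_vertex hred pT pe) eqxx in pv.
move=> p e /andP[pI /asboolP rp] /asboolP pe; apply/asboolP.
exact: leaves_MS pe.
Qed.

Lemma dirbound_MIS {V : zmodType} (j : lseg R -> V) rho : rho \in MIS T ->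
  \sum_(p <- int_vertices T | `[< lseg_pts rho p >]) dirbound j p (lhor rho) = 0.
Proof. by move=> rM; rewrite sumrB !sum_dirsum// subrr. Qed.

(** If [rho] is no MIS, it has a vertex outside the interior of the domain, and minus the total is
    placed there; so the total is zero in all cases. *)
Lemma vertex_extension {K : fieldType} {V : vectType K} (U : {vspace V}) rho
    (x : R * R -> V) : rho \in MS T ->
  (forall p, p \in int_vertices T -> lseg_pts rho p -> x p \in U) ->
  (rho \in MIS T -> \sum_(p <- int_vertices T | `[< lseg_pts rho p >]) x p = 0) ->
  exists y : R * R -> V,
    [/\ forall p, lseg_pts rho p -> p \in vertices T -> y p \in U,
        forall p, p \in int_vertices T -> lseg_pts rho p -> y p = x p
      & \sum_(p <- vertices T | `[< lseg_pts rho p >]) y p = 0].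
Proof.
move=> rT xU x0; set tot := \sum_(p <- int_vertices T | _) x p in x0.
have totU : tot \in U.
  rewrite /tot big_seq_cond; apply: memv_suml => p /andP[pI /asboolP rp].
  exact: xU.
have [b bP] : exists b : R * R, rho \notin MIS T ->
    [/\ b \in vertices T, lseg_pts rho b & b \notin int_vertices T].
  have [rM|rM] := boolP (rho \in MIS T); first by exists 0.
  by have [b bP] := nonMIS_vertex hT hred rT rM; exists b.
pose y p := if p \in int_vertices T then x p else if p == b then - tot else 0.
exists y; split=> [p rp pT|p pI rp|]; rewrite /y.
- by case: ifP => [pI|_]; [exact: xU|case: ifP; rewrite ?memvN ?mem0v].
- by rewrite pI.
rewrite (bigID (mem (int_vertices T))) /=.
have -> : \sum_(p <- vertices T | `[< lseg_pts rho p >] && (p \in int_vertices T))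
    (if p \in int_vertices T then x p else if p == b then - tot else 0) = tot.
  rewrite /tot -[LHS]big_filter -[RHS]big_filter.
  rewrite (perm_big [seq p <- int_vertices T | `[< lseg_pts rho p >]]).
    by rewrite !big_filter [LHS]big_seq_cond [RHS]big_seq_cond;
      apply: eq_bigr => p /andP[->].
  apply: uniq_perm; rewrite ?filter_uniq ?fset_uniq// => p.
  rewrite !mem_filter -andbA; congr (_ && _); apply/andP/idP => [[]//|pI].
  by have [] := (int_verticesP T p).1 pI.
have [rM|rM] := boolP (rho \in MIS T).
  rewrite x0// add0r big_seq_cond big1// => p /and3P[pT /asboolP rp].
  by rewrite (MIS_vertex hT rM pT rp).
have [bT rb bI] := bP rM.
rewrite big_mkcond (bigD1_seq b) ?fset_uniq//= bI asboolT//= (negPf bI) eqxx.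
rewrite big1 ?addr0 ?subrr// => p pb.
by case: ifP => // /andP[_ pI]; rewrite (negPf pI) (negPf pb).
Qed.

(* The value of the chain on an edge is minus the sum of all values before it. *)
Lemma chain_on_MS {K : fieldType} {V : vectType K} (U : {vspace V}) rho
    (x : R * R -> V) : rho \in MS T ->
  (forall p, p \in int_vertices T -> lseg_pts rho p -> x p \in U) ->
  (rho \in MIS T -> \sum_(p <- int_vertices T | `[< lseg_pts rho p >]) x p = 0) ->
  exists2 j : lseg R -> V, (forall e, j e \in U) &
    forall p, p \in int_vertices T -> lseg_pts rho p -> dirbound j p (lhor rho) = x p.
Proof.
move=> rT xU x0; have [y [yU yx y0]] := vertex_extension rT xU x0.
set h := lhor rho.
pose S (P : pred R) := \sum_(q <- vertices T | `[< lseg_pts rho q >] && P (co h q)) y q.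
have Smem P : S P \in U.
  rewrite /S big_seq_cond; apply: memv_suml => q /and3P[qT /asboolP rq _].
  exact: yU.
have eqS (P Q : pred R) :
    (forall q, q \in vertices T -> lseg_pts rho q -> P (co h q) = Q (co h q)) -> S P = S Q.
  move=> PQ; rewrite /S big_seq_cond [RHS]big_seq_cond; apply: eq_bigl => q.
  by apply: andb_id2l => qT; apply: andb_id2l => /asboolP rq; exact: PQ.
exists (fun e => - S (fun a => a <= llo e)); first by move=> e; rewrite memvN.
move=> p pI rp; have [pT pD] := (int_verticesP T p).1 pI.
have [rpos /andP[plo phi]] := (lseg_ptsP rho p).1 rp; rewrite -/h in rpos plo phi.
have same q : lseg_pts rho q -> co h q = co h p -> q = p.
  move=> rq qp; apply: (@co_inj2 _ h) => //.
  by have [-> _] := (lseg_ptsP rho q).1 rq.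
set j := fun e => _.
have in_edge : dirsum T j p h false = - S (fun a => a < co h p).
  move: plo; rewrite le_eqVlt => /predU1P[plo|plo].
    rewrite dirsum0 => [|e eI pe]; last first.
      have er := leaves_MS rT pI rp pe; have [eT eh _ /andP[lt _]] := pe.
      have [_ _ le _] := lseg_sub (edge_lt hT eT) er.
      by have := le_lt_trans le lt; rewrite plo ltxx.
    rewrite /S big_seq_cond big1 ?oppr0// => q /and3P[qT /asboolP rq].
    by have [_ /andP[le _]] := (lseg_ptsP rho q).1 rq; rewrite ltNge -plo le.
  have [e [eI pe er]] := @segment_leaves _ _ hT _ _ false (MS_max hT rT).1 rp plo.
  rewrite (dirsum_leaves hT hred _ eI pe) /j; congr (- _); apply: eqS => q qT rq.
  have pE := leaves_vertex hred pT pe; have [eT eh epos /andP[lt _]] := pe.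
  have {}eh : lhor e = h by [].
  have ph : co h p = lhi e by rewrite -eh pE co_end1.
  apply/idP/idP => [/le_lt_trans|lt_qp]; first exact.
  rewrite leNgt; apply/negP => gt.
  have eq : lseg_pts e q.
    apply/lseg_ptsP; rewrite eh (ltW gt) -ph (ltW lt_qp); split=> //.
    by rewrite -epos rpos; have [] := (lseg_ptsP rho q).1 rq.
  case: (edge_vertex hred eT qT eq) => E.
    by move: gt; rewrite E -eh co_end0 ltxx.
  by move: lt_qp; rewrite ph E -eh co_end1 ltxx.
have out_edge : dirsum T j p h true = - S (fun a => a <= co h p).
  (* At the far end of [rho] no edge goes out, while the partial sum has become the full one; here
     the zero total enters. *)
  move: phi; rewrite le_eqVlt => /predU1P[phi|phi].
    rewrite dirsum0 => [|e eI pe]; last first.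
      have er := leaves_MS rT pI rp pe; have [eT eh _ /andP[_ lt]] := pe.
      have [_ _ _ le] := lseg_sub (edge_lt hT eT) er.
      by have := le_lt_trans le (_ : lhi rho < _); rewrite -/h -phi; move/(_ _ lt); rewrite ltxx.
    rewrite (eqS _ predT) ?/S; first by under eq_bigl do rewrite andbT; rewrite y0 oppr0.
    by move=> q qT rq; rewrite phi; have [_ /andP[_ ->]] := (lseg_ptsP rho q).1 rq.
  have [e [eI pe er]] := @segment_leaves _ _ hT _ _ true (MS_max hT rT).1 rp phi.
  rewrite (dirsum_leaves hT hred _ eI pe) /j; congr (- _); apply: eqS => q qT rq.
  have pE := leaves_vertex hred pT pe; have [eT eh _ _] := pe.
  have {}eh : lhor e = h by [].
  by have -> : co h p = llo e by rewrite -eh pE co_end0.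
rewrite /dirbound in_edge out_edge opprK addrC -(yx _ pI rp).
suff -> : S (fun a => a <= co h p) = S (fun a => a < co h p) + y p.
  by rewrite addrAC subrr add0r.
rewrite /S (bigID (fun q => co h q < co h p)) /=; congr (_ + _).
  apply: eq_bigl => q; rewrite -andbA; congr (_ && _).
  by apply/andP/idP => [[]//|lt]; rewrite (ltW lt).
rewrite big_mkcond (bigD1_seq p) ?fset_uniq//= asboolT// lexx ltxx /=.
rewrite big1 ?addr0// => q qp; case: ifP => // /andP[/andP[/asboolP rq le] nlt].
move: le nlt; rewrite le_eqVlt => /predU1P[E|->//].
by rewrite (same q rq E) eqxx in qp.
Qed.

End Chains.

(** * Bivariate polynomials *)

Section Bipolynomials.
Context {R : realType}.
Local Notation P2 := {poly {poly R}}.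
Implicit Types (P Q : P2) (A B k : nat) (e : lseg R).

(* degree less than [A] in s and less than [B] in t *)
Definition box A B P := forall i j, (A <= i)%N || (B <= j)%N -> P`_j`_i = 0.

Lemma box_swap A B P : box A B (swapXY P) <-> box B A P.
Proof.
split=> H i j ij; first by rewrite -coef_swapXY H// orbC.
by rewrite coef_swapXY H// orbC.
Qed.

(** A monic factor of degree [k] raises the degree of a nonzero coefficient by exactly [k]. If [k]
    reaches the bound, the truncated difference 0 rightly forces the cofactor to vanish. *)
Lemma box_mulC A B k (d : {poly R}) Q : d \is monic -> size d = k.+1 ->
  box A B (d%:P * Q) <-> box (A - k) B Q.
Proof.
move=> dm ds; have d0 : d != 0 by rewrite monic_neq0.
split=> H i j ij.
  have [->|Qj0] := eqVneq Q`_j 0; first by rewrite coef0.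
  have [jB|jB] := leqP B j.
    have : d * Q`_j = 0.
      by apply/polyP => l; rewrite -coefCM H ?jB ?orbT// coef0.
    by move/eqP; rewrite mulf_eq0 (negPf d0) (negPf Qj0).
  have {}ij : (A - k <= i)%N by case/orP: ij => //; rewrite leqNgt jB.
  apply: nth_default; apply: leq_trans ij.
  have /leq_sizeP : forall l, (A <= l)%N -> (d * Q`_j)`_l = 0.
    by move=> l Al; rewrite -coefCM H ?Al.
  by rewrite size_monicM// ds addSn /=; lia.
rewrite coefCM; have [jB|jB] := leqP B j.
  rewrite [Q`_j](_ : _ = 0) ?mulr0 ?coef0//.
  by apply/polyP => l; rewrite H ?jB ?orbT// coef0.
have {}ij : (A <= i)%N by case/orP: ij => //; rewrite leqNgt jB.
have [->|Qj0] := eqVneq Q`_j 0; first by rewrite mulr0 coef0.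
apply: nth_default; apply: leq_trans ij; rewrite size_monicM// ds addSn /=.
have : (size (Q`_j)%R <= A - k)%N by apply/leq_sizeP => l Al; rewrite H ?Al.
move=> sz; have kA : (k < A)%N.
  by rewrite -subn_gt0 (leq_trans _ sz)// size_poly_gt0.
by rewrite -(subnKC (ltnW kA)) leq_add2l.
Qed.

Lemma ell_pow_hor e k : lhor e ->
  ell_pow e k%:Z = ('X - (lpos e)%:P%:P) ^+ k.
Proof. by move=> eh; rewrite /ell_pow /ell eh /tvar absz_nat. Qed.

Lemma ell_pow_ver e k : ~~ lhor e ->
  ell_pow e k%:Z = (('X - (lpos e)%:P) ^+ k)%:P.
Proof.
by move=> /negPf eh; rewrite /ell_pow /ell eh /svar absz_nat -rmorphB rmorphXn.
Qed.

Lemma swap_ell_hor (a : R) k :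
  swapXY (('X - a%:P%:P) ^+ k) = (('X - a%:P) ^+ k)%:P.
Proof.
by rewrite rmorphXn rmorphB /= swapXY_X swapXY_polyC map_polyC -rmorphB -rmorphXn.
Qed.

Lemma box_ell A B e k Q : box A B (ell_pow e k%:Z * Q) <->
  if lhor e then box A (B - k) Q else box (A - k) B Q.
Proof.
have [dm ds] : ('X - (lpos e)%:P) ^+ k \is monic /\
    size (('X - (lpos e)%:P) ^+ k) = k.+1.
  by rewrite monic_exp ?monicXsubC// size_exp_XsubC.
case: ifPn => eh; last by rewrite ell_pow_ver//; exact: box_mulC.
rewrite -box_swap rmorphM ell_pow_hor//= swap_ell_hor.
by rewrite (box_mulC _ _ _ dm ds) box_swap.
Qed.

Lemma ell_pow_neq0 e k : ell_pow e k%:Z != 0.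
Proof.
have [eh|eh] := boolP (lhor e).
  by rewrite ell_pow_hor// expf_neq0// polyXsubC_eq0.
by rewrite ell_pow_ver// polyC_eq0 expf_neq0// polyXsubC_eq0.
Qed.

(** Induction on [k]: at [t = lpos e] the left side vanishes while the power of the line of [e']
    remains a nonzero polynomial in [s], so [P'] vanishes there and one factor cancels. *)
Lemma ell_pow_coprime e e' k k' P P' : lhor e -> ~~ lhor e' ->
  ell_pow e k%:Z * P = ell_pow e' k'%:Z * P' ->
  exists2 Q, P = ell_pow e' k'%:Z * Q & P' = ell_pow e k%:Z * Q.
Proof.
move=> eh eh'; rewrite ell_pow_hor// ell_pow_ver//.
set d := ('X - _) ^+ k'; have d0 : d != 0 by rewrite expf_neq0// polyXsubC_eq0.
have dC0 : d%:P != 0 by rewrite polyC_eq0.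
elim: k P' => [|k IHk] P' E.
  by exists P'; rewrite ?expr0 ?mul1r// -E expr0 mul1r.
have /factor_theorem[P'' P''E] : root P' (lpos e)%:P.
  have : (d%:P * P').[(lpos e)%:P] = 0.
    by rewrite -E exprS !hornerE subrr !mul0r.
  by rewrite hornerM hornerC => /eqP; rewrite mulf_eq0 (negPf d0).
have [|Q PE QE] := IHk P''.
  have X0 : 'X - (lpos e)%:P%:P != 0 :> P2 by rewrite polyXsubC_eq0.
  apply: (mulfI X0).
  by rewrite mulrA -exprS E P''E [RHS]mulrC mulrA.
by exists Q; rewrite // P''E QE exprSr mulrAC.
Qed.

End Bipolynomials.

Section TensorPolynomials.
Context {R : realType} (m m' : nat).
Local Notation Rmm := (bipoly R m m').
Local Notation P2 := {poly {poly R}}.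
Implicit Types (p q : Rmm) (P Q : P2) (e : lseg R) (k : nat).

Lemma bievalE p : bieval p =
  \poly_(j < m'.+1) \poly_(i < m.+1) p (inord i) (inord j).
Proof.
rewrite /bieval exchange_big poly_def; apply: eq_bigr => j _ /=.
rewrite -mul_polyC poly_def rmorph_sum mulr_suml; apply: eq_bigr => i _ /=.
by rewrite !inord_val /svar -rmorphXn -rmorphM /= -[in RHS]mul_polyC.
Qed.

Lemma coef_bieval p i j : (bieval p)`_j`_i =
  if (i < m.+1)%N && (j < m'.+1)%N then p (inord i) (inord j) else 0.
Proof.
rewrite bievalE coef_poly; case: ifP => _; last by rewrite coef0 andbF.
by rewrite coef_poly andbT.
Qed.

Lemma box_bieval p : box m.+1 m'.+1 (bieval p).
Proof.
move=> i j; rewrite coef_bieval; case: ifP => // /andP[im jm] /orP[].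
  by rewrite leqNgt im.
by rewrite leqNgt jm.
Qed.

Definition unbi P : Rmm := \matrix_(i, j) P`_j`_i.

Lemma unbi_bieval : cancel (@bieval R m m') unbi.
Proof.
by move=> p; apply/matrixP => i j; rewrite mxE coef_bieval !ltn_ord !inord_val.
Qed.

Lemma bieval_unbi P : box m.+1 m'.+1 P -> bieval (unbi P) = P.
Proof.
move=> H; apply/polyP => j; apply/polyP => i; rewrite coef_bieval.
case: ifP => [/andP[im jm]|/negbT]; first by rewrite mxE !inordK.
by rewrite negb_and -!leqNgt => /H.
Qed.

Lemma bieval_inj : injective (@bieval R m m').
Proof. exact: can_inj unbi_bieval. Qed.

Lemma bieval_linear a p q : bieval (a *: p + q) = a%:P%:P * bieval p + bieval q.
Proof.
apply/polyP => j; apply/polyP => i; rewrite coefD coefCM coefD coefCM.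
by rewrite !coef_bieval; case: ifP; rewrite ?mxE// mulr0 addr0.
Qed.

Lemma bievalB p q : bieval (p - q) = bieval p - bieval q.
Proof.
by rewrite addrC -scaleN1r bieval_linear !rmorphN1 mulN1r addrC.
Qed.

Lemma bieval0 : bieval (0 : Rmm) = 0.
Proof. by rewrite -(subrr (0 : Rmm)) bievalB subrr. Qed.

Lemma bievalN p : bieval (- p) = - bieval p.
Proof. by rewrite -sub0r bievalB bieval0 sub0r. Qed.

Lemma mem_biR (a b : int) p :
  reflect (forall (i : 'I_m.+1) (j : 'I_m'.+1), ~~ ((i : nat)%:Z <= a) || ~~ ((j : nat)%:Z <= b) -> p i j = 0)
          (p \in @biR R m m' a b).
Proof.
pose A := [set q : Rmm | forall (i : 'I_m.+1) (j : 'I_m'.+1),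
  ~~ ((i : nat)%:Z <= a) || ~~ ((j : nat)%:Z <= b) -> q i j = 0].
have AP q : q \in vspan A <-> A q.
  apply: mem_vspan => [i j _|c u w Au Aw i j ij]; first by rewrite mxE.
  by rewrite !mxE Au// Aw// mulr0 addr0.
apply: (iffP idP) => [|H].
  move: p; suff /subvP sub : (biR m m' a b <= vspan A)%VS by move=> p /sub/AP.
  apply/subv_sumP => i ia; apply/subv_sumP => j jb.
  rewrite -memvE; apply/AP => k l; rewrite !mxE.
  by case: eqP => [->|//]; case: eqP => [->|//]; rewrite ia jb.
rewrite [p]matrix_sum_delta; apply: memv_suml => i _; apply: memv_suml => j _.
have [/andP[ia jb]|/negPf] := boolP (((i : nat)%:Z <= a) && ((j : nat)%:Z <= b)).
  apply: memvZ; apply: subvP (_ : delta_mx i j \in <[delta_mx i j]>)%VS => //.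
    by apply: (sumv_sup i ia); apply: (sumv_sup j jb).
  exact: memv_line.
by move/negbT; rewrite negb_and => /H->; rewrite scale0r mem0v.
Qed.

Lemma mem_biR_box (a b : int) A B p : (A <= m.+1)%N -> (B <= m'.+1)%N ->
  (forall i, (i <= m)%N -> (i%:Z <= a) = (i < A)%N) ->
  (forall j, (j <= m')%N -> (j%:Z <= b) = (j < B)%N) ->
  p \in biR m m' a b <-> box A B (bieval p).
Proof.
move=> Am Bm aA bB; split=> [/mem_biR H i j ij|H].
  rewrite coef_bieval; case: ifP => // /andP[im jm]; apply: H.
  by rewrite aA ?bB ?inordK// -!leqNgt.
apply/mem_biR => i j; rewrite aA ?bB ?leq_ord// -!leqNgt => /H.
by rewrite coef_bieval !ltn_ord !inord_val.
Qed.

(* [B_seg] for a segment of smoothness [k - 1] *)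
Definition Bk e k : {vspace Rmm} :=
  if lhor e then biR m m' m (m'%:Z - k%:Z) else biR m m' (m%:Z - k%:Z) m'.

Lemma mem_Bk e k p : p \in Bk e k <->
  box m.+1 m'.+1 (ell_pow e k%:Z * bieval p).
Proof.
rewrite box_ell /Bk; case: ifP => _.
  by apply: mem_biR_box; rewrite ?leq_subr//; lia.
by apply: mem_biR_box; rewrite ?leq_subr//; lia.
Qed.

(** Truncation by [unbi] gives a linear map on all of [Rmm]; it is the actual product on [Bk e k]
    only. *)
Definition mul_ell e k p : Rmm := unbi (ell_pow e k%:Z * bieval p).

Lemma bieval_mul_ell e k p : p \in Bk e k ->
  bieval (mul_ell e k p) = ell_pow e k%:Z * bieval p.
Proof. by move/mem_Bk; exact: bieval_unbi. Qed.

Lemma mul_ell_linear e k : linear (mul_ell e k).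
Proof.
move=> a p q; apply/matrixP => i j; rewrite !mxE bieval_linear mulrDr mulrCA.
by rewrite !coefD !coefCM.
Qed.

Lemma mul_ell0 e k : mul_ell e k 0 = 0.
Proof. by apply/matrixP => i j; rewrite !mxE bieval0 mulr0 !coef0. Qed.

Lemma mul_ellN e k p : mul_ell e k (- p) = - mul_ell e k p.
Proof. by apply/matrixP => i j; rewrite !mxE bievalN mulrN !coefN. Qed.

Lemma mul_ell_inj e k : {in Bk e k &, injective (mul_ell e k)}.
Proof.
move=> p q pB qB /(congr1 (@bieval _ _ _)); rewrite !bieval_mul_ell//.
by move/(mulfI (ell_pow_neq0 e k))/bieval_inj.
Qed.

Lemma mem_vspan_divides (d : P2) p :
  p \in vspan [set p : Rmm | divides d (bieval p)] <-> divides d (bieval p).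
Proof.
apply: (@mem_vspan _ _ [set p : Rmm | divides d (bieval p)]).
  by exists 0; rewrite bieval0 mulr0.
move=> a u w [x ux] [y wy]; exists (a%:P%:P * x + y).
by rewrite bieval_linear ux wy mulrDr mulrCA.
Qed.

Lemma divides_ell e k p :
  divides (ell_pow e k%:Z) (bieval p) <-> exists2 q, q \in Bk e k & p = mul_ell e k q.
Proof.
split=> [[Q pQ]|[q qB ->]]; last by exists (bieval q); exact: bieval_mul_ell.
have QB : box m.+1 m'.+1 Q.
  have : box m.+1 m'.+1 (ell_pow e k%:Z * Q) by rewrite -pQ; exact: box_bieval.
  rewrite box_ell; case: ifP => _ H i j ij; apply: H; case/orP: ij => [ij|ij];
    by rewrite ?(leq_trans (leq_subr _ _) ij) ?ij ?orbT.
exists (unbi Q).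
  by apply/mem_Bk; rewrite bieval_unbi// -pQ; exact: box_bieval.
by rewrite /mul_ell bieval_unbi// -pQ unbi_bieval.
Qed.

(** The two powers are coprime, so a common multiple is a multiple of their product; the cofactor
    obeys precisely the degree bounds of the [q] in a vertex relation. *)
Lemma divides_ell_cross e e' k k' p : lhor e -> ~~ lhor e' ->
  divides (ell_pow e k%:Z) (bieval p) -> divides (ell_pow e' k'%:Z) (bieval p) ->
  exists q, [/\ q \in biR m m' (m%:Z - k'%:Z) (m'%:Z - k%:Z),
    bieval p = ell_pow e k%:Z * (ell_pow e' k'%:Z * bieval q),
    ell_pow e' k'%:Z * bieval q = bieval (mul_ell e' k' q) &
    ell_pow e k%:Z * bieval q = bieval (mul_ell e k q)].
Proof.
move=> eh eh' [P pP] [P' pP'].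
have [|Q PE P'E] := ell_pow_coprime (k := k) (k' := k') (P := P) (P' := P') eh eh'.
  by rewrite -pP.
have : box m.+1 m'.+1 (ell_pow e k%:Z * (ell_pow e' k'%:Z * Q)).
  by rewrite -PE -pP; exact: box_bieval.
rewrite box_ell eh box_ell (negPf eh') => Qbox.
have QB : box m.+1 m'.+1 Q.
  move=> i j ij; apply: Qbox; case/orP: ij => [ij|ij];
    by rewrite ?(leq_trans (leq_subr _ _) ij) ?ij ?orbT.
have qQ := bieval_unbi QB.
exists (unbi Q); split.
- by apply/(@mem_biR_box _ _ (m.+1 - k') (m'.+1 - k)); rewrite ?leq_subr ?qQ//; lia.
- by rewrite qQ -PE.
- rewrite bieval_mul_ell//; apply/mem_Bk; rewrite qQ box_ell (negPf eh').
  by move=> i j ij; apply: Qbox; case/orP: ij => [->//|ij];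
    rewrite (leq_trans (leq_subr _ _) ij) orbT.
- rewrite bieval_mul_ell//; apply/mem_Bk; rewrite qQ box_ell eh.
  by move=> i j ij; apply: Qbox; case/orP: ij => [ij|->]; rewrite ?orbT//
    (leq_trans (leq_subr _ _) ij).
Qed.

End TensorPolynomials.

(** * Hermite interpolation by duality *)

Section UnivariateSpan.
Context {R : numFieldType} (m : nat).
Implicit Types (p q : {poly R}) (u v : 'rV[R]_m.+1).

Let L u p : R := \sum_(j < m.+1) u 0 j * p`_j.
Let Lhat u (P : {poly {poly R}}) : {poly R} := \sum_(j < m.+1) (u 0 j)%:P * P`_j.

(* As a polynomial in y, this is the value of the functional [L u] at (X - y)^m. *)
Let G u : {poly R} := Lhat u (('X - 'X%:P) ^+ m).

Let coef_binom j : (('X - 'X%:P : {poly {poly R}}) ^+ m)`_j =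
  (- 'X) ^+ (m - j) *+ 'C(m, j).
Proof.
rewrite -polyCN addrC exprDn coef_sum; have [jm|jm] := leqP j m; last first.
  rewrite bin_small// mulr0n big1// => i _; rewrite -polyC_exp.
  rewrite coefMn coefCM coefXn; case: eqP => [ji|]; last by rewrite mulr0 mul0rn.
  by have := ltn_ord i; rewrite -ji ltnS leqNgt jm.
rewrite (bigD1 (Ordinal (jm : j < m.+1)%N))//= big1 => [|i ij].
  by rewrite addr0 -polyC_exp coefMn coefCM coefXn eqxx mulr1.
rewrite -polyC_exp coefMn coefCM coefXn (_ : (j == i) = false) ?mulr0 ?mul0rn//.
by apply/eqP => ji; move/eqP: ij; apply; apply: val_inj.
Qed.

Let GE u : G u = \sum_(j < m.+1) (u 0 j *+ 'C(m, j) * (-1) ^+ (m - j)) *: 'X^(m - j).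
Proof.
apply: eq_bigr => j _; rewrite coef_binom [in LHS]exprNn.
by rewrite -mul_polyC !polyCM polyC_exp polyCN polyCMn -mulrA mulrnAl mulrnAr.
Qed.

Let size_G u : (size (G u) <= m.+1)%N.
Proof.
rewrite GE; apply: leq_trans (size_sum _ _ _) _; apply/bigmax_leqP => j _.
by apply: leq_trans (size_scale_leq _ _) _; rewrite size_polyXn ltnS leq_subr.
Qed.

(** The coefficients of [G u] are the entries of [u] up to signs and binomial coefficients, which
    are nonzero in characteristic 0. *)
Let G_eq0 u : G u = 0 -> u = 0.
Proof.
move=> G0; apply/rowP => j; rewrite mxE.
have := congr1 (fun p : {poly R} => p`_(m - j)) G0; rewrite /= coef0 GE coef_sum.
rewrite (bigD1 j)//= big1 => [|i ij]; last first.
  rewrite coefZ coefXn (_ : _ == _ = false) ?mulr0//.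
  apply/eqP => E; move/eqP: ij; apply; apply: val_inj => /=.
  by rewrite -(subKn (leq_ord i)) -E subKn// leq_ord.
rewrite addr0 coefZ coefXn eqxx mulr1 => /eqP.
rewrite mulf_eq0 signr_eq0 orbF mulrn_eq0 => /orP[|/eqP//].
by rewrite eqn0Ngt bin_gt0 leq_ord.
Qed.

Let Lhat_map u p : Lhat u (map_poly polyC p) = (L u p)%:P.
Proof.
by rewrite /Lhat /L rmorph_sum; apply: eq_bigr => j _; rewrite coef_map rmorphM.
Qed.

Let Lhat_sum u n (F : 'I_n -> {poly {poly R}}) :
  Lhat u (\sum_(i < n) F i) = \sum_(i < n) Lhat u (F i).
Proof.
rewrite /Lhat exchange_big /=; apply: eq_bigr => j _.
by rewrite coef_sum mulr_sumr.
Qed.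

(** Expand [(X - y)^m] in powers of [X - a] and [y - a]: the functional kills the terms with
    exponent at least [k] in [X - a], and in the others [y - a] has exponent at least
    [m + 1 - k]. *)
Let dvdp_G u (a : R) k : (forall q, (size q <= m.+1 - k)%N ->
    L u (('X - a%:P) ^+ k * q) = 0) -> ('X - a%:P) ^+ (m.+1 - k) %| G u.
Proof.
move=> L0; rewrite /G.
have -> : 'X - 'X%:P = (map_poly polyC ('X - a%:P)) + (- ('X - a%:P))%:P
    :> {poly {poly R}}.
  by rewrite rmorphB /= map_polyX map_polyC /= polyCN rmorphB /= opprB addrA subrK.
rewrite [in X in _ %| X]exprDn Lhat_sum.
apply: (big_ind (fun x => ('X - a%:P) ^+ (m.+1 - k) %| x)) => [|x y|l _];
  [exact: dvdp0|exact: dvdp_add|].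
have -> : Lhat u (map_poly polyC ('X - a%:P) ^+ (m - l) *
    (- ('X - a%:P))%:P ^+ l *+ 'C(m, l)) =
    (- ('X - a%:P)) ^+ l * (L u (('X - a%:P) ^+ (m - l)))%:P *+ 'C(m, l).
  rewrite -Lhat_map /Lhat mulr_sumr -sumrMnl; apply: eq_bigr => j _.
  rewrite -rmorphXn -polyC_exp coefMn coefMC /= mulrnAr; congr (_ *+ _).
  by rewrite mulrA mulrC.
have [lk|lk] := ltnP l (m.+1 - k).
  have E : (m - l = k + (m - l - k))%N by rewrite subnKC//; lia.
  rewrite E exprD L0 ?polyC0 ?mulr0 ?mul0rn ?dvdp0//.
  by rewrite size_exp_XsubC; lia.
rewrite exprNn -mulrnAr -!mulrA; apply: dvdp_mull; apply: dvdp_mulr.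
exact: dvdp_exp2l.
Qed.

Let dvdp_prod_coprime (I : eqType) (s : seq I) (a : I -> R) (n : I -> nat) p :
  uniq s -> {in s &, injective a} ->
  (forall i, i \in s -> ('X - (a i)%:P) ^+ n i %| p) ->
  \prod_(i <- s) ('X - (a i)%:P) ^+ n i %| p.
Proof.
elim: s => [|i s IHs] /=; first by rewrite big_nil dvd1p.
move=> /andP[nis us] inj dv; rewrite big_cons Gauss_dvdp.
  rewrite dv ?mem_head// IHs// => [x y xs ys|x xs].
    by apply: inj; rewrite inE ?xs ?ys orbT.
  by apply: dv; rewrite inE xs orbT.
rewrite big_seq.
apply: (big_ind (coprimep (('X - (a i)%:P) ^+ n i))) => [|x y|j js].
- exact: coprimep1.
- by rewrite coprimepMr => -> ->.
apply/coprimep_expl/coprimep_expr; rewrite coprimep_XsubC root_XsubC.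
apply: contra nis => /eqP/inj <- //; rewrite ?mem_head//.
by rewrite inE js orbT.
Qed.

(** [G u] has degree at most [m], yet it is divisible by a product of coprime powers of total degree
    at least [m + 1]. *)
Lemma functional_eq0 (s : seq R) (k : R -> nat) u : uniq s ->
  (m.+1 <= \sum_(a <- s) (m.+1 - k a))%N ->
  (forall a q, a \in s -> (size q <= m.+1 - k a)%N ->
     L u (('X - a%:P) ^+ k a * q) = 0) -> u = 0.
Proof.
move=> us le L0; apply: G_eq0; apply/eqP; apply: contraLR le => G0.
have /(dvdp_leq G0) : \prod_(a <- s) ('X - a%:P) ^+ (m.+1 - k a) %| G u.
  apply: (@dvdp_prod_coprime _ s id) => // a sa; apply: dvdp_G => q; exact: L0.
rewrite -ltnNge => /leq_trans/(_ (size_G u)); apply: leq_trans.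
rewrite size_prod_seq => [|a _]; last by rewrite expf_neq0// polyXsubC_eq0.
have -> : (\sum_(a <- s) size (('X - a%:P) ^+ (m.+1 - k a)) =
    \sum_(a <- s) (m.+1 - k a) + size s)%N.
  rewrite -[size s]sum1_size -big_split /=; apply: eq_bigr => a _.
  by rewrite size_exp_XsubC addn1.
by rewrite subSn ?leq_addl// addnK.
Qed.

(* Otherwise a nonzero functional would vanish on the span. *)
Lemma univariate_span (s : seq R) (k : R -> nat) p : uniq s ->
  (m.+1 <= \sum_(a <- s) (m.+1 - k a))%N -> (size p <= m.+1)%N ->
  exists2 q : R -> {poly R}, (forall a, (size (q a) <= m.+1 - k a)%N) &
    p = \sum_(a <- s) ('X - a%:P) ^+ k a * q a.
Proof.
move=> us le sp.
pose A := [set v : 'rV[R]_m.+1 | exists2 q : R -> {poly R},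
  (forall a, (size (q a) <= m.+1 - k a)%N) &
  rVpoly v = \sum_(a <- s) ('X - a%:P) ^+ k a * q a].
have AP v : v \in vspan A <-> A v.
  apply: mem_vspan.
    exists (fun=> 0) => [a|]; first by rewrite size_poly0.
    by rewrite raddf0 big1// => a _; rewrite mulr0.
  move=> c u w [q1 s1 E1] [q2 s2 E2]; exists (fun a => c *: q1 a + q2 a).
    move=> a; apply: leq_trans (size_polyD _ _) _; rewrite geq_max s2 andbT.
    exact: leq_trans (size_scale_leq _ _) (s1 a).
  rewrite linearP /= E1 E2 scaler_sumr -big_split /=; apply: eq_bigr => a _.
  by rewrite mulrDr scalerAr.
suff full : vspan A = fullv.
  have /AP[q qs E] : poly_rV p \in vspan A by rewrite full memvf.
  by exists q; rewrite // -E poly_rV_K.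
apply/eqP; rewrite -dimv_leqif_eq ?subvf// dimvf /dim /= mul1n.
rewrite eqn_leq; apply/andP; split.
  by have := dimvS (subvf (vspan A)); rewrite dimvf /dim /= mul1n.
rewrite leqNgt; apply/negP => lt.
pose M := \matrix_(i < \dim (vspan A)) (vbasis (vspan A))`_i.
have : kermx M^T != 0.
  rewrite -mxrank_eq0 mxrank_ker -lt0n subn_gt0; apply: leq_ltn_trans lt.
  by rewrite mxrank_tr rank_leq_row.
case/rowV0Pn => u /sub_kermxP uM; apply/negP/negPn/eqP.
apply: (functional_eq0 us le) => a q sa sq.
have sz : (size (('X - a%:P) ^+ k a * q)%R <= m.+1)%N.
  have [->|q0] := eqVneq q 0; first by rewrite mulr0 size_poly0.
  rewrite size_monicM ?monic_exp ?monicXsubC// size_exp_XsubC addSn /=.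
  have kA : (k a < m.+1)%N.
    by rewrite -subn_gt0 (leq_trans _ sq)// size_poly_gt0.
  by rewrite -(subnKC (ltnW kA)) leq_add2l.
have vA : poly_rV (('X - a%:P) ^+ k a * q) \in vspan A.
  apply/AP; exists (fun b => if b == a then q else 0) => [b|].
    by case: eqP => [->//|_]; rewrite size_poly0.
  rewrite (bigD1_seq a)//= eqxx big1 => [|b /negPf->]; last by rewrite mulr0.
  by rewrite addr0 poly_rV_K.
have -> : L u (('X - a%:P) ^+ k a * q) =
    \sum_(j < m.+1) u 0 j * (poly_rV (('X - a%:P) ^+ k a * q) : 'rV_m.+1) 0 j.
  by apply: eq_bigr => j _; rewrite mxE.
rewrite (coord_vbasis vA).
under eq_bigr => j _ do rewrite summxE mulr_sumr.
rewrite exchange_big /= big1// => i _.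
have /rowP/(_ i) := uM; rewrite !mxE => E.
under eq_bigr do rewrite mxE mulrCA.
rewrite -mulr_sumr (_ : \sum_(j < m.+1) _ = 0) ?mulr0//.
by rewrite -[RHS]E; apply: eq_bigr => j _; rewrite !mxE.
Qed.

End UnivariateSpan.

(** * Linear algebra *)

Section LinearAlgebraLemmas.
Context {K : fieldType}.

Lemma linfun_exists (U V : vectType K) (f : U -> V) :
  linear f -> exists F : 'Hom(U, V), forall x, F x = f x.
Proof.
move=> fL; pose F : {linear U -> V} := HB.pack f (GRing.isLinear.Build K U V *:%R f fL).
by exists (linfun F) => x; rewrite lfunE.
Qed.

(** Both sides equal the dimension of [N] minus that of its intersection with both kernels. *)
Lemma dim_img_ker (X Y Z : vectType K) (f : 'Hom(X, Y)) (g : 'Hom(X, Z))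
    (N : {vspace X}) :
  (\dim (f @: N) + \dim (g @: (N :&: lker f)) =
   \dim (g @: N) + \dim (f @: (N :&: lker g)))%N.
Proof.
have := limg_ker_dim f N; have := limg_ker_dim g N.
have := limg_ker_dim g (N :&: lker f); have := limg_ker_dim f (N :&: lker g).
rewrite -capvA -[(N :&: lker f :&: _)%VS]capvA [(lker g :&: _)%VS]capvC; lia.
Qed.

Lemma dim_preimg (X Y : vectType K) (f : 'Hom(X, Y)) (W : {vspace Y}) :
  \dim (f @^-1: W) = (\dim (lker f) + \dim (W :&: limg f))%N.
Proof.
have := limg_ker_dim f (f @^-1: W)%VS.
have -> : (f @^-1: W :&: lker f = lker f)%VS.
  by apply/capv_idPr; rewrite -lpreim0 lpreimS// sub0v.
suff -> : (f @: (f @^-1: W) = W :&: limg f)%VS by [].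
apply/vspaceP => y; apply/idP/idP.
  by move=> /memv_imgP[x xW ->]; rewrite memv_cap memv_img ?memvf// memv_preim xW.
rewrite memv_cap => /andP[yW /memv_imgP[x _ yE]].
by apply/memv_imgP; exists x; rewrite // -memv_preim -yE.
Qed.

End LinearAlgebraLemmas.

Section ProductSpace.
Context {K : fieldType} {V : vectType K} {I : finType}.
Implicit Types (U : I -> {vspace V}) (x : {ffun I -> V}).

Definition prodv U : {vspace {ffun I -> V}} :=
  vspan [set x : {ffun I -> V} | forall i, x i \in U i].

Lemma mem_prodv U x : x \in prodv U <-> forall i, x i \in U i.
Proof.
apply: (@mem_vspan _ _ [set x : {ffun I -> V} | forall i, x i \in U i]).
  by move=> i; rewrite ffunE mem0v.
by move=> a u w /= uU wU i; rewrite !ffunE memvD// memvZ.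
Qed.

Definition delta_ffun (i : I) (v : V) : {ffun I -> V} :=
  [ffun k => if k == i then v else 0].

Lemma delta_ffun_linear i : linear (delta_ffun i).
Proof.
move=> a u v; apply/ffunP => k; rewrite !ffunE.
by case: eqP => _; rewrite ?scaler0 ?addr0.
Qed.

Lemma ffun_sum_delta x : x = \sum_i delta_ffun i (x i).
Proof.
apply/ffunP => k; rewrite sum_ffunE (bigD1 k)//= big1 => [|i ik].
  by rewrite ffunE eqxx addr0.
by rewrite ffunE eq_sym (negPf ik).
Qed.

Lemma dim_prodv U : \dim (prodv U) = (\sum_i \dim (U i))%N.
Proof.
have /choice[D DE] : forall i, exists F : 'Hom(V, {ffun I -> V}), forall v, F v = delta_ffun i v.
  by move=> i; apply: linfun_exists; exact: delta_ffun_linear.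
have -> : prodv U = (\sum_i D i @: U i)%VS.
  apply/vspaceP => x; apply/idP/idP => [/mem_prodv xU|/memv_sumP[y yD ->]].
    rewrite [x]ffun_sum_delta; apply: memv_sumr => i _.
    by rewrite -DE memv_img.
  apply/mem_prodv => k; rewrite sum_ffunE; apply: memv_suml => i _.
  have /memv_imgP[v vU ->] := yD i isT; rewrite DE ffunE.
  by case: eqP => [->//|_]; rewrite mem0v.
have Dinj i : lker (D i) = 0%VS.
  apply/eqP; rewrite -subv0; apply/subvP => v; rewrite memv_ker memv0 DE.
  by move=> /eqP/ffunP/(_ i); rewrite !ffunE eqxx => ->.
have /directvP/= -> : directv (\sum_i D i @: U i)%VS.
  apply/directv_sum_independent => y yD sum0 i _.
  have yE k : exists2 v, v \in U k & y k = delta_ffun k v.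
    by have /memv_imgP[v vU ->] := yD k isT; exists v; rewrite ?DE.
  have [v vU yi] := yE i; rewrite yi; apply/ffunP => k; rewrite !ffunE.
  case: eqP => // _; move/ffunP/(_ i): sum0; rewrite sum_ffunE (bigD1 i)//= big1.
    by rewrite addr0 yi !ffunE eqxx.
  by move=> l li; have [w _ ->] := yE l; rewrite ffunE eq_sym (negPf li).
apply: eq_bigr => i _; apply: limg_dim_eq.
by rewrite Dinj capv0.
Qed.

End ProductSpace.

Section FsetExtension.
Context {K : fieldType} {V : vectType K} {I : choiceType} {A : {fset I}}.
Implicit Types (x y : {ffun A -> V}).

Definition fext x (i : I) : V := if insub i is Some a then x a else 0.

Lemma fextE x (a : A) : fext x (val a) = x a.
Proof. by rewrite /fext valK. Qed.

Lemma fextT x i (iA : i \in A) : fext x i = x [` iA]%fset.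
Proof. by rewrite -fextE. Qed.

Lemma fext_linear (a : K) x y i : fext (a *: x + y) i = a *: fext x i + fext y i.
Proof. by rewrite /fext; case: insub => [b|]; rewrite ?ffunE ?scaler0 ?addr0. Qed.

End FsetExtension.

(** * The spline complex *)

Section ChainComplex.
Context {R : realType} (T : tmesh R).
Hypotheses (hT : is_tmesh T) (hred : reduced T).
Context {K : fieldType} {V : vectType K}.
Implicit Types (f : {ffun cells T -> V}) (j : {ffun int_edges T -> V})
  (y : {ffun int_vertices T -> V}) (x : {ffun int_vertices T * bool -> V}).

Definition d2 f : {ffun int_edges T -> V} := [ffun e => jump T (fext f) (val e)].

Definition d1 j : {ffun int_vertices T -> V} :=
  [ffun p => boundary T (fext j) (val p)].

(** The boundary before its horizontal and vertical parts are added. At this level different maximal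
    segments do not interact. *)
Definition d1_split j : {ffun int_vertices T * bool -> V} :=
  [ffun ph => dirbound T (fext j) (val ph.1) ph.2].

Definition sum_dir x : {ffun int_vertices T -> V} :=
  [ffun p => x (p, true) + x (p, false)].

Definition sum_MIS x : {ffun MIS T -> V} :=
  [ffun rho => \sum_(p | `[< lseg_pts (val rho) (val p) >]) x (p, lhor (val rho))].

Lemma dirsum_linear (a : K) (k k' : lseg R -> V) p h s :
  dirsum T (fun e => a *: k e + k' e) p h s = a *: dirsum T k p h s + dirsum T k' p h s.
Proof. by rewrite /dirsum scaler_sumr -big_split. Qed.

Lemma dirbound_linear (a : K) (k k' : lseg R -> V) p h :
  dirbound T (fun e => a *: k e + k' e) p h = a *: dirbound T k p h + dirbound T k' p h.
Proof. by rewrite /dirbound !dirsum_linear opprD scalerBr addrACA. Qed.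

Lemma d2_linear : linear d2.
Proof.
move=> a u w; apply/ffunP => e; rewrite !ffunE /jump !fext_linear.
by rewrite opprD scalerBr addrACA.
Qed.

Lemma d1_split_linear : linear d1_split.
Proof.
move=> a u w; apply/ffunP => ph; rewrite !ffunE -dirbound_linear.
by congr (dirbound T _ _ _); apply: funext => e; exact: fext_linear.
Qed.

Lemma sum_dir_linear : linear sum_dir.
Proof.
by move=> a u w; apply/ffunP => p; rewrite !ffunE scalerDr addrACA.
Qed.

Lemma sum_MIS_linear : linear sum_MIS.
Proof.
move=> a u w; apply/ffunP => rho; rewrite !ffunE scaler_sumr -big_split /=.
by apply: eq_bigr => p _; rewrite !ffunE.
Qed.

Lemma d1E j : d1 j = sum_dir (d1_split j).
Proof.
by apply/ffunP => p; rewrite !ffunE /= (boundary_dirbound hT hred)//; exact: valP.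
Qed.

Lemma d1_linear : linear d1.
Proof. by move=> a u w; rewrite !d1E d1_split_linear sum_dir_linear. Qed.

Lemma eq_boundary (k k' : lseg R -> V) p :
  (forall e, e \in int_edges T -> k e = k' e) -> boundary T k p = boundary T k' p.
Proof.
move=> kk'; rewrite /boundary; congr (_ - _); rewrite big_seq_cond [RHS]big_seq_cond;
  by apply: eq_bigr => e /andP[/kk'].
Qed.

Lemma eq_dirsum (k k' : lseg R -> V) p h s :
  (forall e, e \in int_edges T -> leaves T p h s e -> k e = k' e) ->
  dirsum T k p h s = dirsum T k' p h s.
Proof.
move=> kk'; rewrite /dirsum big_seq_cond [RHS]big_seq_cond.
by apply: eq_bigr => e /andP[eT /asboolP]; exact: kk'.
Qed.

Lemma d1_d2 f : d1 (d2 f) = 0.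
Proof.
apply/ffunP => p; rewrite !ffunE -[RHS](boundary_jump hT hred (fext f) (valP p)).
by apply: eq_boundary => e eT; rewrite fextT ffunE.
Qed.

Lemma d1_ker j : d1 j = 0 -> exists f, d2 f = j.
Proof.
move=> /ffunP j0; have [|f fj] := cycle_jump hT hred (j := fext j).
  by move=> p pI; have := j0 [` pI]%fset; rewrite !ffunE.
exists [ffun c => f (val c)]; apply/ffunP => e; rewrite ffunE -fextE.
rewrite fj ?(valP e)// /jump.
have cT s : cell_on T (val e) s \in cells T.
  by have [] := cell_onP hT hred s (valP e).
by rewrite !fextT !ffunE.
Qed.

(** The boundary of a value on one edge moves it from [p] to an interior vertex with larger
    coordinate sum, or out of the complex. The induction counts the interior vertices with larger
    sum. *)
Lemma d1_onto y : exists j, d1 j = y.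
Proof.
have [D1 D1E] := linfun_exists d1_linear.
suff delta n (p : int_vertices T) (v : V) :
    (#|[pred q : int_vertices T |
        ((val p).1 + (val p).2 < (val q).1 + (val q).2)%R]| < n)%N ->
    delta_ffun p v \in limg D1.
  have : y \in limg D1.
    by rewrite [y]ffun_sum_delta; apply: memv_suml => p _; exact: delta (ltnSn _).
  by move=> /memv_imgP[j _ ->]; exists j.
elim: n p v => // n IHn p v; rewrite ltnS => card_p.
have [e [eT e0 lt]] := int_vertex_leaves hT hred (valP p).
have eT' := int_edge eT; have elt := edge_lt hT eT'.
pose j : {ffun int_edges T -> V} := delta_ffun [` eT]%fset (- v).
have jE e' : e' \in int_edges T -> fext j e' = if e' == e then - v else 0.
  by move=> e'T; rewrite fextT ffunE -val_eqE.
have one (g : lseg R -> R * R) q : \sum_(e' <- int_edges T | g e' == q) fext j e' =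
    if g e == q then - v else 0.
  rewrite big_mkcond (bigD1_seq e) ?fset_uniq//= big_seq_cond big1 ?addr0 => [|e'].
    by rewrite jE// eqxx.
  by move=> /andP[e'T /negPf ne]; rewrite jE// ne if_same.
have : D1 j \in limg D1 by rewrite memv_img ?memvf.
have [vI|vI] := boolP (lseg_end1 e \in int_vertices T); last first.
  have -> : D1 j = delta_ffun p v => //.
  rewrite D1E; apply/ffunP => q; rewrite !ffunE /boundary !one e0.
  rewrite (_ : (lseg_end1 e == val q) = false); last first.
    by apply: contraNF vI => /eqP->; exact: valP.
  by rewrite val_eqE eq_sym sub0r; case: eqP; rewrite ?opprK ?oppr0.
have -> : D1 j = delta_ffun p v - delta_ffun [` vI]%fset v.
  rewrite D1E; apply/ffunP => q; rewrite !ffunE /boundary !one e0.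
  rewrite -[lseg_end1 e]/(val [` vI]%fset) !val_eqE addrC ![q == _]eq_sym.
  by congr (_ + _); case: eqP; rewrite ?opprK ?oppr0.
move=> Dj; rewrite -[delta_ffun p v](subrK (delta_ffun [` vI]%fset v)) memvD//.
apply: IHn; apply: leq_trans card_p; apply: proper_card; apply/properP; split.
  by apply/fintype.subsetP => q; rewrite !inE; exact: lt_trans.
by exists [` vI]%fset; rewrite !inE ?ltxx.
Qed.

(* the identity [|cells| - |int_edges| + |int_vertices| = dim ker d2 / dim V] *)
Lemma dim_complex (D2 : 'Hom({ffun cells T -> V}, {ffun int_edges T -> V}))
    (D1 : 'Hom({ffun int_edges T -> V}, {ffun int_vertices T -> V})) :
  (forall f, D2 f = d2 f) -> (forall j, D1 j = d1 j) ->
  [/\ limg D2 = lker D1, limg D1 = fullv &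
   (\dim {: {ffun cells T -> V}} + \dim {: {ffun int_vertices T -> V}} =
    \dim {: {ffun int_edges T -> V}} + \dim (lker D2))%N].
Proof.
move=> D2E D1E'.
have img2 : limg D2 = lker D1.
  apply/vspaceP => j; rewrite memv_ker D1E'; apply/idP/eqP.
    by move=> /memv_imgP[f _ ->]; rewrite D2E d1_d2.
  by move=> /d1_ker[f <-]; rewrite -D2E memv_img ?memvf.
have img1 : limg D1 = fullv.
  apply/vspaceP => y; rewrite memvf; have [j <-] := d1_onto y.
  by rewrite -D1E' memv_img ?memvf.
split=> //; have := limg_ker_dim D2 fullv; have := limg_ker_dim D1 fullv.
by rewrite img1 img2 !capfv => <- <-; rewrite -addnA addnC.
Qed.

End ChainComplex.

(** * Splines and segment ideals inside the complex *)

Section SplineComplex.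
Context {R : realType} (T : tmesh R).
Hypotheses (hT : is_tmesh T) (hred : reduced T).
Context (r : lseg R -> int).
Hypotheses (hr : smoothness T r) (hrc : constant_along_MS T r).
Context (m m' : nat).
Local Notation Rmm := (bipoly R m m').
Local Notation I_ e := (I_edge r m m' e).
Implicit Types (p : R * R) (e rho : lseg R) (h s : bool).

(** The exponent [r + 1], natural because [r] is at least -1 on edges. For [r = -1] it is 0 and the
    ideal is all of [Rmm]. *)
Definition kseg rho : nat := absz (seg_r T r rho + 1).

Definition Iseg rho : {vspace Rmm} :=
  vspan [set p : Rmm | divides (ell_pow rho (kseg rho)%:Z) (bieval p)].

Lemma mem_Iseg rho (q : Rmm) :
  q \in Iseg rho <-> divides (ell_pow rho (kseg rho)%:Z) (bieval q).
Proof. exact: mem_vspan_divides. Qed.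

Lemma mem_I_edge e (q : Rmm) :
  q \in I_ e <-> divides (ell_pow e (r e + 1)) (bieval q).
Proof. exact: mem_vspan_divides. Qed.

Lemma kseg_edge rho e : rho \in MS T -> e \in edges T ->
  lseg_pts e `<=` lseg_pts rho -> (kseg rho)%:Z = r e + 1.
Proof.
move=> rT eT er; rewrite /kseg (seg_rE hrc rT eT er) gez0_abs//.
by rewrite -(lerD2r (-1)) addrK add0r hr.1.
Qed.

Lemma ksegE rho : rho \in MS T -> seg_r T r rho + 1 = (kseg rho)%:Z.
Proof.
move=> rT; have [e [eT _ er]] := MS_point hT rT (lseg_end0_pts (ltW (MS_lt hT rT))).
by rewrite (kseg_edge rT (int_edge eT) er) (seg_rE hrc rT (int_edge eT) er).
Qed.

Lemma I_edge_seg rho e : rho \in MS T -> e \in edges T ->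
  lseg_pts e `<=` lseg_pts rho -> I_ e = Iseg rho.
Proof.
move=> rT eT er; have [eh epos _ _] := lseg_sub (edge_lt hT eT) er.
by rewrite /Iseg /I_edge (kseg_edge rT eT er) /ell_pow /ell eh epos.
Qed.

Lemma I_vertexE p : p \in int_vertices T ->
  I_vertex T r m m' p = (Iseg (MS_at T true p) + Iseg (MS_at T false p))%VS.
Proof.
move=> pI; have MSP h := MS_atP hT hred h pI.
apply/eqP; rewrite eqEsubv; apply/andP; split.
  rewrite /I_vertex big_seq_cond.
  apply: (big_ind (fun W => (W <= _)%VS)) => [|U W|e /andP[eT /asboolP ep]].
  - exact: sub0v.
  - by rewrite subv_add => -> ->.
  have [rT rh rp] := MSP (lhor e).
  have er := int_edge_sub_MS hT rT eT (esym rh) rp ep.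
  rewrite (I_edge_seg rT (int_edge eT) er).
  by case: (lhor e); [exact: addvSl|exact: addvSr].
have edge_in h : (Iseg (MS_at T h p) <= I_vertex T r m m' p)%VS.
  have [rT rh rp] := MSP h; have [e [eT ep er]] := MS_point hT rT rp.
  rewrite -(I_edge_seg rT (int_edge eT) er) /I_vertex.
  rewrite big_mkcond (bigD1_seq e) ?fset_uniq//= asboolT//; exact: addvSl.
by rewrite subv_add; apply/andP; split; exact: edge_in.
Qed.

(** An interior edge has exactly one cell on each side, so the condition on pairs of cells around it
    amounts to one oriented jump lying in its ideal. *)
Lemma mem_spline_space (f : {ffun cells T -> Rmm}) :
  f \in spline_space T r m m' <-> forall e : int_edges T, d2 f e \in I_ (val e).
Proof.
pose A := [set f : {ffun cells T -> Rmm} |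
    forall (c c' : cells T) (e : lseg R), c != c' -> e \in int_edges T ->
      lseg_pts e `<=` rect_pts (val c) `&` rect_pts (val c') ->
      divides (ell_pow e (r e + 1)) (bieval (f c) - bieval (f c'))].
have -> : f \in spline_space T r m m' <-> A f.
  apply: mem_vspan => [c c' e _ _ _|a u w Au Aw c c' e cc' eT ecc'].
    by rewrite !ffunE subrr; exists 0; rewrite mulr0.
  have [x ux] := Au c c' e cc' eT ecc'; have [y wy] := Aw c c' e cc' eT ecc'.
  exists (a%:P%:P * x + y); rewrite !ffunE !bieval_linear mulrDr mulrCA -ux -wy.
  by rewrite mulrBr opprD addrACA.
split=> [Af e|If c c' e cc' eT ecc'].
  have eT := valP e; have eT' := int_edge eT.
  have [lT le _] := cell_onP hT hred (lhor (val e)) eT.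
  have [rT re _] := cell_onP hT hred (~~ lhor (val e)) eT.
  apply/mem_I_edge; rewrite ffunE /jump bievalB !fextT; apply: Af => //.
    apply/eqP => /(congr1 val)/= E.
    have := cell_onP hT hred (~~ lhor (val e)) eT.
    by rewrite -E; apply: (on_side_neq hT); exact: cell_onP.
  by move=> q eq; split; [exact: le|exact: re].
have eT' := int_edge eT.
have [s ce] := edge_cell_side hT eT' (valP c) (fun q eq => (ecc' q eq).1).
have [s' c'e] := edge_cell_side hT eT' (valP c') (fun q eq => (ecc' q eq).2).
have ss' : s' = ~~ s.
  have [E|] := eqVneq s' s; last by case: (s); case: (s').
  move/eqP: cc'; case; apply: val_inj; apply: (on_side_uniq hT eT' ce).
  by rewrite -E.
have := If [` eT]%fset => /mem_I_edge; rewrite ffunE /jump bievalB /=.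
have [sh|sh] := eqVneq s (lhor e).
  rewrite -sh -ss' (cell_onE hT eT' ce) (cell_onE hT eT' c'e).
  by rewrite !fextE.
have {}sh : lhor e = s' by rewrite ss'; move: sh; case: (s); case: (lhor e).
rewrite sh ss' negbK -ss' (cell_onE hT eT' ce) (cell_onE hT eT' c'e).
by rewrite !fextE => -[q E]; exists (- q); rewrite mulrN -E opprB.
Qed.

Definition I_space : {vspace {ffun int_edges T -> Rmm}} := prodv (fun e : int_edges T => I_ (val e)).

Definition N_space : {vspace {ffun int_vertices T * bool -> Rmm}} :=
  prodv (fun ph : int_vertices T * bool => Iseg (MS_at T ph.2 (val ph.1))).

Lemma mem_sum_dir (y : {ffun int_vertices T -> Rmm}) :
  (forall p : int_vertices T, y p \in I_vertex T r m m' (val p)) <->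
  exists2 x, x \in N_space & y = sum_dir x.
Proof.
split=> [Iy|[x /mem_prodv xN ->] p]; last first.
  rewrite I_vertexE ?(valP p)// ffunE.
  by have := memv_add (xN (p, true)) (xN (p, false)).
have /choice[x xP] : forall p : int_vertices T, exists x : Rmm * Rmm,
    [/\ x.1 \in Iseg (MS_at T true (val p)), x.2 \in Iseg (MS_at T false (val p))
      & y p = x.1 + x.2].
  move=> p; have := Iy p; rewrite I_vertexE ?(valP p)// => /memv_addP[u uI [w wI E]].
  by exists (u, w); split; [exact: uI|exact: wI|exact: E].
exists [ffun ph => if ph.2 then (x ph.1).1 else (x ph.1).2].
  apply/mem_prodv => -[p h]; rewrite ffunE /=; have [x1 x2 _] := xP p.
  by case: h; [exact: x1|exact: x2].
by apply/ffunP => p; rewrite !ffunE /=; have [_ _ E] := xP p; exact: E.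
Qed.

(** Every MIS has an interior vertex, where its whole value can be placed. Different MISs do not
    interfere, since a vertex and a direction determine the segment. *)
Lemma mem_sum_MIS (y : {ffun MIS T -> Rmm}) :
  (forall rho : MIS T, y rho \in Iseg (val rho)) <-> exists2 x, x \in N_space & y = sum_MIS x.
Proof.
split=> [Iy|[x /mem_prodv xN ->] rho]; last first.
  rewrite ffunE; apply: memv_suml => p /asboolP rp.
  have := xN (p, lhor (val rho)).
  by rewrite /= (MS_at_eq hT hred (valP p) (MIS_MS (valP rho)) rp).
have /choice[b bP] : forall rho : MIS T, exists p : int_vertices T,
    lseg_pts (val rho) (val p).
  move=> rho; have [p pI rp] := MIS_int_vertex hT (valP rho).
  by exists [` pI]%fset.
pose z (ph : int_vertices T * bool) : Rmm :=
  if insub (MS_at T ph.2 (val ph.1)) is Some rho then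
    if b rho == ph.1 then y rho else 0 else 0.
exists [ffun ph => z ph].
  apply/mem_prodv => -[p h]; rewrite ffunE /z /=.
  case: insubP => [rho _ rE|_]; last by rewrite mem0v.
  by case: eqP => _; rewrite ?mem0v// -rE.
apply/ffunP => rho; rewrite ffunE.
have zE (p : int_vertices T) : lseg_pts (val rho) (val p) ->
    z (p, lhor (val rho)) = if b rho == p then y rho else 0.
  move=> rp; rewrite /z /= (MS_at_eq hT hred (valP p) (MIS_MS (valP rho)) rp).
  by rewrite valK.
rewrite (bigD1 (b rho)) /=; last by apply/asboolP; exact: bP.
rewrite ffunE zE// eqxx big1 ?addr0// => p /andP[/asboolP rp ne].
by rewrite ffunE zE// eq_sym (negPf ne).
Qed.

Lemma d1_split_N j : j \in I_space -> d1_split j \in N_space /\ sum_MIS (d1_split j) = 0.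
Proof.
move=> /mem_prodv jI; split.
  apply/mem_prodv => -[p h]; rewrite ffunE /=.
  have [rT rh rp] := MS_atP hT hred h (valP p).
  have dI s : dirsum T (fext j) (val p) h s \in Iseg (MS_at T h (val p)).
    rewrite /dirsum big_seq_cond; apply: memv_suml => e /andP[eT /asboolP pe].
    rewrite -{1}rh in pe.
    have er := leaves_MS hT hred rT (valP p) rp pe.
    by rewrite -(I_edge_seg rT (int_edge eT) er) fextT; exact: jI.
  by rewrite memvB.
apply/ffunP => rho; rewrite !ffunE.
rewrite -[RHS](dirbound_MIS hT hred (fext j) (valP rho)) big_seq_fsetE /=.
by apply: eq_bigr => p _; rewrite ffunE.
Qed.

(** Solve along each maximal segment with [chain_on_MS] and glue: an edge lies on at most one
    maximal segment. *)
Lemma N_d1_split x : x \in N_space -> sum_MIS x = 0 ->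
  exists2 j, j \in I_space & x = d1_split j.
Proof.
move=> /mem_prodv xN /ffunP x0.
pose xx h p : Rmm := if insub p is Some q then x (q, h) else 0.
have xxE h (p : int_vertices T) : xx h (val p) = x (p, h) by rewrite /xx valK.
have chain rho : exists k : lseg R -> Rmm, rho \in MS T ->
    (forall e, k e \in Iseg rho) /\ forall p, p \in int_vertices T ->
    lseg_pts rho p -> dirbound T k p (lhor rho) = xx (lhor rho) p.
  have [rT|rT] := boolP (rho \in MS T); last by exists (fun=> 0).
  have [| |k kI kP] := chain_on_MS hT hred (U := Iseg rho) (x := xx (lhor rho)) rT.
  - move=> p pI rp; have := xN ([` pI]%fset, lhor rho).
    by rewrite /= (MS_at_eq hT hred pI rT rp) -xxE.
  - move=> rM; have := x0 [` rM]%fset; rewrite !ffunE => E.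
    rewrite -[RHS]E big_seq_fsetE /=.
    by apply: eq_bigr => p _; rewrite xxE.
  by exists k.
have {chain} /choice[k kP] := chain.
pose ms e := [set rho | rho \in MS T /\ lseg_pts e `<=` lseg_pts rho].
pose j e : Rmm := if `[< exists rho, ms e rho >] then k (xget e (ms e)) e else 0.
have msP e : (exists rho, ms e rho) -> ms e (xget e (ms e)) by exact: xgetPex.
have jE rho e : e \in edges T -> ms e rho -> j e = k rho e.
  move=> eT er; rewrite /j asboolT; last by exists rho.
  have [gT eg] := msP e (ex_intro _ rho er); have [rT eR] := er.
  have ep := lseg_end0_pts (ltW (edge_lt hT eT)).
  have [h1 _ _ _] := lseg_sub (edge_lt hT eT) eg.
  have [h2 _ _ _] := lseg_sub (edge_lt hT eT) eR.
  by rewrite (MS_uniq hT gT rT _ (eg _ ep) (eR _ ep)) -?h1 -?h2.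
exists [ffun e => j (val e)].
  apply/mem_prodv => e; rewrite ffunE /j; case: asboolP => [/msP[gT eg]|_].
    by rewrite (I_edge_seg gT (int_edge (valP e)) eg); exact: (kP _ gT).1.
  exact: mem0v.
apply/ffunP => -[p h]; rewrite ffunE /=.
have [rT rh rp] := MS_atP hT hred h (valP p).
have <- := xxE h p; rewrite -{1}rh -(kP _ rT).2 ?(valP p)// rh /dirbound.
have eqd s : dirsum T (k (MS_at T h (val p))) (val p) h s =
    dirsum T (fext [ffun e : int_edges T => j (val e)]) (val p) h s.
  apply: eq_dirsum => e eT pe; rewrite fextT ffunE /= (jE (MS_at T h (val p)))//.
    exact: int_edge.
  by split=> //; rewrite -{1}rh in pe; exact: (leaves_MS hT hred rT (valP p) rp pe).
by rewrite !eqd.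
Qed.

End SplineComplex.

(** * Vertex relations as cancelling pairs *)

Section Relations.
Context {R : realType} (T : tmesh R).
Hypotheses (hT : is_tmesh T) (hred : reduced T).
Context (r : lseg R -> int).
Hypotheses (hr : smoothness T r) (hrc : constant_along_MS T r).
Context (m m' : nat).
Local Notation Rmm := (bipoly R m m').
Local Notation k_ := (kseg T r).
Local Notation Iseg := (Iseg T r m m').
Local Notation N_space := (N_space T r m m').
Implicit Types (p : int_vertices T) (e rho : lseg R) (h s : bool) (w q : Rmm).

(** Realises M(MIS) inside the ideals of the MISs, where it can be compared with [sum_MIS];
    injective on M(MIS). *)
Definition ideal_of (x : {ffun MIS T -> Rmm}) : {ffun MIS T -> Rmm} :=
  [ffun rho => mul_ell (val rho) (k_ (val rho)) (x rho)].

Lemma ideal_of_linear : linear ideal_of.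
Proof. by move=> a u w; apply/ffunP => rho; rewrite !ffunE mul_ell_linear. Qed.

Lemma B_segE rho : rho \in MS T -> B_seg T r m m' rho = Bk m m' rho (k_ rho).
Proof.
move=> rT; rewrite /B_seg /Bk -(ksegE hT hr hrc rT).
by rewrite !opprD !addrA.
Qed.

Lemma mem_M_space (A : {set MIS T}) (x : {ffun MIS T -> Rmm}) :
  x \in M_space r m m' A <->
  forall rho : MIS T, x rho \in (if rho \in A then B_seg T r m m' (val rho) else 0%VS).
Proof. exact: mem_prodv. Qed.

Lemma biR_sub (a b a' b' : int) : a <= a' -> b <= b' ->
  (@biR R m m' a b <= biR m m' a' b')%VS.
Proof.
move=> aa bb; apply/subvP => q /mem_biR H; apply/mem_biR => i j ij; apply: H.
by case/orP: ij => ij; apply/orP; [left|right]; apply: contra ij => /le_trans; apply.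
Qed.

Lemma biR_sub_Bk e e' k k' : lhor e -> ~~ lhor e' ->
  (@biR R m m' (m%:Z - k'%:Z) (m'%:Z - k%:Z) <= Bk m m' e k)%VS /\
  (@biR R m m' (m%:Z - k'%:Z) (m'%:Z - k%:Z) <= Bk m m' e' k')%VS.
Proof.
by move=> eh /negPf eh'; split; rewrite /Bk ?eh ?eh'; apply: biR_sub; lia.
Qed.

(** Such pairs generate the kernel of [sum_dir]. The signs follow the vertex relations: plus on the
    vertical segment, minus on the horizontal one. *)
Definition pair_at p w : {ffun int_vertices T * bool -> Rmm} :=
  [ffun ph => if ph.1 == p then (if ph.2 then - w else w) else 0].

Lemma sum_MIS_pair_at p w (rho : MIS T) : sum_MIS (pair_at p w) rho =
  if val rho == MS_at T false (val p) then w
  else if val rho == MS_at T true (val p) then - w else 0.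
Proof.
have MSP h := MS_atP hT hred h (valP p).
have [vT /= vh vp] := MSP false; have [hTT /= hh hp] := MSP true.
have rT := MIS_MS (valP rho).
have -> : sum_MIS (pair_at p w) rho = if `[< lseg_pts (val rho) (val p) >] then
    (if lhor (val rho) then - w else w) else 0.
  rewrite ffunE big_mkcond (bigD1 p)//= ffunE eqxx big1 ?addr0// => p' /negPf ne.
  by rewrite ffunE /= ne if_same.
case: asboolP => [rp|nrp].
  have := MS_at_eq hT hred (valP p) rT rp.
  case rh : (lhor (val rho)) => rE; last by rewrite -rE eqxx.
  by case: eqP => [E|_]; [move: rh; rewrite (E : val rho = _) vh|rewrite -rE eqxx].
case: eqP => [E|_]; first by case: nrp; rewrite (E : val rho = _).
by case: eqP => [E|//]; case: nrp; rewrite (E : val rho = _).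
Qed.

(** [w] is the product of both powers with some [q]. Dividing on each segment by its own power
    leaves the power of the other one times [q], as in a vertex relation. *)
Lemma relation_of_pair p w : w \in Iseg (MS_at T true (val p)) ->
  w \in Iseg (MS_at T false (val p)) ->
  exists2 y, vertex_relation r y & ideal_of y = sum_MIS (pair_at p w).
Proof.
have MSP h := MS_atP hT hred h (valP p).
have [vT /= vh vp] := MSP false; have [hTT /= hh hp] := MSP true.
have vhN : ~~ lhor (MS_at T false (val p)) by rewrite vh.
move=> /mem_Iseg wh /mem_Iseg wv.
have [q [qB wE qv qh]] := divides_ell_cross hh vhN wh wv.
exists [ffun rho : MIS T => if val rho == MS_at T false (val p)
    then mul_ell (MS_at T true (val p)) (k_ (MS_at T true (val p))) q
    else if val rho == MS_at T true (val p)
    then - mul_ell (MS_at T false (val p)) (k_ (MS_at T false (val p))) q else 0].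
  exists (val p); split; first exact: valP.
  exists (MS_at T true (val p)), (MS_at T false (val p)); split=> //.
  rewrite -!addrA -!opprD !(ksegE hT hr hrc)//; exists q => // rho.
  rewrite ffunE; case: eqP => _; first by rewrite -qh.
  case: eqP => _; last exact: bieval0.
  by rewrite qv bievalN.
apply/ffunP => rho; rewrite sum_MIS_pair_at !ffunE.
case: eqP => [->|_].
  apply: bieval_inj; rewrite wE /mul_ell -/(mul_ell _ _ q) -qh.
  rewrite bieval_unbi; first by rewrite mulrCA.
  by rewrite mulrCA -wE; exact: box_bieval.
case: eqP => [->|_].
  rewrite mul_ellN; congr (- _); apply: bieval_inj; rewrite wE.
  rewrite /mul_ell -/(mul_ell _ _ q) -qv bieval_unbi//.
  by rewrite -wE; exact: box_bieval.
exact: mul_ell0.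
Qed.

Lemma pair_of_relation y : vertex_relation r y -> exists p w,
  [/\ w \in Iseg (MS_at T true (val p)), w \in Iseg (MS_at T false (val p))
    & ideal_of y = sum_MIS (pair_at p w)].
Proof.
move=> [p0 [pI [rhoh [rhov [[hTT hh] [vT vh] hp vp [q]]]]]].
pose p := [` pI]%fset.
have hE : MS_at T true (val p) = rhoh.
  by have := MS_at_eq hT hred pI hTT hp; rewrite hh.
have vE : MS_at T false (val p) = rhov.
  by have := MS_at_eq hT hred pI vT vp; rewrite (negPf vh).
rewrite -!addrA -!opprD !(ksegE hT hr hrc)// => qB yE.
have [/subvP subh /subvP subv] := biR_sub_Bk (k_ rhoh) (k_ rhov) hh vh.
have qh := subh _ qB; have qv := subv _ qB.
pose P := ell_pow rhoh (k_ rhoh)%:Z * (ell_pow rhov (k_ rhov)%:Z * bieval q).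
have Pbox : box m.+1 m'.+1 P.
  rewrite /P box_ell hh box_ell (negPf vh).
  apply/(@mem_biR_box _ _ _ (m%:Z - (k_ rhov)%:Z) (m'%:Z - (k_ rhoh)%:Z));
    rewrite ?leq_subr//; lia.
have PE := bieval_unbi Pbox.
exists p, (unbi m m' P); rewrite hE vE; split.
- by apply/mem_Iseg; exists (ell_pow rhov (k_ rhov)%:Z * bieval q); rewrite PE.
- apply/mem_Iseg; exists (ell_pow rhoh (k_ rhoh)%:Z * bieval q).
  by rewrite PE /P mulrCA.
apply/ffunP => rho; rewrite sum_MIS_pair_at ffunE hE vE /mul_ell yE.
case: eqP => [->|_]; first by rewrite mulrCA.
case: eqP => [->|_]; last by apply/matrixP => i j; rewrite !mxE mulr0 !coef0.
by apply/matrixP => i j; rewrite !mxE mulrN !coefN.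
Qed.

Lemma relations_sub_M : (relations T r m m' <= M_space r m m' [set: MIS T]%SET)%VS.
Proof.
apply: vspan_sub => y [p0 [pI [rhoh [rhov [[hTT hh] [vT vh] hp vp [q]]]]]].
rewrite -!addrA -!opprD !(ksegE hT hr hrc)// => qB yE.
apply/mem_M_space => rho; rewrite inE.
have [/subvP subh /subvP subv] := biR_sub_Bk (k_ rhoh) (k_ rhov) hh vh.
have Pbox : box m.+1 m'.+1
    (ell_pow rhoh (k_ rhoh)%:Z * (ell_pow rhov (k_ rhov)%:Z * bieval q)).
  rewrite box_ell hh box_ell (negPf vh).
  apply/(@mem_biR_box _ _ _ (m%:Z - (k_ rhov)%:Z) (m'%:Z - (k_ rhoh)%:Z));
    rewrite ?leq_subr//; lia.
have rT := MIS_MS (valP rho); rewrite B_segE//; apply/mem_Bk; rewrite yE.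
case: eqP => [->|_]; first by rewrite mulrCA.
case: eqP => [->|_] i j ij; last by rewrite mulr0 !coef0.
by rewrite mulrN !coefN Pbox ?oppr0.
Qed.

Lemma mem_ideal_of_M (y : {ffun MIS T -> Rmm}) :
  (forall rho : MIS T, y rho \in Iseg (val rho)) <->
  exists2 x, x \in M_space r m m' [set: MIS T]%SET & y = ideal_of x.
Proof.
split=> [Iy|[x /mem_M_space xM ->] rho]; last first.
  rewrite ffunE; apply/mem_Iseg/divides_ell; exists (x rho) => //.
  by have := xM rho; rewrite inE B_segE//; exact/MIS_MS/valP.
have /choice[x xP] : forall rho : MIS T, exists q : Rmm,
    q \in Bk m m' (val rho) (k_ (val rho)) /\ y rho = mul_ell (val rho) (k_ (val rho)) q.
  by move=> rho; have /mem_Iseg/divides_ell[q qB E] := Iy rho; exists q.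
exists [ffun rho => x rho].
  apply/mem_M_space => rho; rewrite inE ffunE B_segE; last exact/MIS_MS/valP.
  exact: (xP rho).1.
by apply/ffunP => rho; rewrite !ffunE; exact: (xP rho).2.
Qed.

Lemma ideal_of_eq0 x : x \in M_space r m m' [set: MIS T]%SET -> ideal_of x = 0 -> x = 0.
Proof.
move=> /mem_M_space xM /ffunP x0; apply/ffunP => rho.
have := x0 rho; rewrite !ffunE => E.
apply: (mul_ell_inj (e := val rho) (k := k_ (val rho))).
- by have := xM rho; rewrite inE B_segE//; exact/MIS_MS/valP.
- exact: mem0v.
by rewrite E mul_ell0.
Qed.

End Relations.

(** * Deletion *)

Section BivariateSpan.
Context {R : realType} (m m' : nat).
Local Notation P2 := {poly {poly R}}.
Implicit Types (s : seq R) (k : R -> nat) (P : P2).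

Let span_s n s k B P : uniq s -> (n.+1 <= \sum_(a <- s) (n.+1 - k a))%N ->
  box n.+1 B P -> exists2 Q : R -> P2, (forall a, box (n.+1 - k a) B (Q a)) &
    P = \sum_(a <- s) (('X - a%:P) ^+ k a)%:P * Q a.
Proof.
move=> us le PB.
have /choice[q qP] : forall j, exists q : R -> {poly R},
    (forall a, (size (q a) <= n.+1 - k a)%N) /\
    P`_j = \sum_(a <- s) ('X - a%:P) ^+ k a * q a.
  move=> j; have [|q qs qE] := univariate_span us le (p := P`_j).
    by apply/leq_sizeP => i ni; rewrite PB ?ni.
  by exists q.
exists (fun a => \poly_(j < B) q j a) => [a i j ij|].
  rewrite coef_poly; case: ifP => jB; last by rewrite coef0.
  have {}ij : (n.+1 - k a <= i)%N by case/orP: ij => //; rewrite leqNgt jB.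
  by apply: nth_default; apply: leq_trans ij; exact: (qP j).1.
apply/polyP => j; rewrite coef_sum.
have [jB|jB] := ltnP j B.
  rewrite (qP j).2; apply: eq_bigr => a _.
  by rewrite coefCM coef_poly jB.
rewrite big1 => [|a _]; last by rewrite coefCM coef_poly ltnNge jB mulr0.
by apply/polyP => i; rewrite PB ?jB ?orbT// coef0.
Qed.

(** [h] is the direction of the segment to be deleted, and the [g a] cross it. For a horizontal one
    the interpolation runs in [s], coefficient by coefficient in [t]; swapping the variables gives
    the vertical case. *)
Lemma ell_span h s k (g : R -> lseg R) B P : uniq s ->
  {in s, forall a, lhor (g a) = ~~ h /\ lpos (g a) = a} ->
  let n := if h then m else m' in
  (n.+1 <= \sum_(a <- s) (n.+1 - k a))%N ->
  (if h then box m.+1 B P else box B m'.+1 P) ->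
  exists2 Q : R -> P2,
    (forall a, if h then box (m.+1 - k a) B (Q a) else box B (m'.+1 - k a) (Q a)) &
    P = \sum_(a <- s) ell_pow (g a) (k a)%:Z * Q a.
Proof.
case: h => us gP /= le PB.
  have [Q QB ->] := span_s us le PB; exists Q => //.
  rewrite big_seq [RHS]big_seq; apply: eq_bigr => a /gP[gh ga].
  by rewrite ell_pow_ver ?gh ?ga.
have [Q QB PE] := span_s us le ((box_swap _ _ _).2 PB).
exists (fun a => swapXY (Q a)) => [a|]; first exact/box_swap/QB.
rewrite -[P]swapXYK PE raddf_sum /= big_seq [RHS]big_seq.
apply: eq_bigr => a /gP[gh ga].
by rewrite ell_pow_hor ?gh ?ga// rmorphM /= -swap_ell_hor swapXYK.
Qed.

End BivariateSpan.

Section Deletion.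
Context {R : realType} (T : tmesh R).
Hypotheses (hT : is_tmesh T) (hred : reduced T).
Context (r : lseg R -> int).
Hypotheses (hr : smoothness T r) (hrc : constant_along_MS T r).
Context (m m' : nat).
Local Notation Rmm := (bipoly R m m').
Local Notation k_ := (kseg T r).
Implicit Types (rho sigma : MIS T) (A : {set MIS T}).

(** In the vertex relation of [q] the term on the crossing segment [tau] is absent if [tau] is no
    MIS, and otherwise lies in the span of the relations by hypothesis. Subtracting it leaves the
    term on [rho]. *)
Lemma vertex_relation_mem (rho : MIS T) p (q : Rmm) : p \in int_vertices T ->
  lseg_pts (val rho) p ->
  let h := lhor (val rho) in let tau := MS_at T (~~ h) p in
  (forall sigma b, val sigma = tau -> b \in B_seg T r m m' tau ->
     delta_ffun sigma b \in relations T r m m') ->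
  (if h then q \in biR m m' (m%:Z - (k_ tau)%:Z) (m'%:Z - (k_ (val rho))%:Z)
   else q \in biR m m' (m%:Z - (k_ (val rho))%:Z) (m'%:Z - (k_ tau)%:Z)) ->
  delta_ffun rho (mul_ell tau (k_ tau) q) \in relations T r m m'.
Proof.
move=> pI rp h tau hsig qB; have rT := MIS_MS (valP rho).
have [tT th tp] := MS_atP hT hred (~~ h) pI; rewrite -/tau in tT th tp.
pose y : {ffun MIS T -> Rmm} := [ffun rho' =>
  if val rho' == tau then mul_ell (val rho) (k_ (val rho)) (if h then q else - q)
  else if rho' == rho then mul_ell tau (k_ tau) (if h then - q else q) else 0].
have tau_rho : (val rho == tau) = false.
  by apply/eqP => E; have := congr1 (@lhor R) E; rewrite th /h; case: lhor.
have y_rel : vertex_relation r y.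
  exists p; split=> //.
  case hh : h qB => qB.
    have thN : ~~ lhor tau by rewrite th hh.
    have [/subvP sub1 /subvP sub2] := biR_sub_Bk m m' (k_ (val rho)) (k_ tau) hh thN.
    exists (val rho), tau; split=> //.
    rewrite -!addrA -!opprD !(ksegE hT hr hrc)//; exists q => // rho'.
    rewrite ffunE hh; case: eqP => [_|_]; first by rewrite bieval_mul_ell// sub1.
    rewrite -val_eqE; case: eqP => [_|_]; last exact: bieval0.
    by rewrite mul_ellN bievalN bieval_mul_ell// sub2.
  have rN : ~~ lhor (val rho) by rewrite -/h hh.
  have thh : lhor tau by rewrite th hh.
  have [/subvP sub1 /subvP sub2] := biR_sub_Bk m m' (k_ tau) (k_ (val rho)) thh rN.
  exists tau, (val rho); split=> //.
  rewrite -!addrA -!opprD !(ksegE hT hr hrc)//; exists q => // rho'.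
  rewrite ffunE hh -val_eqE; case: (val rho' =P val rho) => [->|_].
    by rewrite tau_rho bieval_mul_ell// sub1.
  case: eqP => [_|_]; last exact: bieval0.
  by rewrite mul_ellN bievalN bieval_mul_ell// sub2.
have y_in : y \in relations T r m m' by exact: sub_vspan.
have /mem_M_space yM : y \in M_space r m m' [set: MIS T]%SET.
  by apply: subvP y_in; exact: relations_sub_M.
have rest : \sum_(sigma | sigma != rho) delta_ffun sigma (y sigma) \in relations T r m m'.
  apply: memv_suml => sigma ne; have [E|ne'] := eqVneq (val sigma) tau.
    by apply: hsig => //; have := yM sigma; rewrite inE E.
  rewrite ffunE (negPf ne') (negPf ne); set z := delta_ffun _ _.
  by have -> : z = 0 by [apply/ffunP => l; rewrite !ffunE if_same]; rewrite mem0v.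
have yrho : y rho = mul_ell tau (k_ tau) (if h then - q else q).
  by rewrite ffunE tau_rho eqxx.
clearbody y; have : delta_ffun rho (y rho) \in relations T r m m'.
  suff -> : delta_ffun rho (y rho) =
      y - \sum_(sigma | sigma != rho) delta_ffun sigma (y sigma) by exact: memvB.
  by apply/eqP; rewrite eq_sym subr_eq {1}[y]ffun_sum_delta (bigD1 rho).
rewrite yrho; case: ifP => _ H; last exact: H.
rewrite -memvN; suff <- : delta_ffun rho (mul_ell tau (k_ tau) (- q)) =
  - delta_ffun rho (mul_ell tau (k_ tau) q) by exact: H.
by apply/ffunP => l; rewrite !ffunE mul_ellN; case: eqP => _; rewrite ?oppr0.
Qed.

Lemma mem_biR_sub_box (q : Rmm) a b :
  q \in biR m m' (m%:Z - a%:Z) (m'%:Z - b%:Z) <->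
  box (m.+1 - a) (m'.+1 - b) (bieval q).
Proof. by apply: mem_biR_box; rewrite ?leq_subr//; lia. Qed.

(** With [k = r + 1], the share [(m - r)_+] of a vertex in the weight is the truncated [m + 1 - k],
    the number of free coefficients of a cofactor of a [k]-th power. *)
Let truncated (n k : nat) (z : int) : z + 1 = k%:Z ->
  Num.max 0 (n%:Z - z) = (n.+1 - k)%N%:Z.
Proof. lia. Qed.

Lemma deletion_step (A : {set MIS T}) rho : rho \in A ->
  Defs.diagonalizable r m m' A rho ->
  (forall sigma b, sigma \notin A -> b \in B_seg T r m m' (val sigma) ->
     delta_ffun sigma b \in relations T r m m') ->
  forall b, b \in B_seg T r m m' (val rho) ->
    delta_ffun rho b \in relations T r m m'.
Proof.
move=> rA diag hsig b bB; have rM := valP rho; have rT := MIS_MS rM.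
set h := lhor (val rho) in diag.
(* Vertices on [rho] are encoded by their coordinate along [rho]; these coordinates are the
   interpolation nodes. *)
pose pt a : R * R := mkpt (fun c => if c == h then a else lpos (val rho)).
pose g a := MS_at T (~~ h) (pt a); pose k a := k_ (g a).
pose s := [seq co h p | p <- mono A rho].
have monoP p : p \in mono A rho -> [/\ p \in vertices T, lseg_pts (val rho) p
    & forall rho' : MIS T, rho' \in A :\ rho -> ~ lseg_pts (val rho') p].
  by rewrite [_ \in _]in_fset inE /= => /and3P[pT /asboolP rp /asboolP].
have ptE p : lseg_pts (val rho) p -> pt (co h p) = p.
  move=> /lseg_ptsP[pos _]; apply: (@co_inj2 _ h); rewrite co_mkpt ?eqxx//.
  by rewrite /h pos; case: lhor.
have us : uniq s.
  rewrite map_inj_in_uniq ?fset_uniq// => p p' /monoP[_ rp _] /monoP[_ rp' _] E.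
  by rewrite -(ptE p rp) -(ptE p' rp') E.
have gP : {in s, forall a, lhor (g a) = ~~ h /\ lpos (g a) = a}.
  move=> _ /mapP[p pm ->]; have [pT rp _] := monoP p pm.
  have pI := MIS_vertex hT rM pT rp.
  rewrite /g (ptE p rp); have [_ th /lseg_ptsP[tp _]] := MS_atP hT hred (~~ h) pI.
  by split=> //; rewrite -tp th negbK.
(* Weight at least threshold is exactly the counting hypothesis of [ell_span] at these nodes. *)
have le : ((if h then m else m').+1 <=
    \sum_(a <- s) ((if h then m else m').+1 - k a))%N.
  rewrite -lez_nat; move: diag; rewrite /Defs.diagonalizable /threshold /weight -/h.
  rewrite (_ : (if h then m.+1 else m'.+1) = (if h then m else m').+1 :> int);
    last by case: (h).
  move/le_trans; apply; rewrite big_map -natz natr_sum big_seq [leRHS]big_seq.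
  rewrite le_eqVlt; apply/orP; left; apply/eqP; apply: eq_bigr => p pm.
  have [pT rp _] := monoP p pm; have pI := MIS_vertex hT rM pT rp.
  have [tT _ _] := MS_atP hT hred (~~ h) pI.
  rewrite natz /k /g (ptE p rp) /mu_h /mu_v; have := ksegE hT hr hrc tT.
  by case: (h) {gP us} => /= /truncated.
pose kr := k_ (val rho); pose B := ((if h then m'.+1 else m.+1) - kr)%N.
have bbox : if h then box m.+1 B (bieval b) else box B m'.+1 (bieval b).
  move: bB; rewrite (B_segE hT hr hrc m m' rT) => /mem_Bk/box_ell.
  by rewrite -/h /B; case: (h).
have [Q QB bE] := ell_span us gP le bbox.
have Qbox a : box m.+1 m'.+1 (Q a).
  move=> i j ij; have := QB a; rewrite /B; case: (h) => H; apply: H;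
    by case/orP: ij => ij; rewrite ?(leq_trans _ ij) ?leq_subr ?orbT.
have -> : delta_ffun rho b =
    \sum_(a <- s) delta_ffun rho (mul_ell (g a) (k a) (unbi m m' (Q a))).
  have [D DE] := linfun_exists (@delta_ffun_linear _ (bipoly R m m') _ rho).
  rewrite -DE; under eq_bigr do rewrite -DE.
  rewrite -linear_sum; congr (D _).
  apply/matrixP => i j; rewrite -[b]unbi_bieval mxE bE !coef_sum summxE.
  by apply: eq_bigr => a _; rewrite mxE bieval_unbi.
rewrite big_seq; apply: memv_suml => _ /mapP[p pm ->].
have [pT rp no] := monoP p pm; have pI := MIS_vertex hT rM pT rp.
rewrite /k /g (ptE p rp).
have [tT th tp] := MS_atP hT hred (~~ h) pI.
(* A vertex in [mono A rho] lies on no other segment of [A], so a crossing MIS there is already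
   deleted and [hsig] covers it. *)
apply: (vertex_relation_mem pI rp) => [sigma c E|].
  rewrite -/h -E => cB; apply: hsig => //; apply/negP => sA.
  apply: (no sigma); last by rewrite E.
  rewrite !inE sA andbT; apply/eqP => sr.
  by have := congr1 (@lhor R) E; rewrite sr th -/h; case: (h).
rewrite -/h -/kr.
have := QB (co h p); rewrite /B /k /g (ptE p rp).
by case: (h) => H; apply/mem_biR_sub_box; rewrite bieval_unbi.
Qed.

(** Segments deleted in the same pass do not rely on each other: both still belong to [A], so the
    vertices counted for one avoid the other. Induction over passes therefore suffices. *)
Lemma deleted_in_relations n rho b :
  rho \notin iter n (deletion_pass r m m') [set: MIS T]%SET ->
  b \in B_seg T r m m' (val rho) -> delta_ffun rho b \in relations T r m m'.
Proof.
elim: n rho b => [|n IHn] rho b /=; first by rewrite inE.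
set A := iter n _ _ in IHn *.
have [rA|rA] := boolP (rho \in A); last by move=> _; exact: IHn.
rewrite /deletion_pass !inE rA /= andbT negbK => diag.
exact: (deletion_step rA diag IHn).
Qed.

(** Deleted segments contribute only relations, so M(CNDC) and the relations together span M(MIS),
    and the second isomorphism theorem applies. *)
Lemma dim_H_space_CNDC :
  \dim (H_space r m m' (CNDC T r m m')) =
  (\dim (M_space r m m' [set: MIS T]%SET) - \dim (relations T r m m'))%N.
Proof.
set A := CNDC T r m m'; set M := M_space r m m' [set: MIS T]%SET.
set W := relations T r m m'.
have full : (M_space r m m' A + W = M)%VS.
  apply/eqP; rewrite eqEsubv subv_add (relations_sub_M hT hr hrc) andbT.
  apply/andP; split; apply/subvP => x /mem_M_space xA.
    apply/mem_M_space => rho; have := xA rho; rewrite inE.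
    by case: ifP => _; rewrite ?memv0// => /eqP->; exact: mem0v.
  rewrite [x]ffun_sum_delta (bigID (mem A)) /=; apply: memv_add.
    apply: memv_suml => rho rA; apply/mem_M_space => sigma; rewrite ffunE.
    case: eqP => [->|_]; last exact: mem0v.
    by have := xA rho; rewrite inE rA.
  apply: memv_suml => rho rA; apply: deleted_in_relations rA _.
  by have := xA rho; rewrite inE.
rewrite /H_space /quotv /R_space.
have := dimv_cap_compl (M_space r m m' A) (M_space r m m' A :&: W).
have := dimv_sum_cap (M_space r m m' A) W; rewrite full -/W.
by rewrite capvA capvv; lia.
Qed.

End Deletion.

(** * Dimension count *)

Section DimensionFormula.
Context {R : realType} (T : tmesh R).
Hypotheses (hT : is_tmesh T) (hred : reduced T).
Context (r : lseg R -> int).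
Hypotheses (hr : smoothness T r) (hrc : constant_along_MS T r).
Context (m m' : nat).
Local Notation Rmm := (bipoly R m m').

Lemma dim_ffun (I : finType) (V : vectType R) :
  \dim {: {ffun I -> V}} = (\sum_(i : I) \dim {: V})%N.
Proof.
rewrite -(@dim_prodv _ V I (fun=> fullv)); congr (\dim _).
by apply/vspaceP => x; rewrite memvf; apply/esym/mem_prodv => i; exact: memvf.
Qed.

Lemma chiQE : chiQ T r m m' =
  (\dim {: {ffun cells T -> Rmm}})%:Z - (\dim {: {ffun int_edges T -> Rmm}})%:Z
  + (\dim {: {ffun int_vertices T -> Rmm}})%:Z
  + (\sum_(e : int_edges T) \dim (I_edge r m m' (val e)))%N%:Z
  - (\sum_(p : int_vertices T) \dim (I_vertex T r m m' (val p)))%N%:Z.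
Proof.
have quotE (U : {vspace Rmm}) : (\dim (quotv fullv U))%:Z = (\dim {: Rmm})%:Z - (\dim U)%:Z.
  by have := dimv_cap_compl fullv U; rewrite /quotv capfv => <-; rewrite PoszD addrAC subrr add0r.
have PoszS (I : finType) (F : I -> nat) : (\sum_i F i)%N%:Z = \sum_i (F i)%:Z.
  exact: (big_morph Posz PoszD (erefl _)).
rewrite /chiQ; under [X in _ - X]eq_bigr do rewrite quotE.
under [X in _ + X = _]eq_bigr do rewrite quotE.
rewrite !big_seq_fsetE /= !sumrB !dim_ffun !PoszS.
by ring.
Qed.

Lemma dim_spline_space :
  (\dim (spline_space T r m m'))%:Z = chiQ T r m m' +
  (\dim (M_space r m m' [set: MIS T]%SET) - \dim (relations T r m m'))%N%:Z.
Proof.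
have [D2 D2E] := linfun_exists (@d2_linear R T R Rmm).
have [D1 D1E] := linfun_exists (d1_linear hT hred (V := Rmm)).
have [P PE] := linfun_exists (@d1_split_linear R T R Rmm).
have [S SE] := linfun_exists (@sum_dir_linear R T R Rmm).
have [U UE] := linfun_exists (@sum_MIS_linear R T R Rmm).
have [D DE] := linfun_exists (@ideal_of_linear R T r m m').
set N := N_space T r m m'; set I := I_space T r m m'.
set M := M_space r m m' [set: MIS T]%SET; set W := relations T r m m'.
have [img2 img1 euler] := dim_complex hT hred D2E D1E.
have spline : spline_space T r m m' = (D2 @^-1: I)%VS.
  apply/vspaceP => f; rewrite -memv_preim D2E; apply/idP/idP.
    by move=> /(mem_spline_space hT hred) fI; apply/mem_prodv.
  by move=> /mem_prodv fI; apply/(mem_spline_space hT hred).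
have D1I : (D1 @: I = S @: (N :&: lker U))%VS.
  apply/vspaceP => y; apply/memv_imgP/memv_imgP => -[x].
    move=> xI ->; have [xN xU] := d1_split_N hT hred hr hrc xI.
    exists (d1_split x); last by rewrite D1E SE (d1E hT hred).
    by rewrite memv_cap xN memv_ker UE xU eqxx.
  rewrite memv_cap memv_ker UE => /andP[xN /eqP xU] ->.
  have [j jI xE] := N_d1_split hT hred hr hrc xN xU.
  by exists j => //; rewrite SE D1E (d1E hT hred) -xE.
have SN : (S @: N = prodv (fun p : int_vertices T => I_vertex T r m m' (val p)))%VS.
  apply/vspaceP => y; apply/memv_imgP/idP.
    move=> [x xN ->]; apply/mem_prodv/(mem_sum_dir hT hred hr hrc).
    by exists x; rewrite ?SE.
  move=> /mem_prodv/(mem_sum_dir hT hred hr hrc)[x xN ->].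
  by exists x; rewrite ?SE.
have UN : (U @: N = D @: M)%VS.
  apply/vspaceP => y; apply/memv_imgP/memv_imgP => -[x xN ->].
    have /(mem_ideal_of_M hT hr hrc)[z zM zE] : forall rho : MIS T,
        U x rho \in Iseg T r m m' (val rho).
      by apply/(mem_sum_MIS hT hred); exists x; rewrite ?UE.
    by exists z => //; rewrite DE.
  have /(mem_sum_MIS hT hred)[z zN zE] : forall rho : MIS T,
      D x rho \in Iseg T r m m' (val rho).
    by apply/(mem_ideal_of_M hT hr hrc); exists x; rewrite ?DE.
  by exists z => //; rewrite UE.
have UK : (U @: (N :&: lker S) = D @: W)%VS.
  apply/eqP; rewrite eqEsubv; apply/andP; split.
    apply/subvP => _ /memv_imgP[x + ->].
    rewrite memv_cap memv_ker SE => /andP[/mem_prodv xN /eqP/ffunP xS].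
    have opp (p : int_vertices T) : x (p, true) = - x (p, false).
      by apply/eqP; rewrite -addr_eq0; have := xS p; rewrite !ffunE => ->.
    have -> : x = \sum_(p : int_vertices T) pair_at p (x (p, false)).
      apply/ffunP => -[p h]; rewrite sum_ffunE (bigD1 p)//= big1 => [|q qp].
        by rewrite addr0 ffunE eqxx /=; case: h; rewrite ?opp.
      by rewrite ffunE /= eq_sym (negPf qp).
    rewrite linear_sum; apply: memv_suml => p _; rewrite /= UE.
    have [||y yR <-] := relation_of_pair hT hred hr hrc (p := p) (w := x (p, false)).
    - by rewrite -memvN -opp; exact: (xN (p, true)).
    - exact: (xN (p, false)).
    by rewrite -DE memv_img// sub_vspan.
  have sub : (W <= D @^-1: (U @: (N :&: lker S)))%VS.
    apply: vspan_sub => y /(pair_of_relation hT hred hr hrc)[p [w [wh wv yE]]].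
    rewrite -memv_preim DE yE -UE memv_img// memv_cap memv_ker SE.
    apply/andP; split.
      apply/mem_prodv => -[q h]; rewrite ffunE /=.
      case: eqP => [->|_]; last exact: mem0v.
      by case: h; [rewrite memvN; exact: wh|exact: wv].
    apply/eqP/ffunP => q; rewrite !ffunE /=.
    by case: eqP => _; rewrite ?addNr ?addr0.
  by apply/subvP => _ /memv_imgP[x xW ->]; rewrite memv_preim (subvP sub).
have kerD : (M :&: lker D = 0)%VS.
  apply/eqP; rewrite -subv0; apply/subvP => x; rewrite memv_cap memv_ker memv0 DE.
  by move=> /andP[xM /eqP x0]; apply/eqP; exact: (ideal_of_eq0 hT hr hrc xM).
have WM : (W <= M)%VS by exact: relations_sub_M.
have dimM := limg_dim_eq kerD.
have dimW : \dim (D @: W) = \dim W.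
  by apply: limg_dim_eq; apply/eqP; rewrite -subv0 -kerD capvS.
have exchange := dim_img_ker S U N.
rewrite UN UK dimM dimW -D1I in exchange.
have kerI := limg_ker_dim D1 I.
rewrite chiQE spline dim_preimg img2 -(dim_prodv (fun e : int_edges T => _)).
rewrite -(dim_prodv (fun p : int_vertices T => _)) -/(I_space T r m m') -/I -SN.
(* [k] and [y] are the dimensions of the kernel of [d2] and of the cycles in the edge ideals, and
   [x] that of the image of these ideals under [d1]; [s - x = l - w] equates the two cokernels. *)
have arith (a b c k s w l x y i : nat) : (a + c = b + k)%N -> (s + w = l + x)%N ->
    (y + x = i)%N -> (w <= l)%N ->
    (k + y)%N%:Z = a%:Z - b%:Z + c%:Z + i%:Z - s%:Z + (l - w)%N%:Z by lia.
exact: arith euler exchange kerI (dimvS WM).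
Qed.


End DimensionFormula.

Theorem theorem3p19 (R : realType) (T : tmesh R) (hT : is_tmesh T)
    (hred : reduced T) (r : lseg R -> int) (hr : smoothness T r)
    (hrc : constant_along_MS T r) (m m' : nat) :
  (\dim (spline_space T r m m'))%:Z =
    chiQ T r m m' + (\dim (H_space r m m' (CNDC T r m m')))%:Z.
Proof. by rewrite (dim_spline_space hT hred hr hrc) (dim_H_space_CNDC hT hred hr hrc). Qed.
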